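(* Let $\Omega\subset\mathbb{R}^2$ be a bounded domain containing $[c_1,c_2]$, whose boundary is a simple closed curve of class $\mathcal{C}^1$ which is not an ellipse with foci $c_1,c_2$, and let $h\ge0$. Let the interval $I=[\theta_-,\theta_+]$, the base point $\theta_0\notin I$, the threshold $k_0$ and the alphabet $\mathcal{S}=\{k\in\mathbb{N}: k\ge k_0\}$ be chosen as described in the context. Then for every bi-infinite sequence $\sigma\in\mathcal{S}^{\mathbb{Z}}$ there exists a complete billiard trajectory at energy $h$ in $\Omega$, with impact points $\gamma(\theta_i)$, $i\in\mathbb{Z}$, all of whose impact parameters $\theta_i$ lie in $I$, and whose $i$-th arc (from $\gamma(\theta_i)$ to $\gamma(\theta_{i+1})$) is $s_{\sigma_i,\theta_0}^{\theta_i,\theta_{i+1}}$; in particular it winds $\sigma_i$ times around $[c_1,c_2]$ between the $i$-th and the $(i+1)$-th impact.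
   Context: Setting. $m_1\ge m_2>0$, $\mu_1=m_1+m_2$, $\mu_2=m_1-m_2$; the centres are normalised as $c_1=(-1,0)$, $c_2=(1,0)$; $r_i=|x-c_i|$, $U=\frac{m_1}{r_1}+\frac{m_2}{r_2}$. Energy-$h$ trajectories are solutions of $\ddot x=\nabla U(x)$ with $\frac12|\dot x|^2-U=h$. Let $\mathcal{C}=\mathbb{R}\times\mathbb{R}/2\pi\mathbb{Z}$, $\Phi(\xi,\eta)=(\cosh\xi\cos\eta,\sinh\xi\sin\eta)$, which maps $\{\xi>0\}$ diffeomorphically onto $\mathbb{R}^2\setminus[c_1,c_2]$. Set $W_1(\xi)=(\mu_1+h\cosh\xi)\cosh\xi$, $W_2(\eta)=(\mu_2+h\cos\eta)\cos\eta$, $a(\xi)=\sqrt{2(W_1(\xi)-\mu_1-h)}$, $b(\eta)=\sqrt{2(\mu_1+h-W_2(\eta))}$ and, on $\{\xi>0\}$, $X^h_\pm=(-a(\xi),\pm b(\eta))$. The Jacobi–Maupertuis metric is $g_h=2(h+U)(dx_1^2+dx_2^2)$; $\mathcal{L}_h$ is its length. $\hat X^h_\pm$ denotes the push-forward of $X^h_\pm$ by $\Phi$, normalised to $g_h$-norm $1$. Boundary. $\gamma:\mathbb{S}^1\to\partial\Omega$ is a regular $\mathcal{C}^1$ counterclockwise parametrisation; $f(\theta)=\frac12(|\gamma(\theta)-c_1|+|\gamma(\theta)-c_2|)$, $\bar f=\min f$. Arcs. For $\theta_0\in\mathbb{S}^1$, $k\in\mathbb{Z}\setminus\{0\}$,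 $\theta_1,\theta_2\in\mathbb{S}^1\setminus\{\theta_0\}$, $s_{k,\theta_0}^{\theta_1,\theta_2}$ is the unique minimiser of $\mathcal{L}_h$ among curves in $\mathbb{R}^2\setminus[c_1,c_2]$ from $\gamma(\theta_1)$ to $\gamma(\theta_2)$ whose concatenation with the arc of $\gamma$ from $\theta_2$ to $\theta_1$ not containing $\theta_0$ is homotopic to $\gamma^k$ in $\mathbb{R}^2\setminus[c_1,c_2]$ ($k$ counterclockwise turns around the segment). It is, up to reparametrisation, an energy-$h$ trajectory. Put $S^k_{\theta_0}(\theta_1,\theta_2)=\mathcal{L}_h(s_{k,\theta_0}^{\theta_1,\theta_2})$. Choices. (1) $\delta_0>0$ and $k_1\in\mathbb{N}$ depend only on $h,m_1,m_2,\Omega$ and are such that, whenever $0<\delta<\delta_0$, $I=[\theta_-,\theta_+]$ satisfies $( * )$: $f'(\theta_-)<0<f'(\theta_+)$, $\max_I|f'|<\delta$, $\max_I f\le\bar f+\delta$, and $\theta_0\notin I$, then for all $\theta_1,\theta_2\in I$, $|k|\ge k_1$ the arc $s_{k,\theta_0}^{\theta_1,\theta_2}$ is contained in $\overline\Omega$, meets $\partial\Omega$ only at its endpoints, and does so transversally (such constants exist). (2) Some $\delta<\delta_0$, an interval $I$ satisfying $( * )$ and a point $\theta_0\notin I$ are fixed. (3) With $\Upsilon(\theta)=-\langle\hat X^h_++\hat X^h_-,\dot\gamma(\theta)\rangle_{g_h}$ (a positive multiple of $f'(\theta)$), set $2\varepsilon=\min\{|\Upsilon(\theta_-)|,|\Upsilon(\theta_+)|\}>0$.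 (4) $k_0\ge k_1$ is an integer such that for every $k\ge k_0$: $\sup_{(\theta_1,\theta_2)\in I\times I}\left|\partial_1S^k_{\theta_0}(\theta_1,\theta_2)+\langle\hat X^h_+,\dot\gamma(\theta_1)\rangle_{g_h}\right|+\left|\partial_2S^k_{\theta_0}(\theta_1,\theta_2)+\langle\hat X^h_-,\dot\gamma(\theta_2)\rangle_{g_h}\right|\le\varepsilon/2$ (such $k_0$ exists). A complete billiard trajectory is a bi-infinite concatenation of energy-$h$ trajectory arcs contained in $\overline\Omega$, meeting $\partial\Omega$ transversally exactly at their endpoints, with consecutive arcs related by elastic reflection (tangential velocity preserved, normal velocity reversed). *)

(* Defs.v *)
From Stdlib Require Export Reals ZArith ClassicalEpsilon.
From Coquelicot Require Export Coquelicot.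
Open Scope R_scope.

Definition plane : Type := (R * R)%type.

Definition dot (u v : plane) : R := fst u * fst v + snd u * snd v.
Definition enorm (u : plane) : R := sqrt (dot u u).
Definition edist (p q : plane) : R := enorm (fst p - fst q, snd p - snd q).
Definition rot90 (u : plane) : plane := (- snd u, fst u).

Definition c1 : plane := (-1, 0).
Definition c2 : plane := (1, 0).

Definition on_segment (p : plane) : Prop := -1 <= fst p <= 1 /\ snd p = 0.
Definition off_segment (p : plane) : Prop := ~ on_segment p.

Definition closure (D : plane -> Prop) (p : plane) : Prop :=
  forall eps : posreal, exists q, ball p eps q /\ D q.

Definition boundary (D : plane -> Prop) (p : plane) : Prop :=
  closure D p /\ closure (fun q => ~ D q) p.

(* For open D, the sets A and B below are open in the plane. *)
Definition open_connected (D : plane -> Prop) : Prop :=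
  open D /\ (exists p, D p) /\
  forall A B : plane -> Prop, open A -> open B ->
    (forall p, D p <-> A p \/ B p) -> (forall p, ~ (A p /\ B p)) ->
    (forall p, ~ A p) \/ (forall p, ~ B p).

Definition bounded_domain (D : plane -> Prop) : Prop :=
  open_connected D /\ exists M, forall p, D p -> enorm p <= M.

Definition unit_interval (t : R) : Prop := 0 <= t <= 1.

(* Free homotopy of loops [0,1] -> D through loops in D. *)
Definition homotopic_in (D : plane -> Prop) (u v : R -> plane) : Prop :=
  exists H : R * R -> plane,
    continuous_on (fun q : R * R => unit_interval (fst q) /\ unit_interval (snd q)) H /\
    (forall s t, unit_interval s -> unit_interval t -> D (H (s, t))) /\
    (forall t, unit_interval t -> H (0, t) = u t /\ H (1, t) = v t) /\
    (forall s, unit_interval s -> H (s, 0) = H (s, 1)).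

Definition velocity (c : R -> plane) (t : R) : plane :=
  (Derive (fun u => fst (c u)) t, Derive (fun u => snd (c u)) t).

Definition C1_curve (c : R -> plane) : Prop :=
  forall t, is_derive c t (velocity c t) /\ continuous (velocity c) t.

(* A curve on the time interval [0, dur]; values of pos elsewhere are irrelevant
   (except that two-sided derivatives at 0 and dur see a neighbourhood). *)
Record curve : Type := Curve { dur : R; pos : R -> plane }.

Definition piecewise_C1 (c : curve) : Prop :=
  exists (n : nat) (a : nat -> R),
    a 0%nat = 0 /\ a n = dur c /\
    forall i, (i < n)%nat ->
      a i < a (S i) /\
      exists d : R -> plane, C1_curve d /\
        forall t, a i <= t <= a (S i) -> pos c t = d t.

Definition U (m1 m2 : R) (p : plane) : R := m1 / edist p c1 + m2 / edist p c2.

Definition gradU (m1 m2 : R) (p : plane) : plane :=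
  (Derive (fun x => U m1 m2 (x, snd p)) (fst p),
   Derive (fun y => U m1 m2 (fst p, y)) (snd p)).

Definition energy_trajectory (m1 m2 h : R) (c : curve) : Prop :=
  0 < dur c /\
  forall t, 0 <= t <= dur c ->
    pos c t <> c1 /\ pos c t <> c2 /\
    is_derive (pos c) t (velocity (pos c) t) /\
    is_derive (velocity (pos c)) t (gradU m1 m2 (pos c t)) /\
    / 2 * dot (velocity (pos c) t) (velocity (pos c) t) - U m1 m2 (pos c t) = h.

Definition g_inner (m1 m2 h : R) (p u v : plane) : R :=
  2 * (h + U m1 m2 p) * dot u v.

Definition g_norm (m1 m2 h : R) (p u : plane) : R := sqrt (g_inner m1 m2 h p u u).

Definition jacobi_length (m1 m2 h : R) (c : curve) : R :=
  RInt (fun t => g_norm m1 m2 h (pos c t) (velocity (pos c) t)) 0 (dur c).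

Definition Phi (q : R * R) : plane :=
  (cosh (fst q) * cos (snd q), sinh (fst q) * sin (snd q)).

(* Phi is a bijection from {xi > 0}, eta taken modulo 2 PI, onto the complement of
   the segment; every use below is 2 PI-periodic in eta. *)
Definition Phi_inv (p : plane) : R * R :=
  epsilon (inhabits (0, 0)) (fun q => 0 < fst q /\ Phi q = p).

Definition dPhi (q v : R * R) : plane :=
  (sinh (fst q) * cos (snd q) * fst v - cosh (fst q) * sin (snd q) * snd v,
   cosh (fst q) * sin (snd q) * fst v + sinh (fst q) * cos (snd q) * snd v).

Definition W1 (m1 m2 h xi : R) : R := ((m1 + m2) + h * cosh xi) * cosh xi.
Definition W2 (m1 m2 h eta : R) : R := ((m1 - m2) + h * cos eta) * cos eta.

Definition a_fun (m1 m2 h xi : R) : R := sqrt (2 * (W1 m1 m2 h xi - (m1 + m2) - h)).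
Definition b_fun (m1 m2 h eta : R) : R := sqrt (2 * ((m1 + m2) + h - W2 m1 m2 h eta)).

(* sgn = 1 gives X_+, sgn = -1 gives X_-. *)
Definition X_field (m1 m2 h sgn : R) (q : R * R) : R * R :=
  (- a_fun m1 m2 h (fst q), sgn * b_fun m1 m2 h (snd q)).

Definition hatX (m1 m2 h sgn : R) (p : plane) : plane :=
  let v := dPhi (Phi_inv p) (X_field m1 m2 h sgn (Phi_inv p)) in
  (fst v / g_norm m1 m2 h p v, snd v / g_norm m1 m2 h p v).

Definition hatX_plus (m1 m2 h : R) : plane -> plane := hatX m1 m2 h 1.
Definition hatX_minus (m1 m2 h : R) : plane -> plane := hatX m1 m2 h (-1).

(* The circle is R/2 PI Z, and gam a 2 PI-periodic map.  Counterclockwise means one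
   positive turn around the segment, i.e. homotopic in its complement to the
   positively oriented circle of radius 2. *)
Definition ccw_boundary_param (Om : plane -> Prop) (gam : R -> plane) : Prop :=
  C1_curve gam /\
  (forall t, velocity gam t <> (0, 0)) /\
  (forall t, gam (t + 2 * PI) = gam t) /\
  (forall t t', gam t = gam t' -> exists n : Z, t' = t + 2 * PI * IZR n) /\
  (forall p, boundary Om p <-> exists t, gam t = p) /\
  homotopic_in off_segment
    (fun t => gam (2 * PI * t))
    (fun t => (2 * cos (2 * PI * t), 2 * sin (2 * PI * t))).

Definition is_focal_ellipse (E : plane -> Prop) : Prop :=
  exists a, 1 < a /\ forall p, E p <-> edist p c1 + edist p c2 = 2 * a.

Definition f_gam (gam : R -> plane) (t : R) : R :=
  / 2 * (edist (gam t) c1 + edist (gam t) c2).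

(* The circle minus theta0 is identified with (th0, th0 + 2 PI): points and intervals
   of the circle avoiding theta0 are represented there, and the arc of gam between
   two such points that does not contain theta0 is the image of the real segment
   between their representatives. *)
Definition in_cut_circle (th0 t : R) : Prop := th0 < t < th0 + 2 * PI.

(* First c, then the arc of gam from th2 to th1; meant for th1, th2 in
   (th0, th0 + 2 PI), for some th0. *)
Definition close_up (gam : R -> plane) (th1 th2 : R) (c : curve) (t : R) : plane :=
  if Rle_dec t (/ 2) then pos c (2 * t * dur c)
  else gam (th2 + (2 * t - 1) * (th1 - th2)).

Definition power_loop (gam : R -> plane) (k : Z) (t : R) : plane :=
  gam (2 * PI * IZR k * t).

Definition winds (gam : R -> plane) (k : Z) (th1 th2 : R) (c : curve) : Prop :=
  homotopic_in off_segment (close_up gam th1 th2 c) (power_loop gam k).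

Definition competitor (gam : R -> plane) (k : Z) (th1 th2 : R) (c : curve) : Prop :=
  0 < dur c /\ piecewise_C1 c /\
  (forall t, 0 <= t <= dur c -> off_segment (pos c t)) /\
  pos c 0 = gam th1 /\ pos c (dur c) = gam th2 /\
  winds gam k th1 th2 c.

Definition minimiser (m1 m2 h : R) (gam : R -> plane) (k : Z) (th1 th2 : R)
    (c : curve) : Prop :=
  competitor gam k th1 th2 c /\
  forall c', competitor gam k th1 th2 c' ->
    jacobi_length m1 m2 h c <= jacobi_length m1 m2 h c'.

Definition reparametrisation_of (c c' : curve) : Prop :=
  exists phi : R -> R,
    continuous_on (fun t => 0 <= t <= dur c') phi /\
    (forall t t', 0 <= t -> t <= t' -> t' <= dur c' -> phi t <= phi t') /\
    phi 0 = 0 /\ phi (dur c') = dur c /\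
    forall t, 0 <= t <= dur c' -> pos c' t = pos c (phi t).

(* c is the unique minimiser, in its parametrisation as an energy-h trajectory. *)
Definition is_arc (m1 m2 h : R) (gam : R -> plane) (k : Z) (th1 th2 : R)
    (c : curve) : Prop :=
  energy_trajectory m1 m2 h c /\
  minimiser m1 m2 h gam k th1 th2 c /\
  forall c', minimiser m1 m2 h gam k th1 th2 c' -> reparametrisation_of c c'.

(* s k th0 th1 th2 is the minimising arc with k turns, for k <> 0 and
   th1, th2 in the circle minus th0. *)
Definition arc_family : Type := Z -> R -> R -> R -> curve.

Definition minimising_arcs (m1 m2 h : R) (gam : R -> plane) (s : arc_family) : Prop :=
  forall (k : Z) (th0 th1 th2 : R), k <> 0%Z ->
    in_cut_circle th0 th1 -> in_cut_circle th0 th2 ->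
    is_arc m1 m2 h gam k th1 th2 (s k th0 th1 th2).

Definition S_len (m1 m2 h : R) (s : arc_family) (k : Z) (th0 th1 th2 : R) : R :=
  jacobi_length m1 m2 h (s k th0 th1 th2).

Definition billiard_arc (Om : plane -> Prop) (gam : R -> plane) (th1 th2 : R)
    (c : curve) : Prop :=
  pos c 0 = gam th1 /\ pos c (dur c) = gam th2 /\
  (forall t, 0 <= t <= dur c -> closure Om (pos c t)) /\
  (forall t, 0 < t < dur c -> ~ boundary Om (pos c t)) /\
  dot (velocity (pos c) 0) (rot90 (velocity gam th1)) <> 0 /\
  dot (velocity (pos c) (dur c)) (rot90 (velocity gam th2)) <> 0.

Definition in_I (tm tp t : R) : Prop := tm <= t <= tp.

(* f_gam gam tb is the minimum of f. *)
Definition star (gam : R -> plane) (delta tm tp : R) : Prop :=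
  tm < tp /\
  Derive (f_gam gam) tm < 0 < Derive (f_gam gam) tp /\
  (forall t, in_I tm tp t -> Rabs (Derive (f_gam gam) t) < delta) /\
  exists tb, (forall t, f_gam gam tb <= f_gam gam t) /\
    forall t, in_I tm tp t -> f_gam gam t <= f_gam gam tb + delta.

(* theta0 is not in I = [tm, tp], I being represented in (th0, th0 + 2 PI). *)
Definition base_point_outside (th0 tm tp : R) : Prop :=
  in_cut_circle th0 tm /\ in_cut_circle th0 tp.

Definition inside_thresholds (Om : plane -> Prop) (gam : R -> plane) (s : arc_family)
    (delta0 : R) (k1 : nat) : Prop :=
  0 < delta0 /\ (0 < k1)%nat /\
  forall delta tm tp th0, 0 < delta < delta0 ->
    star gam delta tm tp -> base_point_outside th0 tm tp ->
    forall (th1 th2 : R) (k : Z), in_I tm tp th1 -> in_I tm tp th2 ->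
      (Z.of_nat k1 <= Z.abs k)%Z ->
      billiard_arc Om gam th1 th2 (s k th0 th1 th2).

Definition Upsilon (m1 m2 h : R) (gam : R -> plane) (t : R) : R :=
  - (g_inner m1 m2 h (gam t) (hatX_plus m1 m2 h (gam t)) (velocity gam t) +
     g_inner m1 m2 h (gam t) (hatX_minus m1 m2 h (gam t)) (velocity gam t)).

Definition derivative_threshold (m1 m2 h : R) (gam : R -> plane) (s : arc_family)
    (tm tp th0 eps : R) (k0 : nat) : Prop :=
  forall (k : nat) (th1 th2 : R), (k0 <= k)%nat -> in_I tm tp th1 -> in_I tm tp th2 ->
    exists d1 d2 : R,
      is_derive (fun t => S_len m1 m2 h s (Z.of_nat k) th0 t th2) th1 d1 /\
      is_derive (fun t => S_len m1 m2 h s (Z.of_nat k) th0 th1 t) th2 d2 /\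
      Rabs (d1 + g_inner m1 m2 h (gam th1)
                   (hatX_plus m1 m2 h (gam th1)) (velocity gam th1)) +
      Rabs (d2 + g_inner m1 m2 h (gam th2)
                   (hatX_minus m1 m2 h (gam th2)) (velocity gam th2)) <= eps / 2.

Definition elastic_reflection (gam : R -> plane) (t : R) (vin vout : plane) : Prop :=
  dot vout (velocity gam t) = dot vin (velocity gam t) /\
  dot vout (rot90 (velocity gam t)) = - dot vin (rot90 (velocity gam t)).

Definition complete_billiard_trajectory (m1 m2 h : R) (Om : plane -> Prop)
    (gam : R -> plane) (th : Z -> R) (x : Z -> curve) : Prop :=
  forall i : Z,
    energy_trajectory m1 m2 h (x i) /\
    billiard_arc Om gam (th i) (th (i + 1)%Z) (x i) /\
    elastic_reflection gam (th (i + 1)%Z)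
      (velocity (pos (x i)) (dur (x i))) (velocity (pos (x (i + 1)%Z)) 0).

(* Main.v *)
Require Import Defs.
From Stdlib Require Import Psatz List.

(** The approximate formulas for the partial derivatives of the action [S^k] say that, up to
    [eps], the derivative in the middle variable of [S^k (x, t) + S^l (t, y)] is [Upsilon t],
    which has the sign of [f'].  It is therefore negative at [tm] and positive at [tp], so a
    sequence in [I^Z] minimising every such two-term sum with respect to its middle entry stays
    in the interior of [I] and is critical.  Such a sequence is a cluster point, for the product
    topology, of approximate minimisers of longer and longer finite sums.

    Only inequalities are needed for the first variation of length: replacing the piece of a
    minimiser on a time interval of length [K s] by a chord whose free end has slid by [s] along
    the boundary gives a competitor, hence an upper bound for the derivative of [S]; letting [K]
    tend to infinity, for both signs of [s], identifies it with the tangential velocity.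
    Criticality thus gives equal tangential velocities at an impact, and the energy relation
    gives opposite or equal normal ones.  Equal ones would place [Omega] on both sides of its
    boundary near the impact point, and by connectedness of the circle near all boundary
    points; then the closure of [Omega] would be open, although it is bounded. *)

(** Passing to a limit of near-minimisers requires continuity of [S] in both endpoints jointly,
    whereas only partial derivatives are given. Their identification with tangential velocities also
    bounds them, since the energy relation fixes the speed at each boundary point; so [S] is
    Lipschitz on the square of [I]. The sum over all of Z need not converge, hence minimality is
    tested one entry at a time.

    The chord needs the extra parameter [K]. With boundary velocity g and arc velocity v, a fixed
    [K] yields the slope |v| |K v - g| - K |v|^2, which by Cauchy-Schwarz is at least - v . g and in
    general strictly larger; the excess disappears only as [K] grows. Differentiability of [S] is
    part of the threshold hypothesis, so right-hand slopes in two opposite directions determine each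
    partial derivative.

    At the ends of [I] the modulus of [Upsilon] is at least 2 [eps], against a total error [eps]:
    this margin keeps the minimiser inside. The two sides of the boundary are separated only
    locally, by parallel segments transverse to the curve, so the Jordan curve theorem is never
    invoked. *)

(** * Membership in an open set along paths off its boundary *)

(** Connectedness of an interval: the supremum of the points satisfying [P] satisfies [P] by local
    constancy, and cannot lie before [b] because [P] persists a little to its right. *)
Lemma locally_constant_on_segment (P : R -> Prop) (a b : R) :
  a <= b ->
  (forall t, a <= t <= b -> exists d : posreal, forall t', a <= t' <= b ->
     Rabs (t' - t) < d -> (P t' <-> P t)) ->
  P a -> P b.
Proof.
intros Hab Hloc Ha.
destruct (completeness (fun t => a <= t <= b /\ P t)) as [m [Hub Hlub]].
- exists b; intros t [Ht _]; lra.
- exists a; split; [lra | exact Ha].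
- assert (Ham : a <= m) by (apply Hub; split; [lra | exact Ha]).
  assert (Hmb : m <= b) by (apply Hlub; intros t [Ht _]; lra).
  destruct (Hloc m (conj Ham Hmb)) as [d Hd].
  pose proof (cond_pos d) as Hd0.
  assert (Pm : P m).
  { apply NNPP; intro Hn.
    assert (m <= m - d); [| lra].
    apply Hlub; intros t [Ht Pt].
    destruct (Rle_dec t (m - d)) as [| Hgt]; [assumption | exfalso].
    assert (t <= m) by (apply Hub; split; assumption).
    apply Hn, (Hd t Ht); [apply Rabs_def1; lra | exact Pt]. }
  destruct (Rle_lt_or_eq_dec _ _ Hmb) as [Hlt | <-]; [| exact Pm].
  exfalso.
  pose (t := Rmin b (m + d / 2)).
  assert (Ht : m < t <= m + d / 2 /\ t <= b).
  { unfold t; repeat split; [apply Rmin_glb_lt; lra | apply Rmin_r | apply Rmin_l]. }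
  assert (t <= m); [| lra].
  apply Hub; split; [lra |].
  apply Hd; [lra | apply Rabs_def1; lra | exact Pm].
Qed.

Lemma closure_incl (D : plane -> Prop) (p : plane) : D p -> closure D p.
Proof. intros Hp eps; exists p; split; [apply ball_center | exact Hp]. Qed.

Lemma closure_not_boundary (D : plane -> Prop) (p : plane) :
  closure D p -> ~ boundary D p -> D p.
Proof.
intros Hc Hb; apply NNPP; intro Hn.
apply Hb; split; [exact Hc | apply (closure_incl (fun q => ~ D q)), Hn].
Qed.

Lemma not_closure_ball (D : plane -> Prop) (p : plane) :
  ~ closure D p -> exists eps : posreal, forall q, ball p eps q -> ~ D q.
Proof.
intro Hn; apply NNPP; intro Hall; apply Hn; intro eps.
apply NNPP; intro Hno; apply Hall; exists eps; intros q Hq Dq.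
apply Hno; exists q; split; assumption.
Qed.

Lemma off_boundary_locally (D : plane -> Prop) (p : plane) :
  open D -> ~ boundary D p -> locally p (fun q => D q <-> D p).
Proof.
intros HD Hb; destruct (classic (D p)) as [Dp | Np].
- generalize (HD p Dp); apply filter_imp; intros q Dq; tauto.
- destruct (not_closure_ball D p) as [eps He].
  { intro Hc; apply Np, closure_not_boundary; assumption. }
  exists eps; intros q Hq; specialize (He q Hq); tauto.
Qed.

(** Off the boundary of an open set, both membership and non-membership are open conditions, so
    neither can change along the path. This is how the sides of the boundary curve are told
    apart. *)
Lemma path_off_boundary (D : plane -> Prop) (c : R -> plane) (a b : R) :
  open D -> a <= b ->
  (forall t, a <= t <= b -> continuous c t /\ ~ boundary D (c t)) ->
  (D (c a) -> D (c b)).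
Proof.
intros HD Hab Hc; apply (locally_constant_on_segment (fun t => D (c t)) a b Hab).
intros t Ht; destruct (Hc t Ht) as [Hct Hbt].
destruct (Hct _ (off_boundary_locally D (c t) HD Hbt)) as [d Hd].
exists d; intros t' _ Htt'; apply Hd; exact Htt'.
Qed.

(** * Plane curves and the normal tube of the boundary *)

Lemma is_derive_fst (c : R -> plane) (t : R) (l : plane) :
  is_derive c t l -> is_derive (fun u => fst (c u)) t (fst l).
Proof.
intro H; apply (filterdiff_comp c fst (fun y => scal y l) fst H).
apply filterdiff_linear, is_linear_fst.
Qed.

Lemma is_derive_snd (c : R -> plane) (t : R) (l : plane) :
  is_derive c t l -> is_derive (fun u => snd (c u)) t (snd l).
Proof.
intro H; apply (filterdiff_comp c snd (fun y => scal y l) snd H).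
apply filterdiff_linear, is_linear_snd.
Qed.

Lemma is_derive_dot (c : R -> plane) (w : plane) (t : R) (l : plane) :
  is_derive c t l -> is_derive (fun u => dot (c u) w) t (dot l w).
Proof.
intro H; unfold dot.
pose proof (is_derive_fst _ _ _ H) as H1; pose proof (is_derive_snd _ _ _ H) as H2.
apply (is_derive_plus (fun u => fst (c u) * fst w) (fun u => snd (c u) * snd w)).
- apply (is_derive_ext (fun u => fst w * fst (c u))); [intro; apply Rmult_comm |].
  rewrite Rmult_comm; apply is_derive_scal, H1.
- apply (is_derive_ext (fun u => snd w * snd (c u))); [intro; apply Rmult_comm |].
  rewrite Rmult_comm; apply is_derive_scal, H2.
Qed.

Lemma continuous_pair {T : UniformSpace} (f g : T -> R) (x : T) :
  continuous f x -> continuous g x -> continuous (fun y => (f y, g y) : plane) x.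
Proof.
intros Hf Hg P [eps He].
specialize (Hf _ (locally_ball (f x) eps)); specialize (Hg _ (locally_ball (g x) eps)).
unfold filtermap in *.
generalize (filter_and _ _ Hf Hg).
apply filter_imp; intros y [H1 H2]; apply He; split; assumption.
Qed.

Lemma continuous_dot {T : UniformSpace} (c d : T -> plane) (x : T) :
  continuous c x -> continuous d x -> continuous (fun y => dot (c y) (d y)) x.
Proof.
intros Hc Hd.
apply (continuous_plus (fun y => fst (c y) * fst (d y)) (fun y => snd (c y) * snd (d y)));
  apply (continuous_mult (K := R_AbsRing)).
- apply (continuous_comp c fst); [exact Hc | apply continuous_fst].
- apply (continuous_comp d fst); [exact Hd | apply continuous_fst].
- apply (continuous_comp c snd); [exact Hc | apply continuous_snd].
- apply (continuous_comp d snd); [exact Hd | apply continuous_snd].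
Qed.

Lemma continuous_enorm {T : UniformSpace} (c : T -> plane) (x : T) :
  continuous c x -> continuous (fun y => enorm (c y)) x.
Proof.
intro Hc; apply (continuous_comp (fun y => dot (c y) (c y)) sqrt).
- apply continuous_dot; exact Hc.
- apply continuity_pt_filterlim, continuity_pt_sqrt; unfold dot; nra.
Qed.

Lemma continuous_edist {T : UniformSpace} (c d : T -> plane) (x : T) :
  continuous c x -> continuous d x -> continuous (fun y => edist (c y) (d y)) x.
Proof.
intros Hc Hd; apply continuous_enorm, continuous_pair;
  apply (continuous_minus (V := R_NormedModule)).
- apply (continuous_comp c fst); [exact Hc | apply continuous_fst].
- apply (continuous_comp d fst); [exact Hd | apply continuous_fst].
- apply (continuous_comp c snd); [exact Hc | apply continuous_snd].
- apply (continuous_comp d snd); [exact Hd | apply continuous_snd].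
Qed.

Lemma C1_curve_continuous (c : R -> plane) (t : R) : C1_curve c -> continuous c t.
Proof.
intro H; apply (ex_derive_continuous (V := prod_NormedModule _ R_NormedModule R_NormedModule)).
eexists; apply H.
Qed.

Lemma enorm_pos (u : plane) : u <> (0, 0) -> 0 < enorm u.
Proof.
destruct u as [x y]; intro H; apply sqrt_lt_R0; unfold dot; simpl.
destruct (Req_dec x 0) as [-> | Hx]; [| nra].
destruct (Req_dec y 0) as [-> | Hy]; [now contradict H | nra].
Qed.

Lemma dot_self_pos (u : plane) : u <> (0, 0) -> 0 < dot u u.
Proof.
intro H; apply sqrt_lt_0_alt; rewrite sqrt_0; exact (enorm_pos u H).
Qed.

Lemma edist_pos (p q : plane) : p <> q -> 0 < edist p q.
Proof.
destruct p as [a b], q as [c d]; intro H; apply enorm_pos; simpl; intro E.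
injection E as E1 E2; apply H; f_equal; lra.
Qed.

Lemma edist_refl (p : plane) : edist p p = 0.
Proof.
unfold edist, enorm, dot; simpl.
rewrite <- sqrt_0; f_equal; ring.
Qed.

Lemma continuous_positive_lower_bound (f : R -> R) (a b : R) :
  a <= b -> (forall t, a <= t <= b -> continuous f t /\ 0 < f t) ->
  exists m, 0 < m /\ forall t, a <= t <= b -> m <= f t.
Proof.
intros Hab Hf.
destruct (continuity_ab_min f a b Hab) as [x [Hx Hxab]].
- intros t Ht; apply continuity_pt_filterlim, Hf, Ht.
- exists (f x); split; [apply Hf, Hxab | exact Hx].
Qed.

Lemma continuous_upper_bound (f : R -> R) (a b : R) :
  a <= b -> (forall t, a <= t <= b -> continuous f t) ->
  exists m, forall t, a <= t <= b -> f t <= m.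
Proof.
intros Hab Hf.
destruct (continuity_ab_maj f a b Hab) as [x [Hx Hxab]].
- intros t Ht; apply continuity_pt_filterlim, Hf, Ht.
- exists (f x); exact Hx.
Qed.

Lemma periodic_Z (gam : R -> plane) (n : Z) (t : R) :
  (forall t, gam (t + 2 * PI) = gam t) -> gam (t + 2 * PI * IZR n) = gam t.
Proof.
intro Hper; revert t.
assert (Hn : forall (n : nat) t, gam (t + 2 * PI * INR n) = gam t).
{ clear n; induction n as [| n IH]; intro t; [simpl; f_equal; ring |].
  rewrite S_INR, <- (IH t), <- (Hper (t + 2 * PI * INR n)); f_equal; ring. }
destruct (Z_le_gt_dec 0 n) as [Hz | Hz]; intro t.
- rewrite <- (Z2Nat.id n Hz), <- INR_IZR_INZ; apply Hn.
- rewrite <- (Hn (Z.to_nat (- n)) (t + 2 * PI * IZR n)); f_equal.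
  rewrite INR_IZR_INZ, Z2Nat.id, opp_IZR by lia; ring.
Qed.

Lemma shift_into_period (t0 t : R) :
  exists n : Z, t0 - PI <= t + 2 * PI * IZR n <= t0 + PI.
Proof.
pose proof PI_RGT_0 as Hpi.
(* [up q] lies in (q, q + 1], so subtracting that many periods puts [t - t0] in [-PI, PI). *)
destruct (archimed ((t - t0 - PI) / (2 * PI))) as [H1 H2].
set (n := up ((t - t0 - PI) / (2 * PI))) in *.
exists (- n)%Z; rewrite opp_IZR.
assert (E : (t - t0 - PI) = 2 * PI * ((t - t0 - PI) / (2 * PI))) by (field; lra).
set (q := (t - t0 - PI) / (2 * PI)) in *.
nra.
Qed.

(* The normal is taken at [t0] for every [t], so that the fibers are parallel; it is not
   normalised. *)
Definition fiber (gam : R -> plane) (t0 t b : R) : plane :=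
  (fst (gam t) - b * snd (velocity gam t0), snd (gam t) + b * fst (velocity gam t0)).

Lemma fiber_0 (gam : R -> plane) (t0 t : R) : fiber gam t0 t 0 = gam t.
Proof. unfold fiber; destruct (gam t); simpl; f_equal; ring. Qed.

Lemma dot_fiber (gam : R -> plane) (t0 t b : R) :
  dot (fiber gam t0 t b) (velocity gam t0) = dot (gam t) (velocity gam t0).
Proof. unfold fiber, dot; simpl; ring. Qed.

Lemma dot_rot90_fiber (gam : R -> plane) (t0 t b : R) :
  dot (fiber gam t0 t b) (rot90 (velocity gam t0)) =
  dot (gam t) (rot90 (velocity gam t0)) + b * dot (velocity gam t0) (velocity gam t0).
Proof. unfold fiber, dot, rot90; simpl; ring. Qed.

Lemma eq_fiber (gam : R -> plane) (t0 t : R) (q : plane) :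
  velocity gam t0 <> (0, 0) ->
  dot (gam t) (velocity gam t0) = dot q (velocity gam t0) ->
  q = fiber gam t0 t
        ((dot q (rot90 (velocity gam t0)) - dot (gam t) (rot90 (velocity gam t0)))
         / dot (velocity gam t0) (velocity gam t0)).
Proof.
intros Hv Hd; pose proof (dot_self_pos _ Hv) as Hp.
unfold fiber; destruct (velocity gam t0) as [x y], (gam t) as [p1 p2], q as [q1 q2].
unfold dot, rot90 in *; simpl in *.
assert (Hz : (q1 - p1) * x + (q2 - p2) * y = 0) by lra.
f_equal; apply Rminus_diag_uniq.
- transitivity (x * ((q1 - p1) * x + (q2 - p2) * y) / (x * x + y * y));
    [field; lra | rewrite Hz; field; lra].
- transitivity (y * ((q1 - p1) * x + (q2 - p2) * y) / (x * x + y * y));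
    [field; lra | rewrite Hz; field; lra].
Qed.

Lemma continuous_fiber {T : UniformSpace} (gam : R -> plane) (t0 : R) (u v : T -> R) (x : T) :
  C1_curve gam -> continuous u x -> continuous v x ->
  continuous (fun s => fiber gam t0 (u s) (v s)) x.
Proof.
intros Hg Hu Hv.
assert (Hgu : continuous (fun s => gam (u s)) x).
{ apply (continuous_comp u gam); [exact Hu | apply C1_curve_continuous, Hg]. }
apply continuous_pair.
- apply (continuous_minus (V := R_NormedModule)
    (fun s => fst (gam (u s))) (fun s => v s * snd (velocity gam t0))).
  + apply (continuous_comp (fun s => gam (u s)) fst); [exact Hgu | apply continuous_fst].
  + apply (continuous_mult (K := R_AbsRing)); [exact Hv | apply continuous_const].
- apply (continuous_plus (V := R_NormedModule)
    (fun s => snd (gam (u s))) (fun s => v s * fst (velocity gam t0))).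
  + apply (continuous_comp (fun s => gam (u s)) snd); [exact Hgu | apply continuous_snd].
  + apply (continuous_mult (K := R_AbsRing)); [exact Hv | apply continuous_const].
Qed.

(** The tangential coordinate of [gam] has derivative |tau|^2 at [t0], hence at least half of that
    nearby by continuity of the velocity. Near [t0] it therefore serves as a parameter of the curve,
    and each fiber meets the nearby part of [gam] only once. *)
Lemma tangential_growth (gam : R -> plane) (t0 : R) :
  C1_curve gam -> velocity gam t0 <> (0, 0) ->
  exists rho c, 0 < rho /\ 0 < c /\
    forall t t', Rabs (t - t0) < rho -> Rabs (t' - t0) < rho -> t <= t' ->
      c * (t' - t) <= dot (gam t') (velocity gam t0) - dot (gam t) (velocity gam t0).
Proof.
intros Hg Hv; pose proof (dot_self_pos _ Hv) as Hp.
set (tau := velocity gam t0) in *.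
assert (Hc : continuous (fun t => dot (velocity gam t) tau) t0).
{ apply continuous_dot; [apply Hg | apply continuous_const]. }
assert (Hhalf : 0 < dot tau tau / 2) by lra.
destruct (Hc _ (locally_ball (dot tau tau : R) (mkposreal _ Hhalf))) as [d Hd].
exists d, (dot tau tau / 2); repeat split; [apply cond_pos | lra |].
intros t t' Ht Ht' Htt'.
destruct (MVT_gen (fun s => dot (gam s) tau) t t' (fun s => dot (velocity gam s) tau))
  as [x [Hx E]].
- intros x _; apply is_derive_dot, Hg.
- intros x _; apply continuity_pt_filterlim, (continuous_dot gam (fun _ => tau));
    [apply C1_curve_continuous, Hg | apply continuous_const].
- rewrite E; apply Rmult_le_compat_r; [lra |].
  rewrite Rmin_left, Rmax_right in Hx by lra.
  assert (Hxd : Rabs (x - t0) < d).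
  { apply Rabs_def2 in Ht; apply Rabs_def2 in Ht'; apply Rabs_def1; lra. }
  specialize (Hd x Hxd); fold tau in Hd.
  unfold ball in Hd; simpl in Hd; unfold AbsRing_ball, abs, minus, plus, opp in Hd; simpl in Hd.
  apply Rabs_def2 in Hd; lra.
Qed.

Lemma continuous_lt_locally {T : UniformSpace} (f : T -> R) (x : T) (m : R) :
  continuous f x -> f x < m -> locally x (fun y => f y < m).
Proof. intros Hf Hm; apply (Hf (fun r => r < m)), open_lt, Hm. Qed.

(** By compactness the part of the curve with parameter away from [t0] keeps a positive distance
    from [gam t0]. A boundary point on a short fiber thus has a parameter near [t0], and equality of
    tangential coordinates makes it the foot of the fiber. *)
Lemma fiber_off_boundary (Om : plane -> Prop) (gam : R -> plane) (t0 : R) :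
  ccw_boundary_param Om gam ->
  exists rho, 0 < rho /\
    forall t b, Rabs (t - t0) < rho -> Rabs b < rho -> b <> 0 ->
      ~ boundary Om (fiber gam t0 t b).
Proof.
intros [Hg [Hv [Hper [Hinj [Hbd _]]]]].
pose proof PI_RGT_0 as Hpi.
destruct (tangential_growth gam t0 Hg (Hv t0)) as [rho0 [c [Hrho0 [Hc Hgrow]]]].
set (rho1 := Rmin (rho0 / 2) PI).
assert (Hrho1 : 0 < rho1 /\ rho1 < rho0 /\ rho1 <= PI).
{ unfold rho1; repeat split; [apply Rmin_glb_lt; lra | | apply Rmin_r].
  apply Rle_lt_trans with (rho0 / 2); [apply Rmin_l | lra]. }
assert (Hcont : forall t, continuous (fun t => edist (gam t) (gam t0)) t).
{ intro t; apply continuous_edist; [apply C1_curve_continuous, Hg | apply continuous_const]. }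
(* Parameters of equal points differ by a multiple of 2 PI; at distance at most PI this multiple is
   zero, which [rho1] excludes. *)
assert (Hfar : forall t, rho1 <= Rabs (t - t0) <= PI -> 0 < edist (gam t) (gam t0)).
{ intros t [Ht1 Ht2]; apply edist_pos; intro E.
  destruct (Hinj _ _ E) as [n Hn].
  assert (Hlow : 2 * PI * Rabs (IZR n) <= PI).
  { rewrite <- (Rabs_pos_eq (2 * PI)), <- Rabs_mult by lra.
    replace (2 * PI * IZR n) with (t0 - t) by lra.
    rewrite Rabs_minus_sym; exact Ht2. }
  destruct (Z.eq_dec n 0) as [-> | Hn0].
  - replace (t - t0) with 0 in Ht1 by lra; rewrite Rabs_R0 in Ht1; lra.
  - rewrite <- abs_IZR in Hlow.
    assert (1 <= IZR (Z.abs n)) by (apply IZR_le; lia). nra. }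
destruct (continuous_positive_lower_bound (fun t => edist (gam t) (gam t0)) (t0 - PI) (t0 - rho1))
  as [ma [Hma Hma']]; [lra | |].
{ intros t Ht; split; [apply Hcont | apply Hfar; rewrite Rabs_left1; lra]. }
destruct (continuous_positive_lower_bound (fun t => edist (gam t) (gam t0)) (t0 + rho1) (t0 + PI))
  as [mb [Hmb Hmb']]; [lra | |].
{ intros t Ht; split; [apply Hcont | apply Hfar; rewrite Rabs_pos_eq; lra]. }
assert (Hnear : locally (t0, 0) (fun q : R * R =>
    edist (fiber gam t0 (fst q) (snd q)) (gam t0) < Rmin ma mb)).
{ apply (continuous_lt_locally
    (fun q : R * R => edist (fiber gam t0 (fst q) (snd q)) (gam t0)) (t0, 0)).
  - apply continuous_edist; [| apply continuous_const].
    apply continuous_fiber; [exact Hg | apply continuous_fst | apply continuous_snd].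
  - simpl; rewrite fiber_0, edist_refl; apply Rmin_glb_lt; assumption. }
destruct Hnear as [d Hd].
exists (Rmin d rho0); split; [apply Rmin_glb_lt; [apply cond_pos | lra] |].
intros t b Ht Hb Hb0 Hbdry.
pose proof (Rmin_l d rho0); pose proof (Rmin_r d rho0).
destruct (proj1 (Hbd _) Hbdry) as [t1 Ht1].
destruct (shift_into_period t0 t1) as [n Hn].
rewrite <- (periodic_Z gam n t1 Hper) in Ht1.
set (t' := t1 + 2 * PI * IZR n) in *.
assert (Hdist : edist (gam t') (gam t0) < Rmin ma mb).
{ rewrite Ht1; apply (Hd (t, b)); split.
  - change (Rabs (t - t0) < d); lra.
  - change (Rabs (b - 0) < d); rewrite Rminus_0_r; lra. }
pose proof (Rmin_l ma mb); pose proof (Rmin_r ma mb).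
assert (Ht' : Rabs (t' - t0) < rho1).
{ apply Rabs_def1; apply Rnot_le_lt; intro Hle.
  - specialize (Hmb' t'); simpl in Hmb'; lra.
  - specialize (Hma' t'); simpl in Hma'; lra. }
assert (Hdot : dot (gam t') (velocity gam t0) = dot (gam t) (velocity gam t0)).
{ rewrite Ht1; apply dot_fiber. }
assert (Ett : t' = t).
{ destruct (Rle_dec t t') as [Hle | Hle].
  - specialize (Hgrow t t'); nra.
  - specialize (Hgrow t' t); nra. }
pose proof (dot_self_pos _ (Hv t0)).
pose proof (dot_rot90_fiber gam t0 t b) as Hrot.
rewrite <- Ht1, Ett in Hrot.
apply Hb0, (Rmult_eq_reg_r (dot (velocity gam t0) (velocity gam t0))); lra.
Qed.

Lemma convex_combination_lt (a b r s : R) :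
  0 <= s <= 1 -> a < r -> b < r -> a + s * (b - a) < r.
Proof. intros Hs Ha Hb; destruct (Rle_dec a b); nra. Qed.

(** One side of the tube is the image of a rectangle in (t, b), so a straight segment of parameters
    joins any two of its points off the boundary. The factor [e] is 1 or -1 in the applications and
    selects the side. *)
Lemma fiber_same_side (Om : plane -> Prop) (gam : R -> plane) (t0 rho e : R) :
  C1_curve gam -> open Om -> e <> 0 -> Rabs e <= 1 ->
  (forall t b, Rabs (t - t0) < rho -> Rabs b < rho -> b <> 0 ->
      ~ boundary Om (fiber gam t0 t b)) ->
  forall t b t' b', Rabs (t - t0) < rho -> Rabs (t' - t0) < rho ->
    0 < b < rho -> 0 < b' < rho ->
    Om (fiber gam t0 t (e * b)) -> Om (fiber gam t0 t' (e * b')).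
Proof.
intros Hg HO He He1 Hoff t b t' b' Ht Ht' Hb Hb'.
pose (u := fun s => t + s * (t' - t)); pose (v := fun s => e * (b + s * (b' - b))).
assert (Hpath := path_off_boundary Om (fun s => fiber gam t0 (u s) (v s)) 0 1 HO).
unfold u, v in Hpath.
replace (t + 0 * (t' - t)) with t in Hpath by ring.
replace (b + 0 * (b' - b)) with b in Hpath by ring.
replace (t + 1 * (t' - t)) with t' in Hpath by ring.
replace (b + 1 * (b' - b)) with b' in Hpath by ring.
apply Hpath; [lra |].
intros s Hs; split.
- apply continuous_fiber; [exact Hg | |];
    apply (ex_derive_continuous (V := R_NormedModule)); auto_derive; trivial.
- apply Rabs_def2 in Ht; apply Rabs_def2 in Ht'.
  assert (Hbs : 0 < b + s * (b' - b) < rho).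
  { pose proof (convex_combination_lt (- b) (- b') 0 s Hs).
    pose proof (convex_combination_lt b b' rho s Hs); lra. }
  apply Hoff.
  + pose proof (convex_combination_lt t t' (t0 + rho) s Hs).
    pose proof (convex_combination_lt (- t) (- t') (rho - t0) s Hs).
    apply Rabs_def1; lra.
  + rewrite Rabs_mult, (Rabs_pos_eq (b + s * (b' - b))) by lra.
    pose proof (Rabs_pos e); nra.
  + apply Rmult_integral_contrapositive; split; [exact He | lra].
Qed.

(** By the intermediate value theorem the tangential coordinate of [gam] takes the value of that of
    [q] at some [t] near [t0]; what remains of [q - gam t] is normal and small. *)
Lemma fiber_cover (gam : R -> plane) (t0 rho : R) :
  C1_curve gam -> velocity gam t0 <> (0, 0) -> 0 < rho ->
  locally (gam t0) (fun q => exists t b, Rabs (t - t0) < rho /\ Rabs b < rho /\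
     q = fiber gam t0 t b).
Proof.
intros Hg Hv Hrho.
pose proof (dot_self_pos _ Hv) as HA.
destruct (tangential_growth gam t0 Hg Hv) as [rho0 [c [Hrho0 [Hc Hgrow]]]].
set (tau := velocity gam t0) in *; set (A := dot tau tau) in *; set (n := rot90 tau).
assert (Hcd : forall w t, continuous (fun t => dot (gam t) w) t).
{ intros w t; apply (continuous_dot gam (fun _ => w));
    [apply C1_curve_continuous, Hg | apply continuous_const]. }
assert (Hq : forall w q, continuous (fun q : plane => dot q w) q).
{ intros w q; apply (continuous_dot (fun q => q) (fun _ => w));
    [apply continuous_id | apply continuous_const]. }
assert (HrA : 0 < rho * A) by nra.
assert (Hn1 : locally t0 (fun t => Rabs (dot (gam t) n - dot (gam t0) n) < rho * A / 2)).
{ assert (Hp : 0 < rho * A / 2) by lra.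
  exact (Hcd n t0 _ (locally_ball (dot (gam t0) n : R) (mkposreal _ Hp))). }
destruct Hn1 as [d1 Hd1]; pose proof (cond_pos d1) as Hd1p.
set (r := Rmin (d1 / 2) (Rmin (rho / 2) (rho0 / 2))).
assert (Hr : 0 < r /\ r <= d1 / 2 /\ r <= rho / 2 /\ r <= rho0 / 2).
{ unfold r; pose proof (Rmin_l (d1 / 2) (Rmin (rho / 2) (rho0 / 2)));
  pose proof (Rmin_r (d1 / 2) (Rmin (rho / 2) (rho0 / 2)));
  pose proof (Rmin_l (rho / 2) (rho0 / 2)); pose proof (Rmin_r (rho / 2) (rho0 / 2)).
  repeat split; try lra; repeat apply Rmin_glb_lt; lra. }
assert (Hup : dot (gam t0) tau < dot (gam (t0 + r)) tau).
{ specialize (Hgrow t0 (t0 + r)).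
  rewrite Rminus_diag, Rabs_R0, (Rabs_pos_eq (t0 + r - t0)) in Hgrow by lra; nra. }
assert (Hdn : dot (gam (t0 - r)) tau < dot (gam t0) tau).
{ specialize (Hgrow (t0 - r) t0).
  rewrite Rminus_diag, Rabs_R0, (Rabs_left1 (t0 - r - t0)) in Hgrow by lra; nra. }
assert (HpA : 0 < rho * A / 2) by lra.
assert (L1 : locally (gam t0) (fun q => dot q tau < dot (gam (t0 + r)) tau)).
{ apply (continuous_lt_locally (fun q : plane => dot q tau)); [apply Hq | exact Hup]. }
assert (L2 : locally (gam t0) (fun q => dot (gam (t0 - r)) tau < dot q tau)).
{ apply (Hq tau (gam t0) (fun x => dot (gam (t0 - r)) tau < x)), open_gt, Hdn. }
assert (L3 : locally (gam t0) (fun q => Rabs (dot q n - dot (gam t0) n) < rho * A / 2)).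
{ exact (Hq n (gam t0) _ (locally_ball (dot (gam t0) n : R) (mkposreal _ HpA))). }
generalize (filter_and _ _ L1 (filter_and _ _ L2 L3)); apply filter_imp.
intros q [H1 [H2 H3]].
destruct (IVT_gen (fun t => dot (gam t) tau) (t0 - r) (t0 + r) (dot q tau)) as [t [Ht Et]].
- intro x; apply continuity_pt_filterlim, Hcd.
- rewrite Rmin_left, Rmax_right by lra; lra.
- rewrite Rmin_left, Rmax_right in Ht by lra.
  exists t, ((dot q n - dot (gam t) n) / A); repeat split.
  + apply Rabs_def1; lra.
  + unfold Rdiv; rewrite Rabs_mult, Rabs_inv, (Rabs_pos_eq A) by lra.
    apply (Rmult_lt_reg_r A); [exact HA |].
    rewrite Rmult_assoc, Rinv_l, Rmult_1_r by lra.
    (* The normal offset from [gam t] to [q] is split at [gam t0]; each part is below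
       [rho * A / 2]. *)
    specialize (Hd1 t); replace (dot q n - dot (gam t) n)
      with ((dot q n - dot (gam t0) n) - (dot (gam t) n - dot (gam t0) n)) by ring.
    assert (Rabs (dot (gam t) n - dot (gam t0) n) < rho * A / 2).
    { apply Hd1; change (Rabs (t - t0) < d1); apply Rabs_def1; lra. }
    eapply Rle_lt_trans; [apply Rabs_triang |]; rewrite Rabs_Ropp; lra.
  + apply eq_fiber; assumption.
Qed.

(** One point of [Om] on each side puts both open halves of the tube in [Om]. The curve between them
    consists of boundary points, so the whole tube lies in the closure, and the tube is a
    neighbourhood of [gam t0]. *)
Lemma both_sides_interior (Om : plane -> Prop) (gam : R -> plane) (t0 rho : R) :
  open Om -> ccw_boundary_param Om gam -> 0 < rho ->
  (forall t b, Rabs (t - t0) < rho -> Rabs b < rho -> b <> 0 ->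
      ~ boundary Om (fiber gam t0 t b)) ->
  forall t b t' b', Rabs (t - t0) < rho -> Rabs (t' - t0) < rho ->
    0 < b < rho -> 0 < b' < rho ->
    Om (fiber gam t0 t b) -> Om (fiber gam t0 t' (- b')) ->
    locally (gam t0) (closure Om).
Proof.
intros HO [Hg [Hv [_ [_ [Hbd _]]]]] Hrho Hoff t b t' b' Ht Ht' Hb Hb' H1 H2.
generalize (fiber_cover gam t0 rho Hg (Hv t0) Hrho); apply filter_imp.
intros q [u [v [Hu [Hvr ->]]]]; apply Rabs_def2 in Hvr.
destruct (Rtotal_order v 0) as [Hneg | [-> | Hpos]].
- apply closure_incl; replace v with (- 1 * - v) by ring.
  apply (fiber_same_side Om gam t0 rho (- 1)) with (t := t') (b := b'); try assumption; try lra.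
  + rewrite Rabs_left; lra.
  + replace (- 1 * b') with (- b') by ring; exact H2.
- rewrite fiber_0; apply (proj2 (Hbd (gam u))); exists u; reflexivity.
- apply closure_incl; replace v with (1 * v) by ring.
  apply (fiber_same_side Om gam t0 rho 1) with (t := t) (b := b); try assumption; try lra.
  + rewrite Rabs_pos_eq; lra.
  + replace (1 * b) with b by ring; exact H1.
Qed.

(** Passing from [t0] to nearby [t] is openness of an interior. Conversely, if the closure is a
    neighbourhood of [gam t], short fibers through [gam t] give points of [Om] on both sides of the
    tube built at [t0], which is large enough to contain them. *)
Lemma closure_interior_locally_constant (Om : plane -> Prop) (gam : R -> plane) (t0 : R) :
  open Om -> ccw_boundary_param Om gam ->
  exists d : posreal, forall t, Rabs (t - t0) < d ->
    (locally (gam t) (closure Om) <-> locally (gam t0) (closure Om)).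
Proof.
intros HO Hccw.
destruct (fiber_off_boundary Om gam t0 Hccw) as [rho [Hrho Hoff]].
assert (Hback : forall t, Rabs (t - t0) < rho ->
   locally (gam t) (closure Om) -> locally (gam t0) (closure Om)).
{ intros t Ht HG.
  assert (Hcf : continuous (fun b => fiber gam t0 t b) 0).
  { apply (continuous_fiber gam t0 (fun _ => t) (fun b => b));
      [apply Hccw | apply continuous_const | apply continuous_id]. }
  rewrite <- (fiber_0 gam t0 t) in HG.
  destruct (Hcf _ HG) as [d Hd]; pose proof (cond_pos d) as Hd0.
  set (b := Rmin d rho / 2).
  assert (Hb : 0 < b < rho /\ b < d).
  { unfold b; pose proof (Rmin_l d rho); pose proof (Rmin_r d rho).
    assert (0 < Rmin d rho) by (apply Rmin_glb_lt; lra); lra. }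
  apply (both_sides_interior Om gam t0 rho) with (t := t) (b := b) (t' := t) (b' := b);
    try assumption; try lra; apply closure_not_boundary.
  - apply Hd; change (Rabs (b - 0) < d); rewrite Rabs_pos_eq; lra.
  - apply Hoff; [exact Ht | rewrite Rabs_pos_eq; lra | lra].
  - apply Hd; change (Rabs (- b - 0) < d); rewrite Rabs_left; lra.
  - apply Hoff; [exact Ht | rewrite Rabs_left; lra | lra]. }
destruct (classic (locally (gam t0) (closure Om))) as [HG | HG].
- assert (Hcg : continuous gam t0) by apply C1_curve_continuous, Hccw.
  destruct (Hcg _ (locally_locally _ _ HG)) as [d Hd].
  exists d; intros t Ht; split; intros _; [exact HG | apply Hd, Ht].
- exists (mkposreal rho Hrho); intros t Ht; split; [apply Hback, Ht | tauto].
Qed.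

(** The property would spread along all of [gam], making the closure of [Om] both open and closed; a
    horizontal ray issued from a point of [Om] would then never leave it, against boundedness. *)
Lemma boundary_not_interior_closure (Om : plane -> Prop) (gam : R -> plane) (t0 : R) :
  bounded_domain Om -> ccw_boundary_param Om gam -> ~ locally (gam t0) (closure Om).
Proof.
intros [[HO [[q0 Hq0] _]] [M HM]] Hccw HG0.
assert (HG : forall t, locally (gam t) (closure Om)).
{ intro t; destruct (Rle_dec t0 t) as [Hle | Hle].
  - apply (locally_constant_on_segment (fun t => locally (gam t) (closure Om)) t0 t Hle);
      [| exact HG0].
    intros s _; destruct (closure_interior_locally_constant Om gam s HO Hccw) as [d Hd].
    exists d; intros s' _; apply Hd.
  (* Parameters to the left of [t0] are reached by reversing the parameter. *)
  - assert (Hm := locally_constant_on_segment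
      (fun s => locally (gam (- s)) (closure Om)) (- t0) (- t)).
    cbv beta in Hm; rewrite !Ropp_involutive in Hm; apply Hm; [lra | | exact HG0].
    intros s _; destruct (closure_interior_locally_constant Om gam (- s) HO Hccw) as [d Hd].
    exists d; intros s' _ Hs'; apply Hd.
    rewrite <- Rabs_Ropp; replace (- (- s' - - s)) with (s' - s) by ring; exact Hs'. }
assert (Hfst : forall p, closure Om p -> fst p <= M + 1).
{ intros p Hp; destruct (Hp (mkposreal 1 Rlt_0_1)) as [q [[Hb _] Hq]].
  change (Rabs (fst q - fst p) < 1) in Hb; apply Rabs_def2 in Hb.
  pose proof (HM q Hq) as HMq.
  assert (fst q <= enorm q); [| lra].
  apply Rle_trans with (Rabs (fst q)); [apply Rle_abs |].
  rewrite <- sqrt_Rsqr_abs; apply sqrt_le_1_alt; unfold dot, Rsqr.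
  change (fst q * fst q <= fst q * fst q + snd q * snd q).
  pose proof (Rle_0_sqr (snd q)) as Hsq; unfold Rsqr in Hsq; lra. }
(* The first coordinate is at most [M + 1] on the closure, one unit more than on [Om]; the end of
   the ray has first coordinate at least [M + 2]. *)
set (b := Rmax 0 (M + 2 - fst q0)).
pose (c := fun s : R => (fst q0 + s, snd q0) : plane).
assert (Hend : closure Om (c b)).
{ apply (locally_constant_on_segment (fun s => closure Om (c s)) 0 b).
  - apply Rmax_l.
  - intros s _.
    assert (Hc : continuous c s).
    { apply (continuous_pair (fun s => fst q0 + s) (fun _ => snd q0));
        [| apply continuous_const].
      apply (continuous_plus (V := R_NormedModule) (fun _ => fst q0) (fun s => s));
        [apply continuous_const | apply continuous_id]. }
    assert (Hl : locally (c s) (fun q => closure Om q <-> closure Om (c s))).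
    { destruct (classic (closure Om (c s))) as [Hcl | Hcl].
      - assert (locally (c s) (closure Om)) as Hloc.
        { destruct (classic (boundary Om (c s))) as [Hb | Hb].
          - destruct Hccw as [_ [_ [_ [_ [Hbd _]]]]].
            destruct (proj1 (Hbd _) Hb) as [t <-]; apply HG.
          - generalize (HO _ (closure_not_boundary Om _ Hcl Hb)); apply filter_imp.
            intros q; apply closure_incl. }
        revert Hloc; apply filter_imp; tauto.
      - destruct (not_closure_ball _ _ Hcl) as [eps He].
        assert (Hloc : locally (c s) (fun q => ~ Om q)) by (exists eps; exact He).
        apply locally_locally in Hloc; revert Hloc; apply filter_imp.
        intros q [eq Hq]; split; [| tauto]; intro Hcq; exfalso.
        destruct (Hcq eq) as [z [Hz1 Hz2]]; exact (Hq z Hz1 Hz2). }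
    destruct (Hc _ Hl) as [d Hd]; exists d; intros s' _ Hs'; apply Hd, Hs'.
  - unfold c; rewrite Rplus_0_r; apply closure_incl; destruct q0; exact Hq0. }
apply Hfst in Hend; unfold c in Hend; simpl in Hend.
pose proof (Rmax_r 0 (M + 2 - fst q0)); unfold b in Hend; lra.
Qed.

(** * Curves leaving the boundary transversally *)

Lemma C1_curve_normal_small (gam : R -> plane) (t0 k : R) :
  C1_curve gam -> 0 < k ->
  locally t0 (fun t => Rabs (dot (gam t) (rot90 (velocity gam t0)) -
     dot (gam t0) (rot90 (velocity gam t0))) <= k * Rabs (t - t0)).
Proof.
intros Hg Hk.
pose proof (is_derive_dot gam (rot90 (velocity gam t0)) t0 _ (proj1 (Hg t0))) as [_ Hd].
specialize (Hd t0 (fun P H => H) (mkposreal _ Hk)).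
revert Hd; apply filter_imp; intros t Ht.
replace (dot (velocity gam t0) (rot90 (velocity gam t0))) with 0 in Ht
  by (unfold dot, rot90; simpl; ring).
change (Rabs ((dot (gam t) (rot90 (velocity gam t0)) - dot (gam t0) (rot90 (velocity gam t0))) -
  (t - t0) * 0) <= k * Rabs (t - t0)) in Ht.
rewrite Rmult_0_r, Rminus_0_r in Ht; exact Ht.
Qed.

Lemma derive_linear_bound (f : R -> R) (x l k : R) :
  is_derive f x l -> 0 < k ->
  locally 0 (fun s => Rabs (f (x + s) - f x - l * s) <= k * Rabs s).
Proof.
intros [_ Hd] Hk.
destruct (Hd x (fun P H => H) (mkposreal _ Hk)) as [d He].
exists d; intros s Hs.
assert (Exs : x + s - x = s) by ring.
specialize (He (x + s)); change (Rabs (s - 0) < d) in Hs; rewrite Rminus_0_r in Hs.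
assert (Hb : ball x d (x + s)).
{ change (Rabs (x + s - x) < d); rewrite Exs; exact Hs. }
specialize (He Hb).
change (Rabs (f (x + s) - f x - (x + s - x) * l) <= k * Rabs (x + s - x)) in He.
rewrite Exs, (Rmult_comm s l) in He; exact He.
Qed.

(* [gam] is tangent to the axis of the fibers, so a curve leaving [gam t0] transversally
   lies, to first order, on the side indicated by the normal component of its velocity. *)
Lemma transversal_side (gam x : R -> plane) (t0 s0 rho : R) (w : plane) :
  C1_curve gam -> velocity gam t0 <> (0, 0) -> x s0 = gam t0 ->
  is_derive x s0 w -> dot w (rot90 (velocity gam t0)) <> 0 -> 0 < rho ->
  locally 0 (fun s => s <> 0 -> exists t b, Rabs (t - t0) < rho /\ 0 < b < rho /\
     x (s0 + s) = fiber gam t0 t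
       (if Rlt_dec 0 (s * dot w (rot90 (velocity gam t0))) then b else - b)).
Proof.
intros Hg Hv Hx Hw Hn0 Hrho.
pose proof (dot_self_pos _ Hv) as HA.
destruct (tangential_growth gam t0 Hg Hv) as [rho0 [c [Hrho0 [Hc Hgrow]]]].
set (tau := velocity gam t0) in *; set (n := rot90 tau) in *; set (A := dot tau tau) in *.
set (wn := dot w n) in *; set (wt := Rabs (dot w tau) + 1).
assert (Hwt : 0 < wt) by (unfold wt; pose proof (Rabs_pos (dot w tau)); lra).
assert (Hwn : 0 < Rabs wn) by (apply Rabs_pos_lt; exact Hn0).
(* The foot of the fiber through [x (s0 + s)] moves by at most [wt / c * Rabs s]; this slope makes
   the normal drift of [gam] over that range at most a quarter of [Rabs wn * Rabs s]. *)
assert (Hk : 0 < c * Rabs wn / (4 * wt)).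
{ apply Rdiv_lt_0_compat; [apply Rmult_lt_0_compat |]; lra. }
destruct (C1_curve_normal_small gam t0 _ Hg Hk) as [d1 Hd1].
pose proof (cond_pos d1) as Hd1p.
set (r := Rmin rho (Rmin rho0 d1)).
assert (Hr : 0 < r /\ r <= rho /\ r <= rho0 /\ r <= d1).
{ unfold r; pose proof (Rmin_l rho (Rmin rho0 d1)); pose proof (Rmin_r rho (Rmin rho0 d1)).
  pose proof (Rmin_l rho0 d1); pose proof (Rmin_r rho0 d1).
  repeat split; try lra; repeat apply Rmin_glb_lt; lra. }
assert (Hxc : continuous (fun s => x (s0 + s)) 0).
{ apply (continuous_comp (fun s => s0 + s) x).
  - apply (ex_derive_continuous (V := R_NormedModule)); auto_derive; trivial.
  - rewrite Rplus_0_r.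
    apply (ex_derive_continuous (V := prod_NormedModule _ R_NormedModule R_NormedModule)).
    exists w; exact Hw. }
assert (Hcov := fiber_cover gam t0 r Hg Hv (proj1 Hr)).
assert (Hcov' : locally 0 (fun s => exists t b, Rabs (t - t0) < r /\ Rabs b < r /\
     x (s0 + s) = fiber gam t0 t b)).
{ assert (Ex : gam t0 = x (s0 + 0)) by (rewrite Rplus_0_r; symmetry; exact Hx).
  rewrite Ex in Hcov; exact (Hxc _ Hcov). }
assert (Hwn4 : 0 < Rabs wn / 4) by lra.
generalize (filter_and _ _ Hcov'
  (filter_and _ _ (derive_linear_bound _ s0 _ 1 (is_derive_dot x tau s0 w Hw) Rlt_0_1)
                  (derive_linear_bound _ s0 _ _ (is_derive_dot x n s0 w Hw) Hwn4))).
apply filter_imp; intros s [[t [b [Ht [Hb Hxs]]]] [Htau Hn]] Hs0.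
assert (Hs : 0 < Rabs s) by (apply Rabs_pos_lt; exact Hs0).
rewrite Hxs, Hx in Htau, Hn.
rewrite dot_fiber in Htau.
unfold n in Hn; rewrite dot_rot90_fiber in Hn; fold tau in Hn; fold n A wn in Hn.
fold tau in Htau.
assert (Hts : c * Rabs (t - t0) <= wt * Rabs s).
{ apply Rle_trans with (Rabs (dot (gam t) tau - dot (gam t0) tau)).
  - assert (Ht0 : Rabs (t0 - t0) < rho0) by (rewrite Rminus_diag, Rabs_R0; lra).
    assert (Ht1 : Rabs (t - t0) < rho0) by lra.
    destruct (Rle_dec t0 t) as [Hle | Hle].
    + rewrite (Rabs_pos_eq (t - t0)) by lra.
      eapply Rle_trans; [exact (Hgrow t0 t Ht0 Ht1 Hle) | apply Rle_abs].
    + rewrite (Rabs_left1 (t - t0)) by lra; rewrite Rabs_minus_sym.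
      eapply Rle_trans; [| apply Rle_abs].
      replace (- (t - t0)) with (t0 - t) by ring; apply Hgrow; lra.
  - replace (dot (gam t) tau - dot (gam t0) tau) with
      ((dot (gam t) tau - dot (gam t0) tau - dot w tau * s) + dot w tau * s) by ring.
    eapply Rle_trans; [apply Rabs_triang |]; rewrite Rabs_mult; unfold wt; lra. }
assert (Hvt : Rabs (dot (gam t) n - dot (gam t0) n) <= Rabs wn / 4 * Rabs s).
{ eapply Rle_trans; [apply Hd1; change (Rabs (t - t0) < d1); lra |].
  apply Rle_trans with (Rabs wn / (4 * wt) * (c * Rabs (t - t0))).
  - right; field; lra.
  - apply Rle_trans with (Rabs wn / (4 * wt) * (wt * Rabs s)).
    + apply Rmult_le_compat_l; [apply Rlt_le, Rdiv_lt_0_compat; lra | exact Hts].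
    + right; field; lra. }
(* Two errors of one quarter, from [x] and from [gam], leave [b * A] with the sign of [wn * s]. *)
assert (HbA : Rabs (b * A - wn * s) <= Rabs wn * Rabs s / 2).
{ replace (b * A - wn * s) with
    ((dot (gam t) n + b * A - dot (gam t0) n - wn * s) +
     - (dot (gam t) n - dot (gam t0) n)) by ring.
  eapply Rle_trans; [apply Rabs_triang |]; rewrite Rabs_Ropp; lra. }
exists t, (Rabs b).
destruct (Rlt_dec 0 (s * wn)) as [Hpos | Hneg].
- assert (Hb0 : 0 < b).
  { rewrite <- Rabs_mult, (Rabs_pos_eq (wn * s)) in HbA by lra.
    apply Rabs_le_between in HbA; nra. }
  rewrite (Rabs_pos_eq b) in * by lra; repeat split; try assumption; lra.
- assert (Hsw : s * wn < 0).
  { destruct (Rtotal_order (s * wn) 0) as [H | [H | H]]; [exact H | | lra].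
    apply Rmult_integral in H; tauto. }
  assert (Hb0 : b < 0).
  { rewrite <- Rabs_mult, (Rabs_left (wn * s)) in HbA by lra.
    apply Rabs_le_between in HbA; nra. }
  rewrite (Rabs_left b) in * by lra; rewrite Ropp_involutive.
  repeat split; try assumption; lra.
Qed.

Lemma arc_in_domain (Om : plane -> Prop) (gam : R -> plane) (th1 th2 : R) (c : curve) (t : R) :
  billiard_arc Om gam th1 th2 c -> 0 < t < dur c -> Om (pos c t).
Proof.
intros [_ [_ [Hcl [Hb _]]]] Ht; apply closure_not_boundary; [apply Hcl; lra | apply Hb, Ht].
Qed.

(* If the two normal components had the same sign, the arcs would show that [Om] lies on
   both sides of its boundary. *)
Lemma incoming_outgoing_normal (Om : plane -> Prop) (gam : R -> plane) (th1 t0 th2 : R)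
    (x y : curve) (vin vout : plane) :
  bounded_domain Om -> ccw_boundary_param Om gam ->
  0 < dur x -> 0 < dur y ->
  billiard_arc Om gam th1 t0 x -> billiard_arc Om gam t0 th2 y ->
  is_derive (pos x) (dur x) vin -> is_derive (pos y) 0 vout ->
  dot vin (rot90 (velocity gam t0)) <> 0 -> dot vout (rot90 (velocity gam t0)) <> 0 ->
  dot vin (rot90 (velocity gam t0)) * dot vout (rot90 (velocity gam t0)) < 0.
Proof.
intros Hbd Hccw Hdx Hdy Hx Hy Hvin Hvout Hin Hout.
destruct (fiber_off_boundary Om gam t0 Hccw) as [rho [Hrho Hoff]].
assert (Hg : C1_curve gam) by apply Hccw.
assert (Hv : velocity gam t0 <> (0, 0)) by apply Hccw.
destruct (transversal_side gam (pos x) t0 (dur x) rho vin Hg Hv (proj1 (proj2 Hx)) Hvin Hin Hrho)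
  as [d1 Hd1].
destruct (transversal_side gam (pos y) t0 0 rho vout Hg Hv (proj1 Hy) Hvout Hout Hrho)
  as [d2 Hd2].
pose proof (cond_pos d1) as Hd1p; pose proof (cond_pos d2) as Hd2p.
assert (Hs : exists s, 0 < s /\ s < d1 /\ s < d2 /\ s < dur x /\ s < dur y).
{ set (m := Rmin (Rmin d1 d2) (Rmin (dur x) (dur y))).
  assert (Hm : 0 < m) by (unfold m; repeat apply Rmin_glb_lt; assumption).
  exists (m / 2).
  pose proof (Rmin_l (Rmin d1 d2) (Rmin (dur x) (dur y))).
  pose proof (Rmin_r (Rmin d1 d2) (Rmin (dur x) (dur y))).
  pose proof (Rmin_l d1 d2); pose proof (Rmin_r d1 d2).
  pose proof (Rmin_l (dur x) (dur y)); pose proof (Rmin_r (dur x) (dur y)).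
  fold m in H, H0; repeat split; lra. }
destruct Hs as [s [Hs [Hs1 [Hs2 [Hsx Hsy]]]]].
destruct (Hd1 (- s)) as [t [b [Ht [Hb E1]]]];
  [change (Rabs (- s - 0) < d1); rewrite Rabs_left; lra | lra |].
destruct (Hd2 s) as [t' [b' [Ht' [Hb' E2]]]];
  [change (Rabs (s - 0) < d2); rewrite Rabs_pos_eq; lra | lra |].
assert (Ox := arc_in_domain Om gam th1 t0 x (dur x + - s) Hx ltac:(lra)).
assert (Oy := arc_in_domain Om gam t0 th2 y (0 + s) Hy ltac:(lra)).
rewrite E1 in Ox; rewrite E2 in Oy.
set (a := dot vin (rot90 (velocity gam t0))) in *.
set (e := dot vout (rot90 (velocity gam t0))) in *.
assert (Hint := both_sides_interior Om gam t0 rho (proj1 (proj1 Hbd)) Hccw Hrho Hoff).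
apply Rnot_le_lt; intro Hae.
apply (boundary_not_interior_closure Om gam t0 Hbd Hccw).
(* The incoming arc is observed at time [-s], hence on the side of [-a], and the outgoing one on the
   side of [e]. Equal sides contradict the assumed sign of [a * e]; opposite sides feed
   [both_sides_interior]. *)
destruct (Rlt_dec 0 (- s * a)) as [Ha | Ha], (Rlt_dec 0 (s * e)) as [He | He].
- exfalso; nra.
- exact (Hint t b t' b' Ht Ht' Hb Hb' Ox Oy).
- exact (Hint t' b' t b Ht' Ht Hb' Hb Oy Ox).
- exfalso.
  assert (0 < a) by (destruct (Rtotal_order a 0) as [| []]; [nra | tauto | assumption]).
  assert (e < 0) by (destruct (Rtotal_order e 0) as [| []]; [assumption | tauto | nra]).
  nra.
Qed.

(** * Minimising bi-infinite chains *)

(** Bolzano-Weierstrass for the decreasing family [Q e]. If every [y] had a scale at which it fails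
    to be a cluster value, compactness of [[a, b]] would give one positive lower bound [d] for the
    relevant scales, and a point of [Q d] would contradict them. *)
Lemma cluster_value {X : Type} (f : X -> R) (Q : R -> X -> Prop) (a b : R) :
  (forall e e' x, e <= e' -> Q e x -> Q e' x) ->
  (forall e x, Q e x -> a <= f x <= b) ->
  (forall e, 0 < e -> exists x, Q e x) ->
  exists y, forall e, 0 < e -> exists x, Q e x /\ Rabs (f x - y) < e.
Proof.
intros Hmono Hab Hex; apply NNPP; intro Hno.
assert (Hsep : forall y, exists e : posreal, forall x, Q e x -> ~ Rabs (f x - y) < e).
{ intro y; apply NNPP; intro Hy; apply Hno; exists y; intros e He.
  apply NNPP; intro Hx; apply Hy; exists (mkposreal e He); intros x HQ Hlt.
  apply Hx; exists x; split; assumption. }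
pose (delta := fun y => proj1_sig (constructive_indefinite_description _ (Hsep y))).
assert (Hdelta : forall y x, Q (delta y) x -> ~ Rabs (f x - y) < delta y).
{ intro y; exact (proj2_sig (constructive_indefinite_description _ (Hsep y))). }
destruct (compactness_value_1d a b delta) as [d Hd].
destruct (Hex d (cond_pos d)) as [x Hx].
apply (Hd (f x) (Hab d x Hx)); intros [t [_ [Ht1 Ht2]]].
exact (Hdelta t x (Hmono _ _ x Ht2 Hx) Ht1).
Qed.

Definition cluster_pick {X : Type} (f : X -> R) (Q : R -> X -> Prop) : R :=
  epsilon (inhabits 0) (fun y => forall e, 0 < e -> exists x, Q e x /\ Rabs (f x - y) < e).

(** Replaces the extraction of successive subsequences: stage [n] constrains the coordinates below
    [n] to be within [e] of their chosen values. The same [e] indexes the family and measures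
    closeness. *)
Fixpoint cluster_refine {X : Type} (f : nat -> X -> R) (Q : R -> X -> Prop) (n : nat) :
    R -> X -> Prop :=
  match n with
  | O => Q
  | S n => fun e x => cluster_refine f Q n e x /\
             Rabs (f n x - cluster_pick (f n) (cluster_refine f Q n)) < e
  end.

(** Sequential compactness of a countable product of intervals. Each refinement stays monotone and
    inhabited, so the next coordinate again has a cluster value; stage [m] controls all coordinates
    below [m] at once. *)
Lemma cluster_point {X : Type} (f : nat -> X -> R) (Q : R -> X -> Prop) (a b : R) :
  (forall e e' x, e <= e' -> Q e x -> Q e' x) ->
  (forall e x n, Q e x -> a <= f n x <= b) ->
  (forall e, 0 < e -> exists x, Q e x) ->
  exists l : nat -> R, forall m e, 0 < e -> exists x, Q e x /\
    forall i, (i < m)%nat -> Rabs (f i x - l i) < e.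
Proof.
intros Hmono Hab Hex.
assert (Hr : forall n,
  (forall e e' x, e <= e' -> cluster_refine f Q n e x -> cluster_refine f Q n e' x) /\
  (forall e x, cluster_refine f Q n e x -> Q e x) /\
  (forall e, 0 < e -> exists x, cluster_refine f Q n e x)).
{ induction n as [| n [IH1 [IH2 IH3]]]; [repeat split; auto |].
  simpl; repeat split.
  - destruct H0; eapply IH1; eassumption.
  - destruct H0; lra.
  - intros e x [Hx _]; exact (IH2 e x Hx).
  - apply (epsilon_spec (inhabits 0) (fun y => forall e, 0 < e ->
      exists x, cluster_refine f Q n e x /\ Rabs (f n x - y) < e)).
    apply (cluster_value (f n) _ a b); [exact IH1 | | exact IH3].
    intros e x Hx; exact (Hab e x n (IH2 e x Hx)). }
exists (fun i => cluster_pick (f i) (cluster_refine f Q i)); intros m e He.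
destruct (Hr m) as [_ [HQ Hx]]; destruct (Hx e He) as [x Hmx].
exists x; split; [exact (HQ e x Hmx) |].
clear - Hmx; induction m as [| m IH]; intros i Hi; [lia |].
destruct Hmx as [Hmx Hlast].
destruct (Nat.eq_dec i m) as [-> | Hne]; [exact Hlast | apply IH; [exact Hmx | lia]].
Qed.

Definition Z_enum (n : nat) : Z :=
  if Nat.even n then Z.of_nat (Nat.div2 n) else (- Z.of_nat (Nat.div2 n))%Z.

Lemma Z_enum_surjective (z : Z) : exists n, Z_enum n = z.
Proof.
destruct (Z_le_gt_dec 0 z) as [Hz | Hz].
- exists (2 * Z.to_nat z)%nat; unfold Z_enum.
  rewrite Nat.even_mul, Nat.div2_double; simpl; lia.
- exists (S (2 * Z.to_nat (- z))); unfold Z_enum.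
  rewrite Nat.even_succ, Nat.div2_succ_double, Nat.odd_mul; simpl; lia.
Qed.

Lemma cluster_point_Z (Q : R -> (Z -> R) -> Prop) (a b : R) :
  (forall e e' x, e <= e' -> Q e x -> Q e' x) ->
  (forall e x i, Q e x -> a <= x i <= b) ->
  (forall e, 0 < e -> exists x, Q e x) ->
  exists l : Z -> R, forall (s : list Z) e, 0 < e -> exists x, Q e x /\
    forall i, In i s -> Rabs (x i - l i) < e.
Proof.
intros Hmono Hab Hex.
destruct (cluster_point (fun n x => x (Z_enum n)) Q a b Hmono
  (fun e x n => Hab e x (Z_enum n)) Hex) as [l Hl].
pose (code := fun z => proj1_sig (constructive_indefinite_description _ (Z_enum_surjective z))).
assert (Hcode : forall z, Z_enum (code z) = z).
{ intro z; exact (proj2_sig (constructive_indefinite_description _ (Z_enum_surjective z))). }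
exists (fun z => l (code z)); intros s e He.
assert (Hm : exists m, forall i, In i s -> (code i < m)%nat).
{ induction s as [| z s [m Hm]]; [exists O; intros i [] |].
  exists (S (code z + m)); intros i [<- | Hi]; [lia | specialize (Hm i Hi); lia]. }
destruct Hm as [m Hm]; destruct (Hl m e He) as [x [HQ Hx]].
exists x; split; [exact HQ |].
intros i Hi; specialize (Hx (code i) (Hm i Hi)); rewrite Hcode in Hx; exact Hx.
Qed.

(** * Actions of finite chains and locally minimising orbits *)

Fixpoint chain_action (S : Z -> R -> R -> R) (th : Z -> R) (a : Z) (n : nat) : R :=
  match n with
  | O => 0
  | Datatypes.S n => S a (th a) (th (a + 1)%Z) + chain_action S th (a + 1)%Z n
  end.

Definition update (th : Z -> R) (i : Z) (t : R) (j : Z) : R :=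
  if Z.eq_dec j i then t else th j.

Lemma update_eq (th : Z -> R) (i : Z) (t : R) : update th i t i = t.
Proof. unfold update; destruct (Z.eq_dec i i); [reflexivity | congruence]. Qed.

Lemma update_neq (th : Z -> R) (i j : Z) (t : R) : j <> i -> update th i t j = th j.
Proof. intro H; unfold update; destruct (Z.eq_dec j i); [congruence | reflexivity]. Qed.

(** The part of the formal action over Z that involves entry [i]; unlike the total sum it always
    makes sense. *)
Definition local_action (S : Z -> R -> R -> R) (th : Z -> R) (i : Z) (t : R) : R :=
  S (i - 1)%Z (th (i - 1)%Z) t + S i t (th (i + 1)%Z).

Lemma chain_action_update_before (S : Z -> R -> R -> R) (th : Z -> R) (i : Z) (t : R) n a :
  (i < a)%Z -> chain_action S (update th i t) a n = chain_action S th a n.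
Proof.
revert a; induction n as [| n IH]; intros a Ha; [reflexivity |].
simpl; rewrite IH, !update_neq by lia; reflexivity.
Qed.

(** Only the two links meeting at [i] change, and the strict bounds on [i] ensure that both belong
    to the chain. *)
Lemma chain_action_update (S : Z -> R -> R -> R) (th : Z -> R) (i : Z) (t : R) n a :
  (a < i < a + Z.of_nat n)%Z ->
  chain_action S (update th i t) a n - chain_action S th a n =
  local_action S th i t - local_action S th i (th i).
Proof.
unfold local_action; revert a; induction n as [| n IH]; intros a Ha; [lia |].
simpl; rewrite (update_neq th i a) by lia.
destruct (Z.eq_dec (a + 1) i) as [<- | Hne].
- destruct n as [| n]; [lia |]; simpl.
  rewrite chain_action_update_before, update_eq, update_neq by lia.
  replace (a + 1 - 1)%Z with a by lia; ring.
- rewrite (update_neq th i (a + 1)%Z) by exact Hne.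
  specialize (IH (a + 1)%Z ltac:(lia)); lra.
Qed.

Lemma chain_action_lower_bound (S : Z -> R -> R -> R) (lo hi : R) n a :
  (forall k, exists B, forall x y, lo <= x <= hi -> lo <= y <= hi -> B <= S k x y) ->
  exists B, forall th, (forall i, lo <= th i <= hi) -> B <= chain_action S th a n.
Proof.
intro HS; revert a; induction n as [| n IH]; intro a.
- exists 0; intros; apply Rle_refl.
- destruct (HS a) as [B1 HB1], (IH (a + 1)%Z) as [B2 HB2].
  exists (B1 + B2); intros th Hth; simpl; apply Rplus_le_compat; auto.
Qed.

Lemma near_minimiser {X : Type} (P : X -> Prop) (f : X -> R) (e : R) :
  0 < e -> (exists x, P x) -> (exists B, forall x, P x -> B <= f x) ->
  exists x, P x /\ forall y, P y -> f x <= f y + e.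
Proof.
intros He [x0 Hx0] [B HB].
destruct (completeness (fun r => exists x, P x /\ r = - f x)) as [m [Hub Hlub]].
- exists (- B); intros r [x [Hx ->]]; apply Ropp_le_contravar, HB, Hx.
- exists (- f x0), x0; split; [exact Hx0 | reflexivity].
- apply NNPP; intro Hno.
  assert (m <= m - e); [| lra].
  apply Hlub; intros r [x [Hx ->]].
  apply Rnot_lt_le; intro Hlt; apply Hno; exists x; split; [exact Hx |].
  intros y Hy; assert (- f y <= m) by (apply Hub; exists y; split; [exact Hy | reflexivity]).
  lra.
Qed.

(** A near-minimiser of a long finite chain nearly minimises each of its interior local actions, by
    changing one entry. The Lipschitz bounds carry these inequalities over to a coordinatewise
    cluster point, with no error left. *)
Lemma minimising_orbit (S : Z -> R -> R -> R) (lo hi : R) :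
  lo <= hi ->
  (forall k, exists M, forall x y x' y', lo <= x <= hi -> lo <= y <= hi ->
     lo <= x' <= hi -> lo <= y' <= hi ->
     Rabs (S k x y - S k x' y') <= M * (Rabs (x - x') + Rabs (y - y'))) ->
  exists th : Z -> R, (forall i, lo <= th i <= hi) /\
    forall i t, lo <= t <= hi -> local_action S th i (th i) <= local_action S th i t.
Proof.
intros Hlohi HLip.
assert (HLip' : forall k, exists M, 0 <= M /\ forall x y x' y', lo <= x <= hi -> lo <= y <= hi ->
     lo <= x' <= hi -> lo <= y' <= hi ->
     S k x y - S k x' y' <= M * (Rabs (x - x') + Rabs (y - y'))).
{ intro k; destruct (HLip k) as [M HM]; exists (Rabs M); split; [apply Rabs_pos |].
  intros x y x' y' Hx Hy Hx' Hy'.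
  eapply Rle_trans; [apply Rle_abs |]; eapply Rle_trans; [apply HM; assumption |].
  apply Rmult_le_compat_r; [| apply Rle_abs].
  apply Rplus_le_le_0_compat; apply Rabs_pos. }
(* One parameter governs both tolerance and range: the test is imposed at indices of modulus at most
   1/e, a window that widens as [e] decreases. *)
pose (Q := fun e (th : Z -> R) => (forall i, lo <= th i <= hi) /\
  forall i t, lo <= t <= hi -> Rabs (IZR i) * e <= 1 ->
    local_action S th i (th i) <= local_action S th i t + e).
destruct (cluster_point_Z Q lo hi) as [l Hl].
- intros e e' th Hee [Hth Hmin]; split; [exact Hth |]; intros i t Ht Hi.
  pose proof (Rabs_pos (IZR i)).
  apply Rle_trans with (local_action S th i t + e); [apply Hmin; [exact Ht | nra] | lra].
- intros e th i [Hth _]; apply Hth.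
- intros e He; destruct (archimed (/ e)) as [Hup _].
  set (n := Z.to_nat (up (/ e))).
  assert (Hinv : 0 < / e) by (apply Rinv_0_lt_compat, He).
  assert (Hn : / e < IZR (Z.of_nat n)).
  { unfold n; rewrite Z2Nat.id; [exact Hup |]; apply le_IZR; lra. }
  (* The interior indices of this chain are exactly those from [-n] to [n], and [n] exceeds 1/e. *)
  set (a := (- Z.of_nat n - 1)%Z); set (N := (2 * n + 2)%nat).
  destruct (near_minimiser (fun th : Z -> R => forall i, lo <= th i <= hi)
    (fun th => chain_action S th a N) e He) as [th [Hth Hmin]].
  + exists (fun _ => lo); intro; lra.
  + apply chain_action_lower_bound; intro k; destruct (HLip' k) as [M [HM0 HM]].
    (* Lipschitz comparison with the corner (lo, lo) of the square. *)
    exists (S k lo lo - M * (2 * (hi - lo))); intros x y Hx Hy.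
    specialize (HM lo lo x y ltac:(lra) ltac:(lra) Hx Hy).
    rewrite !Rabs_left1 in HM by lra; nra.
  + exists th; split; [exact Hth |]; intros i t Ht Hi.
    assert (Hin : (a < i < a + Z.of_nat N)%Z).
    { assert (Hi' : Rabs (IZR i) < IZR (Z.of_nat n)).
      { apply Rle_lt_trans with (/ e); [| exact Hn].
        apply (Rmult_le_reg_r e); [exact He |]; rewrite Rinv_l by lra; exact Hi. }
      rewrite <- abs_IZR in Hi'; apply lt_IZR in Hi'; unfold a, N; lia. }
    assert (Hup' : forall j, lo <= update th i t j <= hi).
    { intro j; unfold update; destruct (Z.eq_dec j i); [exact Ht | apply Hth]. }
    specialize (Hmin _ Hup').
    pose proof (chain_action_update S th i t N a Hin); lra.
- assert (Hlin : forall i, lo <= l i <= hi).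
  { intro i; split; apply Rnot_lt_le; intro Hlt.
    - destruct (Hl (i :: nil) (lo - l i)) as [x [[Hx _] Hxl]]; [lra |].
      specialize (Hxl i (or_introl eq_refl)); specialize (Hx i).
      rewrite Rabs_pos_eq in Hxl; lra.
    - destruct (Hl (i :: nil) (l i - hi)) as [x [[Hx _] Hxl]]; [lra |].
      specialize (Hxl i (or_introl eq_refl)); specialize (Hx i).
      rewrite Rabs_left1 in Hxl; lra. }
  exists l; split; [exact Hlin |]; intros i t Ht.
  destruct (HLip' (i - 1)%Z) as [M1 [HM10 HM1]], (HLip' i) as [M2 [HM20 HM2]].
  (* Comparing [l] with an approximant costs [2 * M1 * e] and [2 * M2 * e] at [l i], then [M1 * e]
     and [M2 * e] at [t], where only the neighbours move; near-minimality costs one more [e]. *)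
  set (C := 3 * (M1 + M2) + 1).
  assert (HC : 0 < C) by (unfold C; lra).
  apply Rnot_lt_le; intro Hlt.
  set (g := local_action S l i (l i) - local_action S l i t).
  assert (Hg : 0 < g) by (unfold g; lra).
  (* The first bound makes the total error at most half the gap [g]; the second puts [i] inside the
     window of [Q e]. *)
  set (e := Rmin (g / (2 * C)) (/ (Rabs (IZR i) + 1))).
  pose proof (Rabs_pos (IZR i)) as Hi0.
  assert (He : 0 < e).
  { apply Rmin_glb_lt; [apply Rdiv_lt_0_compat; lra | apply Rinv_0_lt_compat; lra]. }
  assert (HeC : C * e < g).
  { apply Rle_lt_trans with (C * (g / (2 * C))).
    - apply Rmult_le_compat_l; [lra | apply Rmin_l].
    - replace (C * (g / (2 * C))) with (g / 2) by (field; lra); lra. }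
  assert (Hie : Rabs (IZR i) * e <= 1).
  { apply Rle_trans with ((Rabs (IZR i) + 1) * / (Rabs (IZR i) + 1)).
    - apply Rmult_le_compat; try lra; apply Rmin_r.
    - rewrite Rinv_r; lra. }
  destruct (Hl ((i - 1)%Z :: i :: (i + 1)%Z :: nil) e He) as [x [[Hx Hxmin] Hxl]].
  specialize (Hxmin i t Ht Hie).
  assert (H0 := Hxl (i - 1)%Z ltac:(simpl; tauto)).
  assert (H1 := Hxl i ltac:(simpl; tauto)).
  assert (H2 := Hxl (i + 1)%Z ltac:(simpl; tauto)).
  assert (K1 := HM1 (l (i - 1)%Z) (l i) (x (i - 1)%Z) (x i) ltac:(auto) ltac:(auto)
    ltac:(auto) ltac:(auto)).
  assert (K2 := HM2 (l i) (l (i + 1)%Z) (x i) (x (i + 1)%Z) ltac:(auto) ltac:(auto)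
    ltac:(auto) ltac:(auto)).
  assert (K3 := HM1 (x (i - 1)%Z) t (l (i - 1)%Z) t ltac:(auto) ltac:(auto)
    ltac:(auto) ltac:(auto)).
  assert (K4 := HM2 t (x (i + 1)%Z) t (l (i + 1)%Z) ltac:(auto) ltac:(auto)
    ltac:(auto) ltac:(auto)).
  rewrite Rminus_diag, Rabs_R0 in K3, K4.
  rewrite (Rabs_minus_sym (l (i - 1)%Z)), (Rabs_minus_sym (l i)) in K1.
  rewrite (Rabs_minus_sym (l i)), (Rabs_minus_sym (l (i + 1)%Z)) in K2.
  unfold local_action in *; unfold C in HeC; unfold g in HeC.
  nra.
Qed.

(** * Stability of homotopy classes and splicing *)

(** The complement of the segment is a union of four open half-planes. *)
Lemma open_off_segment : open off_segment.
Proof.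
assert (Hcases : forall p, off_segment p ->
  fst p < -1 \/ 1 < fst p \/ snd p < 0 \/ 0 < snd p).
{ intros p Hp; unfold off_segment, on_segment in Hp.
  destruct (Rlt_dec (fst p) (-1)); [tauto |]; destruct (Rlt_dec 1 (fst p)); [tauto |].
  destruct (Rtotal_order (snd p) 0) as [H | [H | H]]; try tauto.
  exfalso; apply Hp; split; [lra | exact H]. }
intros p Hp; pose proof (Hcases p Hp) as Hcase.
assert (Hf : continuous (fst : plane -> R) p) by (destruct p; apply continuous_fst).
assert (Hs : continuous (snd : plane -> R) p) by (destruct p; apply continuous_snd).
assert (Hgoal : forall (g : plane -> R) (A : R -> Prop), continuous g p -> open A -> A (g p) ->
  (forall q, A (g q) -> off_segment q) -> locally p off_segment).
{ intros g A Hg HA Hp' Hoff; exact (filter_imp _ _ Hoff (Hg A (HA _ Hp'))). }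
destruct Hcase as [H | [H | [H | H]]];
  [apply (Hgoal fst _ Hf (open_lt (-1)) H) | apply (Hgoal fst _ Hf (open_gt 1) H)
  | apply (Hgoal snd _ Hs (open_lt 0) H) | apply (Hgoal snd _ Hs (open_gt 0) H)];
  intros q Hq [Hq1 Hq2]; lra.
Qed.

Lemma continuous_on_ext {T V : UniformSpace} (D : T -> Prop) (f g : T -> V) :
  (forall x, D x -> f x = g x) -> continuous_on D f -> continuous_on D g.
Proof.
intros E Hf x Dx; rewrite <- (E x Dx); intros P HP; specialize (Hf x Dx P HP).
unfold filtermap, within in *; revert Hf; apply filter_imp.
intros y H Dy; rewrite <- (E y Dy); auto.
Qed.

Lemma continuous_on_comp {T V W : UniformSpace} (D : T -> Prop) (E : V -> Prop)
    (f : T -> V) (g : V -> W) :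
  (forall x, D x -> E (f x)) -> continuous_on D f -> continuous_on E g ->
  continuous_on D (fun x => g (f x)).
Proof.
intros HDE Hf Hg x Dx P HP.
specialize (Hf x Dx _ (Hg (f x) (HDE x Dx) P HP)).
unfold filtermap, within in *; revert Hf; apply filter_imp.
intros y H Dy; apply H; auto.
Qed.

Lemma continuous_on_everywhere {T V : UniformSpace} (D : T -> Prop) (f : T -> V) :
  (forall x, D x -> continuous f x) -> continuous_on D f.
Proof.
intros Hf x Dx P HP; specialize (Hf x Dx P HP).
unfold filtermap, within in *; revert Hf; apply filter_imp; auto.
Qed.

Lemma continuous_on_glue {V : UniformSpace} (f : R -> V) (a b c : R) :
  continuous_on (fun t => a <= t <= b) f -> continuous_on (fun t => b <= t <= c) f ->
  continuous_on (fun t => a <= t <= c) f.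
Proof.
intros H1 H2 t Ht P HP; unfold filtermap, within.
destruct (Rtotal_order t b) as [Hlt | [-> | Hgt]].
- assert (Hab : a <= t <= b) by lra; specialize (H1 t Hab P HP).
  unfold filtermap, within in H1.
  generalize (filter_and _ _ H1 (open_lt b t Hlt)); apply filter_imp.
  intros y [Hy Hyb] Hyac; apply Hy; lra.
- assert (Hab : a <= b <= b) by lra; assert (Hbc : b <= b <= c) by lra.
  specialize (H1 b Hab P HP); specialize (H2 b Hbc P HP).
  unfold filtermap, within in H1, H2.
  generalize (filter_and _ _ H1 H2); apply filter_imp.
  intros y [Hy1 Hy2] Hyac; destruct (Rle_dec y b); [apply Hy1 | apply Hy2]; lra.
- assert (Hbc : b <= t <= c) by lra; specialize (H2 t Hbc P HP).
  unfold filtermap, within in H2.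
  generalize (filter_and _ _ H2 (open_gt b t Hgt)); apply filter_imp.
  intros y [Hy Hyb] Hyac; apply Hy; lra.
Qed.

Lemma continuous_on_plus {T : UniformSpace} {V : NormedModule R_AbsRing} (D : T -> Prop)
    (f g : T -> V) :
  continuous_on D f -> continuous_on D g -> continuous_on D (fun x => plus (f x) (g x)).
Proof.
intros Hf Hg x Dx.
apply (filterlim_comp_2 _ _ plus (Hf x Dx) (Hg x Dx)), filterlim_plus.
Qed.

Lemma continuous_on_scal {T : UniformSpace} {V : NormedModule R_AbsRing} (D : T -> Prop)
    (f : T -> R) (g : T -> V) :
  continuous_on D f -> continuous_on D g -> continuous_on D (fun x => scal (f x) (g x)).
Proof.
intros Hf Hg x Dx.
apply (filterlim_comp_2 (H := locally (g x)) (G := locally (f x)) _ _ scal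
  (Hf x Dx) (Hg x Dx)), (filterlim_scal (K := R_AbsRing) (f x) (g x)).
Qed.

(** Only [s] is confined to [[a, b]]: the parameter of a slid endpoint may leave the interval
    between the original ones. *)
Lemma uniform_continuity (f : R -> plane) (a b : R) (eps : posreal) :
  (forall t, continuous f t) ->
  exists d : posreal, forall s t, a <= s <= b -> Rabs (t - s) < d -> ball (f s) eps (f t).
Proof.
intro Hf.
assert (Hloc : forall u, exists d : posreal, forall s, Rabs (s - u) < 2 * d ->
   ball (f u) (eps / 2) (f s)).
{ intro u; assert (He : 0 < eps / 2) by (pose proof (cond_pos eps); lra).
  destruct (Hf u _ (locally_ball (f u) (mkposreal _ He))) as [d Hd].
  assert (Hd2 : 0 < d / 2) by (pose proof (cond_pos d); lra).
  exists (mkposreal _ Hd2); intros s Hs; apply Hd; change (Rabs (s - u) < d); simpl in Hs; lra. }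
pose (delta := fun u => proj1_sig (constructive_indefinite_description _ (Hloc u))).
assert (Hdelta : forall u s, Rabs (s - u) < 2 * delta u -> ball (f u) (eps / 2) (f s)).
{ intro u; exact (proj2_sig (constructive_indefinite_description _ (Hloc u))). }
destruct (compactness_value_1d a b delta) as [d Hd].
exists d; intros s t Hs Hst.
apply NNPP; intro Hno; apply (Hd s Hs); intros [u [_ [Hu Hdu]]]; apply Hno.
pose proof (Rabs_pos (t - s)).
replace (RIneq.pos eps) with (eps / 2 + eps / 2) by field.
apply ball_triangle with (f u).
- apply ball_sym, Hdelta; lra.
- apply Hdelta; replace (t - u) with ((t - s) + (s - u)) by ring.
  eapply Rle_lt_trans; [apply Rabs_triang | lra].
Qed.

(** The homotopy has compact image in an open set, so a single radius [d] around it avoids the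
    segment. A loop closer than [d] to the initial one can then be absorbed by deforming the
    homotopy. *)
Lemma homotopy_stability (u v : R -> plane) :
  homotopic_in off_segment u v ->
  exists d : posreal,
    (forall t q, unit_interval t -> ball (u t) d q -> off_segment q) /\
    forall w, continuous_on unit_interval w -> w 0 = w 1 ->
      (forall t, unit_interval t -> ball (u t) d (w t)) -> homotopic_in off_segment w v.
Proof.
intros [H [Hc [HD [Hends Hloop]]]].
set (sq := fun q : R * R => unit_interval (fst q) /\ unit_interval (snd q)) in *.
(* [compactness_value_2d] takes a radius function defined on the whole plane, so membership in the
   square is a premise after [e], and radius 1 serves outside. *)
assert (Hloc : forall s t, exists e : posreal, unit_interval s -> unit_interval t ->
   forall s' t', unit_interval s' -> unit_interval t' -> Rabs (s' - s) < e -> Rabs (t' - t) < e ->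
   forall q, ball (H (s', t')) e q -> off_segment q).
{ intros s t.
  destruct (classic (unit_interval s /\ unit_interval t)) as [[Hs Ht] | Hn];
    [| exists (mkposreal 1 Rlt_0_1); intros Hs Ht; exfalso; apply Hn; split; assumption].
  destruct (open_off_segment _ (HD s t Hs Ht)) as [e1 He1].
  pose proof (cond_pos e1) as He1p.
  assert (Hhalf : 0 < e1 / 2) by lra.
  destruct (Hc (s, t) (conj Hs Ht) _ (locally_ball (H (s, t)) (mkposreal _ Hhalf))) as [e2 He2].
  assert (He : 0 < Rmin e2 (e1 / 2)) by (apply Rmin_glb_lt; [apply cond_pos | lra]).
  exists (mkposreal _ He); simpl; intros _ _ s' t' Hs' Ht' Hss Htt q Hq.
  pose proof (Rmin_l e2 (e1 / 2)); pose proof (Rmin_r e2 (e1 / 2)).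
  apply He1; replace (RIneq.pos e1) with (e1 / 2 + e1 / 2) by field.
  apply ball_triangle with (H (s', t')).
  - apply (He2 (s', t')); [| split; assumption].
    split; [change (Rabs (s' - s) < e2) | change (Rabs (t' - t) < e2)]; lra.
  - apply ball_le with (Rmin e2 (e1 / 2)); [lra | exact Hq]. }
pose (delta := fun s t => proj1_sig (constructive_indefinite_description _ (Hloc s t))).
assert (Hdelta : forall s t, unit_interval s -> unit_interval t ->
   forall s' t', unit_interval s' -> unit_interval t' ->
   Rabs (s' - s) < delta s t -> Rabs (t' - t) < delta s t ->
   forall q, ball (H (s', t')) (delta s t) q -> off_segment q).
{ intros s t; exact (proj2_sig (constructive_indefinite_description _ (Hloc s t))). }
destruct (compactness_value_2d 0 1 0 1 delta) as [d Hd].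
assert (Hball : forall s t q, unit_interval s -> unit_interval t ->
   ball (H (s, t)) d q -> off_segment q).
{ intros s t q Hs Ht Hq; apply NNPP; intro Hno; apply (Hd s t Hs Ht).
  intros [s0 [t0 [Hs0 [Ht0 [Hss [Htt Hdd]]]]]]; apply Hno.
  apply (Hdelta s0 t0 Hs0 Ht0 s t Hs Ht Hss Htt).
  apply ball_le with d; assumption. }
assert (H01 : unit_interval 0) by (unfold unit_interval; lra).
assert (H11 : unit_interval 1) by (unfold unit_interval; lra).
exists d; split.
- intros t q Ht; rewrite <- (proj1 (Hends t Ht)); apply Hball; assumption.
- intros w Hw Hw01 Hclose.
  (* Adding [(1 - s) (w - u)] to the given homotopy avoids gluing two homotopies. *)
  pose (V := prod_NormedModule R_AbsRing R_NormedModule R_NormedModule).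
  exists (fun q => plus (G := V) (H q)
     (scal (V := V) (1 - fst q) (plus (G := V) (w (snd q)) (scal (V := V) (-1) (H (0, snd q)))))).
  assert (Hform : forall s t,
     plus (G := V) (H (s, t)) (scal (V := V) (1 - s)
       (plus (G := V) (w t) (scal (V := V) (-1) (H (0, t))))) =
     (fst (H (s, t)) + (1 - s) * (fst (w t) + -1 * fst (H (0, t))),
      snd (H (s, t)) + (1 - s) * (snd (w t) + -1 * snd (H (0, t)))))
    by reflexivity.
  repeat split.
  + apply (continuous_on_plus (V := V)); [exact Hc |].
    apply (continuous_on_scal (V := V)).
    * apply continuous_on_everywhere; intros [s t] _.
      apply (continuous_minus (V := R_NormedModule) (fun _ => 1) fst);
        [apply continuous_const | apply continuous_fst].
    * apply (continuous_on_plus (V := V)); [| apply (continuous_on_scal (V := V))].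
      -- apply (continuous_on_comp sq unit_interval snd w); [intros q Hq; apply Hq | | exact Hw].
         apply continuous_on_everywhere; intros [s t] _; apply continuous_snd.
      -- apply continuous_on_everywhere; intros q _; apply continuous_const.
      -- apply (continuous_on_comp sq sq (fun q => (0, snd q)) H);
           [intros q Hq; split; [exact H01 | apply Hq] | | exact Hc].
         apply continuous_on_everywhere; intros [s t] _.
         apply (continuous_pair (fun _ => 0) snd); [apply continuous_const | apply continuous_snd].
  + intros s t Hs Ht; simpl fst; simpl snd; rewrite Hform.
    apply (Hball s t _ Hs Ht).
    assert (Hb := Hclose t Ht); rewrite <- (proj1 (Hends t Ht)) in Hb.
    destruct Hb as [Hb1 Hb2].
    change (Rabs (fst (w t) - fst (H (0, t))) < d) in Hb1.
    change (Rabs (snd (w t) - snd (H (0, t))) < d) in Hb2.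
    (* The correction fades by the factor [1 - s], so it never exceeds its initial size. *)
    assert (Hsmall : forall r, Rabs r < d -> Rabs ((1 - s) * r) < d).
    { intros r Hr; rewrite Rabs_mult; unfold unit_interval in Hs.
      rewrite (Rabs_pos_eq (1 - s)) by lra; pose proof (Rabs_pos r); nra. }
    split.
    * change (Rabs (fst (H (s, t)) + (1 - s) * (fst (w t) + -1 * fst (H (0, t))) -
        fst (H (s, t))) < d).
      replace (fst (H (s, t)) + (1 - s) * (fst (w t) + -1 * fst (H (0, t))) - fst (H (s, t)))
        with ((1 - s) * (fst (w t) - fst (H (0, t)))) by ring; auto.
    * change (Rabs (snd (H (s, t)) + (1 - s) * (snd (w t) + -1 * snd (H (0, t))) -
        snd (H (s, t))) < d).
      replace (snd (H (s, t)) + (1 - s) * (snd (w t) + -1 * snd (H (0, t))) - snd (H (s, t)))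
        with ((1 - s) * (snd (w t) - snd (H (0, t)))) by ring; auto.
  + simpl fst; simpl snd; rewrite Hform; destruct (w t); simpl; f_equal; ring.
  + simpl fst; simpl snd; rewrite Hform, <- (proj2 (Hends t H0)).
    destruct (H (1, t)); simpl; f_equal; ring.
  + intros s Hs; simpl fst; simpl snd; rewrite !Hform, (Hloop s Hs), (Hloop 0 H01), Hw01.
    reflexivity.
Qed.

(** * Piecewise C1 curves and replacement of a piece by a chord *)

(** A tree of concatenations, which can be cut and joined by induction without renumbering a
    subdivision; [piecewise_C1_pieces] and [pieces_piecewise_C1] translate to and from
    [piecewise_C1]. *)
Inductive C1_pieces (f : R -> plane) : R -> R -> Prop :=
| C1_piece a b d : a < b -> C1_curve d -> (forall t, a <= t <= b -> f t = d t) -> C1_pieces f a b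
| C1_pieces_cat a b c : C1_pieces f a b -> C1_pieces f b c -> C1_pieces f a c.

Lemma C1_pieces_lt (f : R -> plane) (a b : R) : C1_pieces f a b -> a < b.
Proof. induction 1; lra. Qed.

Lemma C1_pieces_ext (f g : R -> plane) (a b : R) :
  C1_pieces f a b -> (forall t, a <= t <= b -> f t = g t) -> C1_pieces g a b.
Proof.
induction 1 as [a b d Hab Hd E | a b c H1 IH1 H2 IH2]; intro Eg.
- apply (C1_piece g a b d); [exact Hab | exact Hd |].
  intros t Ht; rewrite <- Eg by exact Ht; apply E, Ht.
- pose proof (C1_pieces_lt _ _ _ H1); pose proof (C1_pieces_lt _ _ _ H2).
  apply C1_pieces_cat with b; [apply IH1 | apply IH2]; intros t Ht; apply Eg; lra.
Qed.

Lemma C1_pieces_split (f : R -> plane) (a b c : R) :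
  C1_pieces f a b -> a < c < b -> C1_pieces f a c /\ C1_pieces f c b.
Proof.
intro H; revert c; induction H as [a b d Hab Hd E | a m b H1 IH1 H2 IH2]; intros c Hc.
- split; (apply (C1_piece f _ _ d); [lra | exact Hd | intros t Ht; apply E; lra]).
- pose proof (C1_pieces_lt _ _ _ H1); pose proof (C1_pieces_lt _ _ _ H2).
  destruct (Rtotal_order c m) as [Hlt | [-> | Hgt]].
  + destruct (IH1 c) as [Ha Hb]; [lra |].
    split; [exact Ha | apply C1_pieces_cat with m; assumption].
  + split; assumption.
  + destruct (IH2 c) as [Ha Hb]; [lra |].
    split; [apply C1_pieces_cat with m; assumption | exact Hb].
Qed.

Lemma C1_pieces_continuous_on (f : R -> plane) (a b : R) :
  C1_pieces f a b -> continuous_on (fun t => a <= t <= b) f.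
Proof.
induction 1 as [a b d Hab Hd E | a b c H1 IH1 H2 IH2].
- apply (continuous_on_ext _ d); [intros t Ht; symmetry; apply E, Ht |].
  apply continuous_on_everywhere; intros t _; apply C1_curve_continuous, Hd.
- apply continuous_on_glue with b; assumption.
Qed.

Lemma piecewise_C1_pieces (c : curve) :
  0 < dur c -> piecewise_C1 c -> C1_pieces (pos c) 0 (dur c).
Proof.
intros Hd [n [a [Ha0 [Han Ha]]]]; rewrite <- Ha0, <- Han in *; clear Han.
assert (Hm : forall m, (m < n)%nat -> C1_pieces (pos c) (a 0%nat) (a (S m))).
{ induction m as [| m IH]; intro Hmn.
  - destruct (Ha 0%nat Hmn) as [Hlt [d [Hd1 E]]]; exact (C1_piece _ _ _ d Hlt Hd1 E).
  - destruct (Ha (S m) Hmn) as [Hlt [d [Hd1 E]]].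
    apply C1_pieces_cat with (a (S m)); [apply IH; lia | exact (C1_piece _ _ _ d Hlt Hd1 E)]. }
destruct n as [| n]; [lra | apply Hm; lia].
Qed.

Lemma pieces_piecewise_C1 (f : R -> plane) (T : R) :
  C1_pieces f 0 T -> piecewise_C1 (Curve T f).
Proof.
assert (Hgen : forall a b, C1_pieces f a b -> exists (n : nat) (u : nat -> R),
  u 0%nat = a /\ u n = b /\ forall i, (i < n)%nat -> u i < u (S i) /\
    exists d, C1_curve d /\ forall t, u i <= t <= u (S i) -> f t = d t).
{ induction 1 as [a b d Hab Hd E | a b c _ [n [u [Hu0 [Hun Hu]]]] _ [m [v [Hv0 [Hvm Hv]]]]].
  - exists 1%nat, (fun i => match i with O => a | _ => b end).
    split; [reflexivity | split; [reflexivity |]]; intros i Hi.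
    replace i with 0%nat by lia; split; [exact Hab | exists d; split; assumption].
  - exists (n + m)%nat, (fun i => if Nat.leb i n then u i else v (i - n)%nat).
    split; [exact Hu0 | split].
    + destruct (Nat.leb_spec (n + m) n) as [Hle | Hgt].
      * replace (n + m)%nat with n by lia; rewrite Hun, <- Hvm; replace m with 0%nat by lia.
        symmetry; exact Hv0.
      * replace (n + m - n)%nat with m by lia; exact Hvm.
    + intros i Hi.
      destruct (Nat.leb_spec i n) as [Hin | Hin], (Nat.leb_spec (S i) n) as [HSin | HSin]; try lia.
      * apply Hu; lia.
      * replace i with n by lia; replace (S n - n)%nat with 1%nat by lia.
        rewrite Hun, <- Hv0; apply Hv; lia.
      * replace (S i - n)%nat with (S (i - n)) by lia; apply Hv; lia. }
intro H; apply Hgen; exact H.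
Qed.

Definition affine_path (al be : R) (P Q : plane) (t : R) : plane :=
  (fst P + (t - al) / (be - al) * (fst Q - fst P),
   snd P + (t - al) / (be - al) * (snd Q - snd P)).

Lemma affine_path_start (al be : R) (P Q : plane) : affine_path al be P Q al = P.
Proof.
unfold affine_path, Rdiv; rewrite Rminus_diag, Rmult_0_l, !Rmult_0_l, !Rplus_0_r.
symmetry; apply surjective_pairing.
Qed.

Lemma affine_path_end (al be : R) (P Q : plane) : al < be -> affine_path al be P Q be = Q.
Proof.
intro H; unfold affine_path, Rdiv; rewrite Rinv_r, !Rmult_1_l by lra.
destruct Q; simpl; f_equal; ring.
Qed.

Lemma is_derive_pair (f g : R -> R) (t lf lg : R) :
  is_derive f t lf -> is_derive g t lg -> is_derive (fun u => (f u, g u) : plane) t (lf, lg).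
Proof.
intros Hf Hg.
apply (filterdiff_ext_lin _ (fun y : R => (scal y lf, scal y lg) : plane)); [| reflexivity].
apply (filterdiff_comp_2 f g (fun a b => (a, b)) _ _ (fun a b => (a, b)) Hf Hg).
apply filterdiff_ext with (fun x : R * R => x); [intros []; reflexivity |].
apply filterdiff_ext_lin with (fun x : R * R => x); [apply filterdiff_id | intros []; reflexivity].
Qed.

Definition affine_velocity (al be : R) (P Q : plane) : plane :=
  ((fst Q - fst P) / (be - al), (snd Q - snd P) / (be - al)).

Lemma velocity_of_is_derive (c : R -> plane) (t : R) (l : plane) :
  is_derive c t l -> velocity c t = l.
Proof.
intro H; destruct l as [l1 l2]; unfold velocity; f_equal; apply is_derive_unique.
- exact (is_derive_fst _ _ _ H).
- exact (is_derive_snd _ _ _ H).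
Qed.

Lemma is_derive_affine_path (al be : R) (P Q : plane) (t : R) :
  is_derive (affine_path al be P Q) t (affine_velocity al be P Q).
Proof. apply is_derive_pair; auto_derive; trivial; unfold Rdiv; ring. Qed.

Lemma C1_curve_affine_path (al be : R) (P Q : plane) : C1_curve (affine_path al be P Q).
Proof.
intro t; rewrite (velocity_of_is_derive _ _ _ (is_derive_affine_path al be P Q t)).
split; [apply is_derive_affine_path |].
apply (continuous_ext (fun _ => affine_velocity al be P Q)); [| apply continuous_const].
intro s; symmetry; apply velocity_of_is_derive, is_derive_affine_path.
Qed.

(** The chord is used on the closed interval, so that when [al] or [be] is an end of the time
    interval the endpoint of the curve moves to [P] or [Q]. *)
Definition splice (x : R -> plane) (al be : R) (P Q : plane) (t : R) : plane :=
  if Rle_dec al t then if Rle_dec t be then affine_path al be P Q t else x t else x t.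

Lemma splice_inside (x : R -> plane) (al be : R) (P Q : plane) (t : R) :
  al <= t <= be -> splice x al be P Q t = affine_path al be P Q t.
Proof. intro H; unfold splice; destruct (Rle_dec al t), (Rle_dec t be); trivial; lra. Qed.

Lemma splice_outside (x : R -> plane) (al be : R) (P Q : plane) (t : R) :
  t < al \/ be < t -> splice x al be P Q t = x t.
Proof. intro H; unfold splice; destruct (Rle_dec al t), (Rle_dec t be); trivial; lra. Qed.

(** At an interior time the chord has to match [x]; at an end of the time interval it may detach
    from it, which is how endpoints slide. *)
Lemma splice_C1_pieces (x : R -> plane) (al be T : R) (P Q : plane) :
  C1_pieces x 0 T -> 0 <= al < be -> be <= T ->
  (al = 0 \/ x al = P) -> (be = T \/ x be = Q) ->
  C1_pieces (splice x al be P Q) 0 T.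
Proof.
intros Hx Hal Hbe HP HQ.
assert (Hmid : C1_pieces (splice x al be P Q) al be).
{ apply (C1_piece _ _ _ (affine_path al be P Q)); [lra | apply C1_curve_affine_path |].
  apply splice_inside. }
assert (Hleft : C1_pieces (splice x al be P Q) 0 be).
{ destruct (Rlt_dec 0 al) as [H0 | H0]; [| replace 0 with al by lra; exact Hmid].
  apply C1_pieces_cat with al; [| exact Hmid].
  apply C1_pieces_ext with x; [exact (proj1 (C1_pieces_split x 0 T al Hx ltac:(lra))) |].
  intros t Ht; destruct (Rlt_dec t al); [symmetry; apply splice_outside; lra |].
  replace t with al by lra; rewrite splice_inside, affine_path_start by lra.
  destruct HP; [lra | assumption]. }
destruct (Rlt_dec be T) as [HT | HT]; [| replace T with be by lra; exact Hleft].
apply C1_pieces_cat with be; [exact Hleft |].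
apply C1_pieces_ext with x; [exact (proj2 (C1_pieces_split x 0 T be Hx ltac:(lra))) |].
intros t Ht; destruct (Rlt_dec be t); [symmetry; apply splice_outside; lra |].
replace t with be by lra; rewrite splice_inside, affine_path_end by lra.
destruct HQ; [lra | assumption].
Qed.

Lemma close_up_continuous_on (gam : R -> plane) (th1 th2 : R) (c : curve) :
  (forall t, continuous gam t) -> 0 < dur c ->
  continuous_on (fun t => 0 <= t <= dur c) (pos c) -> pos c (dur c) = gam th2 ->
  continuous_on unit_interval (close_up gam th1 th2 c).
Proof.
intros Hg Hd Hc Hend; apply continuous_on_glue with (/ 2).
- apply (continuous_on_ext _ (fun t => pos c (2 * t * dur c))).
  + intros t Ht; unfold close_up; destruct (Rle_dec t (/ 2)); [reflexivity | lra].
  + apply (continuous_on_comp _ _ (fun t => 2 * t * dur c) (pos c)) with (3 := Hc).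
    * intros t Ht; split; nra.
    * apply continuous_on_everywhere; intros t _.
      apply (ex_derive_continuous (V := R_NormedModule)); auto_derive; trivial.
- apply (continuous_on_ext _ (fun t => gam (th2 + (2 * t - 1) * (th1 - th2)))).
  + intros t Ht; unfold close_up; destruct (Rle_dec t (/ 2)); [| reflexivity].
    replace t with (/ 2) by lra.
    replace (2 * / 2 * dur c) with (dur c) by field; rewrite Hend; f_equal; field.
  + apply continuous_on_everywhere; intros t _.
    apply (continuous_comp (fun t => th2 + (2 * t - 1) * (th1 - th2)) gam); [| apply Hg].
    apply (ex_derive_continuous (V := R_NormedModule)); auto_derive; trivial.
Qed.

(** The closed-up loop moves little: on the first half because the chord is close to the replaced
    piece, on the second by uniform continuity of [gam]. Stability then preserves the homotopy class
    and keeps the curve off the segment. *)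
Lemma competitor_splice (gam : R -> plane) (k : Z) (th1 th2 : R) (c : curve) :
  C1_curve gam -> competitor gam k th1 th2 c ->
  exists rho : posreal, forall al be P Q th1' th2',
    0 <= al < be -> be <= dur c ->
    (al = 0 \/ pos c al = P) -> (be = dur c \/ pos c be = Q) ->
    splice (pos c) al be P Q 0 = gam th1' -> splice (pos c) al be P Q (dur c) = gam th2' ->
    Rabs (th1' - th1) < rho -> Rabs (th2' - th2) < rho ->
    (forall t, al <= t <= be -> ball (pos c t) rho (affine_path al be P Q t)) ->
    competitor gam k th1' th2' (Curve (dur c) (splice (pos c) al be P Q)).
Proof.
intros Hg [Hdur [Hpw [Hoff [Hstart [Hend Hw]]]]].
apply (piecewise_C1_pieces c Hdur) in Hpw.
assert (Hgc : forall t, continuous gam t) by (intro; apply C1_curve_continuous, Hg).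
destruct (homotopy_stability _ _ Hw) as [d [Hball Hstab]].
destruct (uniform_continuity gam (Rmin th1 th2) (Rmax th1 th2) d Hgc) as [d' Hd'].
assert (Hr : 0 < Rmin d d') by (apply Rmin_glb_lt; apply cond_pos).
exists (mkposreal _ Hr); simpl; intros al be P Q th1' th2' Hal Hbe HP HQ H0 HT H1 H2 Hnear.
pose proof (Rmin_l d d') as Hrd; pose proof (Rmin_r d d') as Hrd'.
set (x' := splice (pos c) al be P Q) in *.
assert (Hnear' : forall t, 0 <= t <= dur c -> ball (pos c t) d (x' t)).
{ intros t Ht; unfold x'.
  destruct (Rlt_dec t al); [rewrite splice_outside by lra; apply ball_center |].
  destruct (Rlt_dec be t); [rewrite splice_outside by lra; apply ball_center |].
  rewrite splice_inside by lra; apply ball_le with (Rmin d d'); [exact Hrd | apply Hnear; lra]. }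
assert (Hpieces : C1_pieces x' 0 (dur c)) by (apply splice_C1_pieces; assumption).
repeat split; simpl; try assumption.
- apply pieces_piecewise_C1, Hpieces.
- intros t Ht.
  (* The time at which [close_up] passes through [pos c t]. *)
  apply (Hball (t / (2 * dur c))).
  + split; [apply Rdiv_le_0_compat; lra |].
    apply (Rmult_le_reg_r (2 * dur c)); [lra |].
    unfold Rdiv; rewrite Rmult_assoc, Rinv_l by lra; lra.
  + unfold close_up.
    replace (2 * (t / (2 * dur c)) * dur c) with t by (field; lra).
    destruct (Rle_dec (t / (2 * dur c)) (/ 2)) as [_ | Hno]; [apply Hnear', Ht |].
    exfalso; apply Hno; apply (Rmult_le_reg_r (2 * dur c)); [lra |].
    unfold Rdiv; rewrite Rmult_assoc, Rinv_l by lra; lra.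
- apply Hstab.
  + apply close_up_continuous_on; simpl; try assumption.
    apply C1_pieces_continuous_on, Hpieces.
  + unfold close_up; simpl.
    destruct (Rle_dec 0 (/ 2)); [| lra]; destruct (Rle_dec 1 (/ 2)); [lra |].
    replace (2 * 0 * dur c) with 0 by ring; rewrite H0; f_equal; ring.
  + intros t Ht; unfold unit_interval in Ht; unfold close_up; simpl.
    destruct (Rle_dec t (/ 2)) as [Hle | Hgt]; [apply Hnear'; split; nra |].
    apply Hd'.
    * pose proof (Rmin_l th1 th2); pose proof (Rmin_r th1 th2).
      pose proof (Rmax_l th1 th2); pose proof (Rmax_r th1 th2); split; nra.
    (* The parameter on the closing arc is shifted by a convex combination of the shifts of [th1]
       and [th2]. *)
    * apply Rabs_def2 in H1; apply Rabs_def2 in H2.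
      pose proof (convex_combination_lt (th2' - th2) (th1' - th1) d' (2 * t - 1)).
      pose proof (convex_combination_lt (- (th2' - th2)) (- (th1' - th1)) d' (2 * t - 1)).
      apply Rabs_def1; lra.
Qed.

(** * First variation of the Jacobi length *)

(** The product norm of Coquelicot is Euclidean, which provides the triangle inequality. *)
Lemma enorm_norm (u : plane) : enorm u = norm u.
Proof.
destruct u as [x y]; unfold enorm, dot, norm; simpl; unfold prod_norm; simpl.
f_equal; change (norm x) with (Rabs x); change (norm y) with (Rabs y).
rewrite !Rmult_1_r, <- !Rabs_mult, !Rabs_pos_eq; [reflexivity | nra | nra].
Qed.

Lemma enorm_triang (u v : plane) : enorm (fst u + fst v, snd u + snd v) <= enorm u + enorm v.
Proof. rewrite !enorm_norm; apply (norm_triangle u v). Qed.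

Lemma enorm_ge_0 (u : plane) : 0 <= enorm u.
Proof. apply sqrt_pos. Qed.

Lemma enorm_sqr (u : plane) : enorm u * enorm u = dot u u.
Proof. apply sqrt_sqrt; unfold dot; nra. Qed.

Lemma enorm_scal (a : R) (u : plane) : 0 <= a -> enorm (a * fst u, a * snd u) = a * enorm u.
Proof.
intro Ha; unfold enorm, dot; simpl.
replace (a * fst u * (a * fst u) + a * snd u * (a * snd u))
  with (a * a * (fst u * fst u + snd u * snd u)) by ring.
rewrite sqrt_mult_alt by nra; rewrite sqrt_square by exact Ha; reflexivity.
Qed.

Lemma enorm_le_abs (u : plane) : enorm u <= Rabs (fst u) + Rabs (snd u).
Proof.
pose proof (Rabs_pos (fst u)); pose proof (Rabs_pos (snd u)).
rewrite <- (sqrt_square (Rabs (fst u) + Rabs (snd u))) by lra.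
apply sqrt_le_1_alt; unfold dot.
rewrite <- (Rabs_pos_eq (fst u * fst u)), <- (Rabs_pos_eq (snd u * snd u)), !Rabs_mult by nra.
nra.
Qed.

Lemma U_continuous (m1 m2 : R) (p : plane) : p <> c1 -> p <> c2 -> continuous (U m1 m2) p.
Proof.
intros H1 H2; unfold U.
assert (Hone : forall m c, p <> c -> continuous (fun q : plane => m / edist q c) p).
{ intros m c Hc; pose proof (edist_pos p c Hc).
  apply (continuous_comp (fun q : plane => edist q c) (fun r => m / r)).
  - apply (continuous_edist (fun q => q) (fun _ => c));
      [apply continuous_id | apply continuous_const].
  - apply (ex_derive_continuous (V := R_NormedModule)); auto_derive; lra. }
apply (continuous_plus (V := R_NormedModule)
  (fun q : plane => m1 / edist q c1) (fun q : plane => m2 / edist q c2)); auto.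
Qed.

Lemma U_ge_0 (m1 m2 : R) (p : plane) : m1 >= m2 -> m2 > 0 -> 0 <= U m1 m2 p.
Proof.
intros H1 H2; unfold U.
assert (Hone : forall m c, 0 < m -> 0 <= m / edist p c).
{ intros m c Hm; apply Rmult_le_pos; [lra |].
  destruct (enorm_ge_0 (fst p - fst c, snd p - snd c)) as [H | H]; fold (edist p c) in H.
  - left; apply Rinv_0_lt_compat, H.
  (* At a centre the quotient is 0, as [/ 0] is 0. *)
  - rewrite <- H, Rinv_0; lra. }
apply Rplus_le_le_0_compat; apply Hone; lra.
Qed.

(** The conformal factor of the Jacobi metric; by the energy relation it is also the squared speed
    of an energy-[h] trajectory. *)
Definition density (m1 m2 h : R) (p : plane) : R := 2 * (h + U m1 m2 p).

Lemma density_ge_0 (m1 m2 h : R) (p : plane) :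
  m1 >= m2 -> m2 > 0 -> h >= 0 -> 0 <= density m1 m2 h p.
Proof. intros; unfold density; pose proof (U_ge_0 m1 m2 p); lra. Qed.

Lemma density_continuous (m1 m2 h : R) (p : plane) :
  p <> c1 -> p <> c2 -> continuous (density m1 m2 h) p.
Proof.
intros H1 H2; apply (continuous_comp (U m1 m2) (fun r => 2 * (h + r))).
- apply U_continuous; assumption.
- apply (ex_derive_continuous (V := R_NormedModule)); auto_derive; trivial.
Qed.

Lemma continuous_sqrt_comp {T : UniformSpace} (f : T -> R) (x : T) :
  continuous f x -> 0 <= f x -> continuous (fun y => sqrt (f y)) x.
Proof.
intros Hf H0; apply (continuous_comp f sqrt x Hf).
apply continuity_pt_filterlim, continuity_pt_sqrt, H0.
Qed.

Lemma g_norm_enorm (m1 m2 h : R) (p v : plane) :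
  m1 >= m2 -> m2 > 0 -> h >= 0 -> g_norm m1 m2 h p v = sqrt (density m1 m2 h p) * enorm v.
Proof.
intros; unfold g_norm, g_inner; fold (density m1 m2 h p).
apply sqrt_mult_alt, density_ge_0; assumption.
Qed.

Lemma energy_dot (m1 m2 h : R) (c : curve) (t : R) :
  energy_trajectory m1 m2 h c -> 0 <= t <= dur c ->
  dot (velocity (pos c) t) (velocity (pos c) t) = density m1 m2 h (pos c t).
Proof. intros [_ H] Ht; destruct (H t Ht) as [_ [_ [_ [_ E]]]]; unfold density; lra. Qed.

Lemma energy_g_norm (m1 m2 h : R) (c : curve) (t : R) :
  m1 >= m2 -> m2 > 0 -> h >= 0 ->
  energy_trajectory m1 m2 h c -> 0 <= t <= dur c ->
  g_norm m1 m2 h (pos c t) (velocity (pos c) t) = density m1 m2 h (pos c t).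
Proof.
intros H1 H2 H3 Hc Ht; rewrite g_norm_enorm by assumption; unfold enorm.
rewrite (energy_dot m1 m2 h c t Hc Ht).
apply sqrt_sqrt, density_ge_0; assumption.
Qed.

Lemma energy_is_derive (m1 m2 h : R) (c : curve) (t : R) :
  energy_trajectory m1 m2 h c -> 0 <= t <= dur c -> is_derive (pos c) t (velocity (pos c) t).
Proof. intros [_ H] Ht; destruct (H t Ht) as [_ [_ [Hd _]]]; exact Hd. Qed.

Lemma energy_continuous (m1 m2 h : R) (c : curve) (t : R) :
  energy_trajectory m1 m2 h c -> 0 <= t <= dur c -> continuous (pos c) t.
Proof.
intros Hc Ht.
apply (ex_derive_continuous (V := prod_NormedModule _ R_NormedModule R_NormedModule)).
eexists; exact (energy_is_derive m1 m2 h c t Hc Ht).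
Qed.

Lemma energy_density_continuous (m1 m2 h : R) (c : curve) (t : R) :
  energy_trajectory m1 m2 h c -> 0 <= t <= dur c ->
  continuous (fun t => density m1 m2 h (pos c t)) t.
Proof.
intros Hc Ht; apply (continuous_comp (pos c) (density m1 m2 h)).
- apply (energy_continuous m1 m2 h c t Hc Ht).
- destruct Hc as [_ H]; destruct (H t Ht) as [Ha [Hb _]]; apply density_continuous; assumption.
Qed.

Lemma energy_density_ex_RInt (m1 m2 h : R) (c : curve) (a b : R) :
  energy_trajectory m1 m2 h c -> 0 <= a <= b -> b <= dur c ->
  ex_RInt (fun t => density m1 m2 h (pos c t)) a b.
Proof.
intros Hc Ha Hb; apply (ex_RInt_continuous (V := R_CompleteNormedModule)).
intros t Ht; rewrite Rmin_left, Rmax_right in Ht by lra.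
apply energy_density_continuous with (1 := Hc); lra.
Qed.

Lemma jacobi_length_energy (m1 m2 h : R) (c : curve) :
  m1 >= m2 -> m2 > 0 -> h >= 0 -> energy_trajectory m1 m2 h c ->
  jacobi_length m1 m2 h c = RInt (fun t => density m1 m2 h (pos c t)) 0 (dur c).
Proof.
intros H1 H2 H3 Hc; apply RInt_ext; intros t Ht.
pose proof (proj1 Hc); rewrite Rmin_left, Rmax_right in Ht by lra.
apply energy_g_norm; try assumption; lra.
Qed.

Lemma velocity_splice_outside (x : R -> plane) (al be : R) (P Q : plane) (t : R) (v : plane) :
  t < al \/ be < t -> is_derive x t v -> velocity (splice x al be P Q) t = v.
Proof.
intros Ht Hx; apply velocity_of_is_derive.
apply (is_derive_ext_loc x); [| exact Hx].
destruct Ht as [Ht | Ht].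
- generalize (open_lt al t Ht); apply filter_imp; intros s Hs.
  symmetry; apply splice_outside; left; exact Hs.
- generalize (open_gt be t Ht); apply filter_imp; intros s Hs.
  symmetry; apply splice_outside; right; exact Hs.
Qed.

Lemma velocity_splice_inside (x : R -> plane) (al be : R) (P Q : plane) (t : R) :
  al < t < be -> velocity (splice x al be P Q) t = affine_velocity al be P Q.
Proof.
intros Ht; apply velocity_of_is_derive.
apply (is_derive_ext_loc (affine_path al be P Q)); [| apply is_derive_affine_path].
generalize (filter_and _ _ (open_gt al t (proj1 Ht)) (open_lt be t (proj2 Ht))).
apply filter_imp; intros s [Hs1 Hs2]; symmetry; apply splice_inside; lra.
Qed.

Lemma enorm_affine_velocity (al be : R) (P Q : plane) :
  al < be -> enorm (affine_velocity al be P Q) = edist Q P / (be - al).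
Proof.
intro H.
assert (Hinv : 0 < / (be - al)) by (apply Rinv_0_lt_compat; lra).
unfold Rdiv; rewrite Rmult_comm; unfold edist; rewrite <- enorm_scal by lra.
unfold affine_velocity; simpl; f_equal; f_equal; unfold Rdiv; ring.
Qed.

(** Away from the chord the integrand is unchanged; on [[al, be]] the chord has Jacobi length at
    most [A * edist Q P], and the piece it replaces at least [(be - al) * E]. Integrands are
    compared on open intervals, where the velocity of the splice is known. *)
Lemma jacobi_length_splice (m1 m2 h : R) (c : curve) (al be A E : R) (P Q : plane) :
  m1 >= m2 -> m2 > 0 -> h >= 0 -> energy_trajectory m1 m2 h c ->
  0 <= al < be -> be <= dur c ->
  (forall t, al <= t <= be -> affine_path al be P Q t <> c1 /\ affine_path al be P Q t <> c2 /\
     sqrt (density m1 m2 h (affine_path al be P Q t)) <= A) ->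
  (forall t, al <= t <= be -> E <= density m1 m2 h (pos c t)) ->
  jacobi_length m1 m2 h (Curve (dur c) (splice (pos c) al be P Q)) <=
  jacobi_length m1 m2 h c + A * edist Q P - (be - al) * E.
Proof.
intros H1 H2 H3 Hc Hal Hbe HA HE.
rewrite (jacobi_length_energy m1 m2 h c) by assumption.
unfold jacobi_length; simpl.
set (x' := splice (pos c) al be P Q).
set (F := fun t => g_norm m1 m2 h (x' t) (velocity x' t)).
set (f := fun t => density m1 m2 h (pos c t)).
set (y := affine_path al be P Q).
set (g := fun t => sqrt (density m1 m2 h (y t)) * (edist Q P / (be - al))).
assert (Hout : forall t, 0 <= t <= dur c -> t < al \/ be < t -> f t = F t).
{ intros t Ht Hto; unfold F, f.
  assert (Hv : velocity x' t = velocity (pos c) t).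
  { exact (velocity_splice_outside (pos c) al be P Q t _ Hto (energy_is_derive m1 m2 h c t Hc Ht)). }
  rewrite Hv; unfold x'; rewrite splice_outside by exact Hto.
  symmetry; apply energy_g_norm; assumption. }
assert (Hin : forall t, al < t < be -> g t = F t).
{ intros t Ht; unfold F, x'; rewrite velocity_splice_inside, splice_inside by lra.
  rewrite g_norm_enorm by assumption; rewrite enorm_affine_velocity by lra; reflexivity. }
assert (If1 : ex_RInt f 0 al) by (apply energy_density_ex_RInt; [exact Hc | lra | lra]).
assert (If2 : ex_RInt f al be) by (apply energy_density_ex_RInt; [exact Hc | lra | lra]).
assert (If3 : ex_RInt f be (dur c)) by (apply energy_density_ex_RInt; [exact Hc | lra | lra]).
assert (Ig : ex_RInt g al be).
{ apply (ex_RInt_continuous (V := R_CompleteNormedModule)).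
  intros t Ht; rewrite Rmin_left, Rmax_right in Ht by lra.
  destruct (HA t Ht) as [Ha [Hb _]].
  apply (continuous_mult (K := R_AbsRing)); [| apply continuous_const].
  apply continuous_sqrt_comp; [| apply density_ge_0; assumption].
  apply (continuous_comp y (density m1 m2 h)).
  - apply C1_curve_continuous, C1_curve_affine_path.
  - apply density_continuous; assumption. }
assert (E1 : RInt F 0 al = RInt f 0 al).
{ symmetry; apply RInt_ext; intros t Ht; rewrite Rmin_left, Rmax_right in Ht by lra.
  apply Hout; lra. }
assert (E2 : RInt F al be = RInt g al be).
{ symmetry; apply RInt_ext; intros t Ht; rewrite Rmin_left, Rmax_right in Ht by lra.
  apply Hin; lra. }
assert (E3 : RInt F be (dur c) = RInt f be (dur c)).
{ symmetry; apply RInt_ext; intros t Ht; rewrite Rmin_left, Rmax_right in Ht by lra.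
  apply Hout; lra. }
assert (IF1 : ex_RInt F 0 al).
{ apply (ex_RInt_ext f); [| exact If1]; intros t Ht; rewrite Rmin_left, Rmax_right in Ht by lra.
  apply Hout; lra. }
assert (IF2 : ex_RInt F al be).
{ apply (ex_RInt_ext g); [| exact Ig]; intros t Ht; rewrite Rmin_left, Rmax_right in Ht by lra.
  apply Hin; lra. }
assert (IF3 : ex_RInt F be (dur c)).
{ apply (ex_RInt_ext f); [| exact If3]; intros t Ht; rewrite Rmin_left, Rmax_right in Ht by lra.
  apply Hout; lra. }
assert (CF : RInt F 0 (dur c) = RInt F 0 al + RInt F al be + RInt F be (dur c)).
{ rewrite <- (RInt_Chasles F 0 be (dur c)), <- (RInt_Chasles F 0 al be);
    try assumption; [reflexivity |].
  apply ex_RInt_Chasles with al; assumption. }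
assert (Cf : RInt f 0 (dur c) = RInt f 0 al + RInt f al be + RInt f be (dur c)).
{ rewrite <- (RInt_Chasles f 0 be (dur c)), <- (RInt_Chasles f 0 al be);
    try assumption; [reflexivity |].
  apply ex_RInt_Chasles with al; assumption. }
assert (HRc : forall r : R, RInt (fun _ => r) al be = (be - al) * r)
  by (intro r; exact (RInt_const (V := R_CompleteNormedModule) al be r)).
assert (Bg : RInt g al be <= (be - al) * (A * (edist Q P / (be - al)))).
{ rewrite <- HRc.
  apply RInt_le; [lra | exact Ig | apply ex_RInt_const |].
  intros t Ht; apply Rmult_le_compat_r; [| apply HA; lra].
  apply Rmult_le_pos; [apply enorm_ge_0 | left; apply Rinv_0_lt_compat; lra]. }
assert (Bf : (be - al) * E <= RInt f al be).
{ rewrite <- HRc.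
  apply RInt_le; [lra | apply ex_RInt_const | exact If2 |].
  intros t Ht; apply HE; lra. }
replace ((be - al) * (A * (edist Q P / (be - al)))) with (A * edist Q P) in Bg by (field; lra).
fold F in CF; rewrite CF, Cf, E1, E2, E3; lra.
Qed.

Lemma ball_plane (p q : plane) (r : R) :
  ball p r q <-> Rabs (fst q - fst p) < r /\ Rabs (snd q - snd p) < r.
Proof. reflexivity. Qed.

Lemma affine_path_ball (p P Q : plane) (al be r t : R) :
  al < be -> al <= t <= be -> ball p r P -> ball p r Q -> ball p r (affine_path al be P Q t).
Proof.
rewrite !ball_plane; intros Hab Ht [HP1 HP2] [HQ1 HQ2]; unfold affine_path; simpl.
assert (Hs : 0 <= (t - al) / (be - al) <= 1).
{ split; [apply Rdiv_le_0_compat; lra |].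
  apply (Rmult_le_reg_r (be - al)); [lra |].
  unfold Rdiv; rewrite Rmult_assoc, Rinv_l; lra. }
set (s := (t - al) / (be - al)) in *.
apply Rabs_def2 in HP1; apply Rabs_def2 in HP2.
apply Rabs_def2 in HQ1; apply Rabs_def2 in HQ2.
split; apply Rabs_def1.
- pose proof (convex_combination_lt (fst P) (fst Q) (fst p + r) s Hs); lra.
- pose proof (convex_combination_lt (- fst P) (- fst Q) (r - fst p) s Hs); lra.
- pose proof (convex_combination_lt (snd P) (snd Q) (snd p + r) s Hs); lra.
- pose proof (convex_combination_lt (- snd P) (- snd Q) (r - snd p) s Hs); lra.
Qed.

Lemma is_derive_continuous_plane (c : R -> plane) (t : R) (l : plane) :
  is_derive c t l -> continuous c t.
Proof.
intro H; apply (ex_derive_continuous (V := prod_NormedModule _ R_NormedModule R_NormedModule)).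
exists l; exact H.
Qed.

Lemma edist_linear_bound (P Q : R -> plane) (wP wQ : plane) (eta : R) :
  P 0 = Q 0 -> is_derive P 0 wP -> is_derive Q 0 wQ -> 0 < eta ->
  locally 0 (fun s => 0 <= s ->
    edist (Q s) (P s) <= s * (enorm (fst wQ - fst wP, snd wQ - snd wP) + eta)).
Proof.
intros H0 HP HQ Heta; assert (He : 0 < eta / 2) by lra.
assert (D1 : is_derive (fun s => fst (Q s) - fst (P s)) 0 (fst wQ - fst wP)).
{ apply (is_derive_minus (V := R_NormedModule) (fun s => fst (Q s)) (fun s => fst (P s)));
    apply is_derive_fst; assumption. }
assert (D2 : is_derive (fun s => snd (Q s) - snd (P s)) 0 (snd wQ - snd wP)).
{ apply (is_derive_minus (V := R_NormedModule) (fun s => snd (Q s)) (fun s => snd (P s)));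
    apply is_derive_snd; assumption. }
generalize (filter_and _ _ (derive_linear_bound _ _ _ _ D1 He)
  (derive_linear_bound _ _ _ _ D2 He)); apply filter_imp; intros s [B1 B2] Hs.
rewrite Rplus_0_l, H0, (Rabs_pos_eq s) in B1, B2 by exact Hs.
set (w := (fst wQ - fst wP, snd wQ - snd wP) : plane) in *.
set (r1 := fst (Q s) - fst (P s) - (fst (Q 0) - fst (Q 0)) - (fst wQ - fst wP) * s) in *.
set (r2 := snd (Q s) - snd (P s) - (snd (Q 0) - snd (Q 0)) - (snd wQ - snd wP) * s) in *.
pose proof (enorm_triang (s * fst w, s * snd w) (r1, r2)) as Ht; simpl in Ht.
pose proof (enorm_le_abs (r1, r2)) as Ha; simpl in Ha.
replace (s * (fst wQ - fst wP) + r1) with (fst (Q s) - fst (P s)) in Ht by (unfold r1; ring).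
replace (s * (snd wQ - snd wP) + r2) with (snd (Q s) - snd (P s)) in Ht by (unfold r2; ring).
pose proof (enorm_scal s w Hs) as Hsc; simpl in Hsc.
unfold edist; lra.
Qed.

(** Everything collapses to [pos c T0]. To first order the chord costs the speed |v| times its
    Euclidean length s |wQ - wP|, and the removed piece of duration [K * s] has length |v|^2 per
    unit time. *)
Lemma shrinking_splice_length (m1 m2 h : R) (c : curve) (T0 K : R) (wP wQ : plane)
    (al be : R -> R) (P Q : R -> plane) :
  m1 >= m2 -> m2 > 0 -> h >= 0 -> energy_trajectory m1 m2 h c ->
  0 <= T0 <= dur c -> 0 < K ->
  locally 0 (fun s => 0 < s -> 0 <= al s /\ be s - al s = K * s /\ be s <= dur c /\
     al s <= T0 <= be s) ->
  P 0 = pos c T0 -> Q 0 = pos c T0 -> is_derive P 0 wP -> is_derive Q 0 wQ ->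
  forall eta rho : posreal,
  locally 0 (fun s => 0 < s ->
    (forall t, al s <= t <= be s ->
       ball (pos c t) rho (affine_path (al s) (be s) (P s) (Q s) t)) /\
    jacobi_length m1 m2 h (Curve (dur c) (splice (pos c) (al s) (be s) (P s) (Q s))) <=
    jacobi_length m1 m2 h c + s *
      (enorm (velocity (pos c) T0) * enorm (fst wQ - fst wP, snd wQ - snd wP)
       - K * dot (velocity (pos c) T0) (velocity (pos c) T0) + eta)).
Proof.
intros H1 H2 H3 Hc HT0 HK Hab HP0 HQ0 HP HQ eta rho.
set (w := (fst wQ - fst wP, snd wQ - snd wP)).
set (p := pos c T0) in *; set (v := velocity (pos c) T0).
set (N := enorm v); set (W := enorm w).
assert (HN : dot v v = density m1 m2 h p) by (apply energy_dot; assumption).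
assert (HNs : sqrt (density m1 m2 h p) = N) by (rewrite <- HN; reflexivity).
assert (HN0 : 0 <= N) by apply enorm_ge_0.
assert (HW0 : 0 <= W) by apply enorm_ge_0.
(* For [e <= 1], the expression [(N + e) * (W + e) + K * e] exceeds [N * W] by at most [e * C]. *)
set (C := N + W + 1 + K); assert (HC : 0 < C) by (unfold C; lra).
pose proof (cond_pos eta) as Heta.
set (e := Rmin 1 (eta / C)).
assert (He : 0 < e) by (apply Rmin_glb_lt; [lra | apply Rdiv_lt_0_compat; assumption]).
assert (He1 : e <= 1) by apply Rmin_l.
assert (HeC : e * C <= eta).
{ apply Rle_trans with (eta / C * C).
  - apply Rmult_le_compat_r; [lra | apply Rmin_r].
  - right; field; lra. }
destruct (proj2 Hc T0 HT0) as [Hp1 [Hp2 [Hdp _]]]; fold p in Hp1, Hp2.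
assert (Hde : forall q : plane, p <> q -> locally p (fun z => z <> q)).
{ intros q Hq; assert (Hcont : continuous (fun z : plane => edist z q) p).
  { apply (continuous_edist (fun z => z) (fun _ => q));
      [apply continuous_id | apply continuous_const]. }
  refine (filter_imp (fun z => 0 < edist z q) _ _ (Hcont _ (open_gt 0 _ (edist_pos p q Hq)))).
  intros z Hz E; rewrite E, edist_refl in Hz; lra. }
pose proof (density_continuous m1 m2 h p Hp1 Hp2) as Hdc.
assert (L1 : locally p (fun z => sqrt (density m1 m2 h z) < N + e)).
{ apply (continuous_lt_locally (fun z => sqrt (density m1 m2 h z))); [| lra].
  apply continuous_sqrt_comp; [exact Hdc | apply density_ge_0; assumption]. }
assert (L2 : locally p (fun z => dot v v - e < density m1 m2 h z)).
{ apply (Hdc (fun r => dot v v - e < r)), open_gt; lra. }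
destruct (filter_and _ _ (filter_and _ _ L1 L2) (filter_and _ _ (Hde c1 Hp1) (Hde c2 Hp2)))
  as [r0 Hr0].
(* Curve and chord are each kept within [rho / 2] of the limit point, hence within [rho] of each
   other. *)
assert (Hr : 0 < Rmin r0 (rho / 2)).
{ pose proof (cond_pos rho); apply Rmin_glb_lt; [apply cond_pos | lra]. }
set (r := mkposreal _ Hr).
assert (Hrr0 : r <= r0) by apply Rmin_l.
assert (Hrrho : r <= rho / 2) by apply Rmin_r.
pose proof (is_derive_continuous_plane _ _ _ HP _ (locally_ball _ r)) as LP.
pose proof (is_derive_continuous_plane _ _ _ HQ _ (locally_ball _ r)) as LQ.
rewrite HP0 in LP; rewrite HQ0 in LQ.
destruct (is_derive_continuous_plane _ _ _ Hdp _ (locally_ball _ r)) as [d Hd].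
fold p in Hd.
assert (Hsd : locally 0 (fun s => K * s < d)).
{ apply (continuous_lt_locally (fun s => K * s) 0 d).
  - apply (ex_derive_continuous (V := R_NormedModule)); auto_derive; trivial.
  - rewrite Rmult_0_r; apply cond_pos. }
assert (LD := edist_linear_bound P Q wP wQ e (eq_trans HP0 (eq_sym HQ0)) HP HQ He).
unfold filtermap in LP, LQ.
generalize (filter_and _ _ (filter_and _ _ Hab Hsd)
  (filter_and _ _ LD (filter_and _ _ LP LQ))); apply filter_imp.
intros s [[Hs Hsd'] [HD [HPs HQs]]] Hs0.
destruct (Hs Hs0) as [Ha0 [Hba [HbT HT]]].
assert (HKs : 0 < K * s) by (apply Rmult_lt_0_compat; assumption).
assert (Haff : forall t, al s <= t <= be s ->
  ball p r (affine_path (al s) (be s) (P s) (Q s) t)).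
{ intros t Ht; apply affine_path_ball; try assumption; lra. }
assert (Hpos : forall t, al s <= t <= be s -> ball p r (pos c t)).
{ intros t Ht; apply Hd; change (Rabs (t - T0) < d); apply Rabs_def1; lra. }
split.
- intros t Ht.
  replace (RIneq.pos rho) with (rho / 2 + rho / 2) by field.
  apply ball_triangle with p.
  + apply ball_sym, ball_le with r; [exact Hrrho | apply Hpos, Ht].
  + apply ball_le with r; [exact Hrrho | apply Haff, Ht].
- eapply Rle_trans.
  + apply (jacobi_length_splice m1 m2 h c (al s) (be s) (N + e) (dot v v - e) (P s) (Q s));
      try assumption; try lra.
    * intros t Ht; destruct (Hr0 _ (ball_le _ _ _ Hrr0 _ (Haff t Ht))) as [[G1 G2] [G3 G4]].
      split; [exact G3 | split; [exact G4 | lra]].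
    * intros t Ht; destruct (Hr0 _ (ball_le _ _ _ Hrr0 _ (Hpos t Ht))) as [[G1 G2] _]; lra.
  + specialize (HD (Rlt_le _ _ Hs0)); fold w W in HD.
    rewrite Hba.
    assert (B : (N + e) * edist (Q s) (P s) <= (N + e) * (s * (W + e))).
    { apply Rmult_le_compat_l; lra. }
    assert (B2 : (N + e) * (W + e) + K * e <= N * W + eta).
    { assert (e * e <= e) by nra; unfold C in HeC; nra. }
    assert (B3 : s * ((N + e) * (W + e) + K * e) <= s * (N * W + eta)).
    { apply Rmult_le_compat_l; lra. }
    lra.
Qed.

(* Comparing [A] with the secant slopes for all large [K] leaves only the first-order term
   [- v . g] of [|v| |K v - g| - K |v|^2]. *)
Lemma secant_limit (v g : plane) (A : R) :
  v <> (0, 0) ->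
  (forall K, 0 < K ->
     A <= enorm v * enorm (K * fst v - fst g, K * snd v - snd g) - K * dot v v) ->
  A <= - dot v g.
Proof.
intros Hv HA; pose proof (dot_self_pos v Hv) as Hp.
apply Rnot_lt_le; intro Hlt.
set (D := A + dot v g); assert (HD : 0 < D) by (unfold D; lra).
set (G := dot g g); assert (HG : 0 <= G) by (unfold G, dot; nra).
set (n := dot v v) in *.
(* The first term makes [A + K * n] positive, so that the inequality can be squared; the second
   yields [G < K * D]. *)
set (K := (Rabs A + 1) / n + G / D + 1).
pose proof (Rabs_pos A) as HA0; pose proof (Rle_abs (- A)) as HAn; rewrite Rabs_Ropp in HAn.
assert (T1 : 0 < (Rabs A + 1) / n) by (apply Rdiv_lt_0_compat; lra).
assert (T2 : 0 <= G / D) by (apply Rdiv_le_0_compat; lra).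
assert (HK : 0 < K) by (unfold K; lra).
specialize (HA K HK).
assert (E1 : (Rabs A + 1) / n * n = Rabs A + 1) by (field; lra).
assert (E2 : G / D * D = G) by (field; lra).
assert (HKn : Rabs A + 1 <= K * n) by (unfold K; nra).
assert (HKD : G < K * D) by (unfold K; nra).
set (z := (K * fst v - fst g, K * snd v - snd g) : plane) in *.
assert (Hsq : (A + K * n) * (A + K * n) <= n * dot z z).
{ unfold n at 3; rewrite <- (enorm_sqr v), <- (enorm_sqr z).
  replace (enorm v * enorm v * (enorm z * enorm z)) with
    ((enorm v * enorm z) * (enorm v * enorm z)) by ring.
  apply Rmult_le_compat; lra. }
assert (Hz : dot z z = K * K * n - 2 * K * dot v g + G).
{ unfold z, n, G, dot; simpl; ring. }
rewrite Hz in Hsq.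
(* After squaring, the terms in [K * K] cancel; the remaining bound is incompatible with
   [G < K * D]. *)
assert (Hfin : A * A + 2 * (K * n) * D <= n * G) by (unfold D; nra).
assert (n * G < n * (K * D)) by (apply Rmult_lt_compat_l; assumption).
nra.
Qed.

(** * One-sided slopes and the variation of each endpoint *)

(** Since the derivative is known to exist, increments in the single direction [e] bound [e * d];
    the directions 1 and -1 together determine [d]. *)
Lemma derivative_le_of_locally_le (L : R -> R) (t d e B : R) :
  is_derive L t d ->
  (forall eta : posreal, locally 0 (fun s => 0 < s -> L (t + e * s) <= L t + s * (B + eta))) ->
  e * d <= B.
Proof.
intros HL HB.
assert (He : is_derive (fun s => L (t + e * s)) 0 (e * d)).
{ apply (is_derive_comp (V := R_NormedModule) L (fun s => t + e * s) 0 d e).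
  - replace (t + e * 0) with t by ring; exact HL.
  - auto_derive; [trivial | ring]. }
apply Rnot_lt_le; intro Hlt.
set (eta := (e * d - B) / 4); assert (Heta : 0 < eta) by (unfold eta; lra).
destruct (filter_and _ _ (HB (mkposreal _ Heta)) (derive_linear_bound _ _ _ _ He Heta))
  as [r Hr].
pose proof (cond_pos r) as Hr0.
assert (Hb : ball 0 r (r / 2)).
{ change (Rabs (r / 2 - 0) < r); rewrite Rabs_pos_eq; lra. }
destruct (Hr (r / 2) Hb) as [H1 H2]; simpl in H1.
specialize (H1 ltac:(lra)).
rewrite Rplus_0_l, Rmult_0_r, Rplus_0_r, (Rabs_pos_eq (r / 2)) in H2 by lra.
apply Rabs_le_between in H2.
assert (0 < r / 2 * (e * d - B - 2 * eta)) by (apply Rmult_lt_0_compat; unfold eta; lra).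
lra.
Qed.

Lemma is_derive_plane_comp_affine (c : R -> plane) (t a : R) (l : plane) :
  is_derive c t l -> is_derive (fun s => c (t + a * s)) 0 (a * fst l, a * snd l).
Proof.
intro H.
apply (is_derive_comp (V := prod_NormedModule _ R_NormedModule R_NormedModule)
  c (fun s => t + a * s) 0 l a).
- replace (t + a * 0) with t by ring; exact H.
- auto_derive; [trivial | ring].
Qed.

Lemma locally_pos_lt (r : R) (a : R) : 0 < r -> locally 0 (fun s => a * s < r).
Proof.
intro Hr; apply (continuous_lt_locally (fun s => a * s) 0 r).
- apply (ex_derive_continuous (V := R_NormedModule)); auto_derive; trivial.
- rewrite Rmult_0_r; exact Hr.
Qed.

Lemma energy_velocity_neq_0 (m1 m2 h : R) (c : curve) (t : R) :
  m1 >= m2 -> m2 > 0 -> h >= 0 -> energy_trajectory m1 m2 h c -> 0 <= t <= dur c ->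
  velocity (pos c) t <> (0, 0).
Proof.
intros H1 H2 H3 Hc Ht E.
pose proof (energy_dot m1 m2 h c t Hc Ht) as Hd; rewrite E in Hd.
destruct (proj2 Hc t Ht) as [Hc1 [Hc2 _]].
pose proof (edist_pos _ _ Hc1); pose proof (edist_pos _ _ Hc2).
assert (0 < m1 / edist (pos c t) c1) by (apply Rdiv_lt_0_compat; lra).
assert (0 < m2 / edist (pos c t) c2) by (apply Rdiv_lt_0_compat; lra).
unfold density, U, dot in Hd; simpl in Hd; lra.
Qed.

Lemma dot_scal_r (v g : plane) (e : R) : dot v (e * fst g, e * snd g) = e * dot v g.
Proof. unfold dot; simpl; ring. Qed.

(** The splices are competitors for the slid endpoints, so their lengths dominate [L] there, and
    their first-order expansion bounds its slope. [T0] is the time of the moving end, 0 or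
    [dur c]. *)
Lemma first_variation_inequality (m1 m2 h : R) (gam : R -> plane) (k : Z) (th1 th2 : R)
    (c : curve) (T0 K : R) (wP wQ : plane) (al be a1 a2 : R -> R) (P Q : R -> plane)
    (L : R -> R) (t e d : R) :
  m1 >= m2 -> m2 > 0 -> h >= 0 -> C1_curve gam ->
  energy_trajectory m1 m2 h c -> competitor gam k th1 th2 c ->
  0 <= T0 <= dur c -> 0 < K ->
  P 0 = pos c T0 -> Q 0 = pos c T0 -> is_derive P 0 wP -> is_derive Q 0 wQ ->
  a1 0 = th1 -> a2 0 = th2 -> continuous a1 0 -> continuous a2 0 ->
  locally 0 (fun s => 0 < s ->
    (0 <= al s /\ be s - al s = K * s /\ be s <= dur c /\ al s <= T0 <= be s) /\
    (al s = 0 \/ pos c (al s) = P s) /\ (be s = dur c \/ pos c (be s) = Q s) /\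
    splice (pos c) (al s) (be s) (P s) (Q s) 0 = gam (a1 s) /\
    splice (pos c) (al s) (be s) (P s) (Q s) (dur c) = gam (a2 s)) ->
  L t = jacobi_length m1 m2 h c ->
  locally 0 (fun s => forall c', competitor gam k (a1 s) (a2 s) c' ->
    L (t + e * s) <= jacobi_length m1 m2 h c') ->
  is_derive L t d ->
  e * d <= enorm (velocity (pos c) T0) * enorm (fst wQ - fst wP, snd wQ - snd wP)
           - K * dot (velocity (pos c) T0) (velocity (pos c) T0).
Proof.
intros H1 H2 H3 Hg Hc Hcomp HT0 HK HP0 HQ0 HP HQ Ha1 Ha2 Ca1 Ca2 Hfam HL0 HL Hd.
destruct (competitor_splice gam k th1 th2 c Hg Hcomp) as [rho Hrho].
apply (derivative_le_of_locally_le L t); [exact Hd |]; intro eta.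
assert (Hab : locally 0 (fun s => 0 < s ->
  0 <= al s /\ be s - al s = K * s /\ be s <= dur c /\ al s <= T0 <= be s)).
{ revert Hfam; apply filter_imp; intros s Hs Hs0; apply (Hs Hs0). }
assert (Hsm := shrinking_splice_length m1 m2 h c T0 K wP wQ al be P Q
  H1 H2 H3 Hc HT0 HK Hab HP0 HQ0 HP HQ eta rho).
pose proof (Ca1 _ (locally_ball _ rho)) as L1; pose proof (Ca2 _ (locally_ball _ rho)) as L2.
rewrite Ha1 in L1; rewrite Ha2 in L2; unfold filtermap in L1, L2.
generalize (filter_and _ _ (filter_and _ _ Hsm Hfam) (filter_and _ _ HL (filter_and _ _ L1 L2))).
apply filter_imp; intros s [[Hlen Hf] [HLs [B1 B2]]] Hs.
destruct (Hlen Hs) as [Hnear Hle]; destruct (Hf Hs) as [[G1 [G2 [G3 G4]]] [G5 [G6 [G7 G8]]]].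
assert (0 < K * s) by (apply Rmult_lt_0_compat; assumption).
rewrite HL0; refine (Rle_trans _ _ _ (HLs _ _) Hle).
apply Hrho; try assumption; lra.
Qed.

Lemma continuous_affine (a b x : R) : continuous (fun s => a + b * s) x.
Proof. apply (ex_derive_continuous (V := R_NormedModule)); auto_derive; trivial. Qed.

(** The piece on [[0, K s]] gives way to a chord from [gam (th1 + e s)] to [pos c (K s)], so the
    difference of end velocities is K v - e g. The limit in [K] followed by [e] = 1 and -1 gives the
    equality. *)
Lemma first_variation_start (m1 m2 h : R) (gam : R -> plane) (k : Z) (th1 th2 d : R)
    (c : curve) (L : R -> R) :
  m1 >= m2 -> m2 > 0 -> h >= 0 -> C1_curve gam ->
  energy_trajectory m1 m2 h c -> competitor gam k th1 th2 c ->
  L th1 = jacobi_length m1 m2 h c ->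
  locally th1 (fun t => forall c', competitor gam k t th2 c' -> L t <= jacobi_length m1 m2 h c') ->
  is_derive L th1 d ->
  d = - dot (velocity (pos c) 0) (velocity gam th1).
Proof.
intros H1 H2 H3 Hg Hc Hcomp HL0 HL Hd.
set (v := velocity (pos c) 0); set (g := velocity gam th1).
assert (Hdur : 0 < dur c) by apply Hc.
assert (Hv : v <> (0, 0)) by (apply (energy_velocity_neq_0 m1 m2 h); try assumption; lra).
assert (Hside : forall e, e * d <= - dot v (e * fst g, e * snd g)).
{ intro e; apply secant_limit; [exact Hv |]; intros K HK.
  apply (first_variation_inequality m1 m2 h gam k th1 th2 c 0 K
    (e * fst g, e * snd g) (K * fst v, K * snd v)
    (fun _ => 0) (fun s => K * s) (fun s => th1 + e * s) (fun _ => th2)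
    (fun s => gam (th1 + e * s)) (fun s => pos c (0 + K * s)) L th1); try assumption.
  - lra.
  - rewrite Rmult_0_r, Rplus_0_r; symmetry; apply Hcomp.
  - f_equal; ring.
  - apply is_derive_plane_comp_affine, Hg.
  - apply is_derive_plane_comp_affine, (energy_is_derive m1 m2 h c 0 Hc); lra.
  - ring.
  - reflexivity.
  - apply continuous_affine.
  - apply continuous_const.
  - generalize (locally_pos_lt (dur c) K Hdur); apply filter_imp; intros s Hs Hs0.
    assert (0 < K * s) by (apply Rmult_lt_0_compat; assumption).
    cbv beta; split; [lra |]; split; [left; reflexivity |]; repeat split.
    + right; f_equal; ring.
    + rewrite splice_inside, affine_path_start by lra; reflexivity.
    + rewrite splice_outside by lra; apply Hcomp.
  - replace th1 with (th1 + e * 0) in HL by ring; exact (continuous_affine th1 e 0 _ HL). }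
pose proof (Hside 1) as Hp; pose proof (Hside (-1)) as Hm.
rewrite dot_scal_r in Hp, Hm; lra.
Qed.

Lemma first_variation_end (m1 m2 h : R) (gam : R -> plane) (k : Z) (th1 th2 d : R)
    (c : curve) (L : R -> R) :
  m1 >= m2 -> m2 > 0 -> h >= 0 -> C1_curve gam ->
  energy_trajectory m1 m2 h c -> competitor gam k th1 th2 c ->
  L th2 = jacobi_length m1 m2 h c ->
  locally th2 (fun t => forall c', competitor gam k th1 t c' -> L t <= jacobi_length m1 m2 h c') ->
  is_derive L th2 d ->
  d = dot (velocity (pos c) (dur c)) (velocity gam th2).
Proof.
intros H1 H2 H3 Hg Hc Hcomp HL0 HL Hd.
set (T := dur c); set (v := velocity (pos c) T); set (g := velocity gam th2).
assert (Hdur : 0 < T) by apply Hc.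
assert (Hv : v <> (0, 0)) by (apply (energy_velocity_neq_0 m1 m2 h); try assumption; fold T; lra).
assert (Hside : forall e, e * d <= - dot v (- e * fst g, - e * snd g)).
{ intro e; apply secant_limit; [exact Hv |]; intros K HK.
  (* At the final end the chord runs from [pos c (T - K s)] to the boundary. The velocity difference
     is K v + e g, hence the opposite sign of the result. *)
  replace (K * fst v - fst (- e * fst g, - e * snd g), K * snd v - snd (- e * fst g, - e * snd g))
    with (fst (e * fst g, e * snd g) - fst (- K * fst v, - K * snd v),
          snd (e * fst g, e * snd g) - snd (- K * fst v, - K * snd v)) by (simpl; f_equal; ring).
  apply (first_variation_inequality m1 m2 h gam k th1 th2 c T K
    (- K * fst v, - K * snd v) (e * fst g, e * snd g)
    (fun s => T + - K * s) (fun _ => T) (fun _ => th1) (fun s => th2 + e * s)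
    (fun s => pos c (T + - K * s)) (fun s => gam (th2 + e * s)) L th2); try assumption.
  - unfold T in *; lra.
  - f_equal; ring.
  - rewrite Rmult_0_r, Rplus_0_r; symmetry; apply Hcomp.
  - apply is_derive_plane_comp_affine, (energy_is_derive m1 m2 h c T Hc); unfold T in *; lra.
  - apply is_derive_plane_comp_affine, Hg.
  - reflexivity.
  - ring.
  - apply continuous_const.
  - apply continuous_affine.
  - generalize (locally_pos_lt T K Hdur); apply filter_imp; intros s Hs Hs0.
    assert (0 < K * s) by (apply Rmult_lt_0_compat; assumption).
    cbv beta; fold T; split; [lra |]; split; [right; reflexivity |]; repeat split.
    + left; reflexivity.
    + rewrite splice_outside by lra; apply Hcomp.
    + rewrite splice_inside, affine_path_end by lra; reflexivity.
  - replace th2 with (th2 + e * 0) in HL by ring; exact (continuous_affine th2 e 0 _ HL). }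
pose proof (Hside 1) as Hp; pose proof (Hside (-1)) as Hm.
rewrite dot_scal_r in Hp, Hm; lra.
Qed.

(** * Elliptic coordinates *)

Lemma cosh_sinh_sqr (x : R) : cosh x * cosh x = 1 + sinh x * sinh x.
Proof.
unfold cosh, sinh.
assert (E : exp x * exp (- x) = 1) by (rewrite <- exp_plus, Rplus_opp_r; apply exp_0).
nra.
Qed.

Lemma cosh_pos (x : R) : 0 < cosh x.
Proof. unfold cosh; pose proof (exp_pos x); pose proof (exp_pos (- x)); lra. Qed.

Lemma cos_sin_sqr (x : R) : cos x * cos x + sin x * sin x = 1.
Proof. pose proof (sin2_cos2 x) as H; unfold Rsqr in H; lra. Qed.

Lemma sinh_pos (x : R) : 0 < x -> 0 < sinh x.
Proof.
intro H; unfold sinh; assert (exp (- x) < exp x) by (apply exp_increasing; lra); lra.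
Qed.

Lemma cos_sin_surjective (x y : R) : x * x + y * y = 1 -> exists t, cos t = x /\ sin t = y.
Proof.
intro H; assert (Hx : -1 <= x <= 1) by (split; nra).
assert (Hs : sin (acos x) = Rabs y).
{ rewrite sin_acos by exact Hx; rewrite <- sqrt_Rsqr_abs; f_equal; unfold Rsqr; lra. }
destruct (Rle_dec 0 y) as [Hy | Hy].
- exists (acos x); rewrite Hs, cos_acos by exact Hx; rewrite Rabs_pos_eq; auto.
- exists (- acos x); rewrite cos_neg, sin_neg, Hs, cos_acos by exact Hx.
  rewrite Rabs_left by lra; split; ring.
Qed.

(** With focal distances r1 and r2, the coordinates are given by cosh xi = (r1 + r2)/2 and cos eta =
    (r1 - r2)/2; the sign of the second Cartesian coordinate fixes sin eta. *)
Lemma Phi_surjective (p : plane) : off_segment p -> exists q, 0 < fst q /\ Phi q = p.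
Proof.
intro Hoff.
set (r1 := edist p c1); set (r2 := edist p c2).
assert (E1 : r1 * r1 = (fst p + 1) * (fst p + 1) + snd p * snd p).
{ unfold r1, edist; rewrite enorm_sqr; unfold dot, c1; simpl; ring. }
assert (E2 : r2 * r2 = (fst p - 1) * (fst p - 1) + snd p * snd p).
{ unfold r2, edist; rewrite enorm_sqr; unfold dot, c2; simpl; ring. }
assert (P1 : 0 <= r1) by apply enorm_ge_0.
assert (P2 : 0 <= r2) by apply enorm_ge_0.
set (x := fst p) in *; set (y := snd p) in *.
set (C := (r1 + r2) / 2); set (D := (r1 - r2) / 2).
assert (ECD : C * D = x) by (unfold C, D; nra).
assert (ESQ : C * C + D * D = x * x + y * y + 1) by (unfold C, D; nra).
(* This places (D, y / S) on the unit circle, where [S] is the value of sinh xi. *)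
assert (Ey : (C * C - 1) * (1 - D * D) = y * y).
{ replace ((C * C - 1) * (1 - D * D)) with (C * C + D * D - 1 - (C * D) * (C * D)) by ring.
  rewrite ECD, ESQ; ring. }
assert (HC1 : 1 <= C).
{ assert (x + 1 <= r1) by (apply Rnot_lt_le; intro; nra).
  assert (1 - x <= r2) by (apply Rnot_lt_le; intro; nra).
  unfold C; lra. }
assert (HCD : D * D <= C * C) by (unfold C, D; nra).
(* The degenerate value [C = 1] would force [y = 0] and [x = D] in [-1, 1], a point of the
   segment. *)
assert (HC : 1 < C).
{ destruct HC1 as [H | H]; [exact H | exfalso; apply Hoff].
  rewrite <- H in *; assert (D = x) by lra.
  unfold on_segment; fold x y; split; [split; nra | nra]. }
assert (HC2 : 0 < C * C - 1) by nra.
set (S := sqrt (C * C - 1)).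
assert (HS : 0 < S) by (apply sqrt_lt_R0; exact HC2).
assert (HSS : S * S = C * C - 1) by (apply sqrt_sqrt; lra).
destruct (cos_sin_surjective D (y / S)) as [eta [Hcos Hsin]].
{ assert (E : y / S * (y / S) = 1 - D * D).
  { apply (Rmult_eq_reg_r (S * S)); [| nra].
    replace (y / S * (y / S) * (S * S)) with (y * y) by (field; lra).
    rewrite HSS, <- Ey; ring. }
  lra. }
assert (Hsh : sinh (arcsinh S) = S) by apply sinh_arcsinh.
assert (Hch : cosh (arcsinh S) = C).
{ pose proof (cosh_sinh_sqr (arcsinh S)) as E; rewrite Hsh, HSS in E.
  pose proof (cosh_pos (arcsinh S)); nra. }
exists (arcsinh S, eta); split; simpl.
- rewrite <- arcsinh_0; apply arcsinh_lt, HS.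
- unfold Phi; simpl; rewrite Hsh, Hch, Hcos, Hsin, ECD.
  unfold x, y; rewrite (surjective_pairing p) at 3; f_equal; field; lra.
Qed.

Lemma Phi_inv_spec (p : plane) : off_segment p -> 0 < fst (Phi_inv p) /\ Phi (Phi_inv p) = p.
Proof.
intro H; apply (epsilon_spec (inhabits (0, 0)) (fun q => 0 < fst q /\ Phi q = p)).
apply Phi_surjective, H.
Qed.

(** With X = cosh xi and a = cos eta, (X a + 1)^2 + (X^2 - 1)(1 - a^2) is the square (X + a)^2, and
    similarly for the other focus. *)
Lemma edist_Phi (q : R * R) :
  edist (Phi q) c1 = cosh (fst q) + cos (snd q) /\
  edist (Phi q) c2 = cosh (fst q) - cos (snd q).
Proof.
pose proof (cosh_sinh_sqr (fst q)) as Hch; pose proof (cos_sin_sqr (snd q)) as Hcs.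
pose proof (cosh_pos (fst q)); pose proof (COS_bound (snd q)).
assert (H1 : 1 <= cosh (fst q)) by (apply Rnot_lt_le; intro; nra).
unfold edist, enorm, dot, Phi, c1, c2; simpl.
set (X := cosh (fst q)) in *; set (Y := sinh (fst q)) in *.
set (a := cos (snd q)) in *; set (b := sin (snd q)) in *.
assert (HYb : Y * b * (Y * b) = (X * X - 1) * (1 - a * a)).
{ replace (X * X - 1) with (Y * Y) by lra; replace (1 - a * a) with (b * b) by lra; ring. }
split.
- rewrite <- (sqrt_square (X + a)) by lra; f_equal.
  rewrite Rminus_0_r, HYb; ring.
- rewrite <- (sqrt_square (X - a)) by lra; f_equal.
  rewrite Rminus_0_r, HYb; ring.
Qed.

Lemma is_derive_sqrt_sum_sqr (f g : R -> R) (a b t lf lg : R) :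
  is_derive f t lf -> is_derive g t lg ->
  0 < (f t - a) * (f t - a) + (g t - b) * (g t - b) ->
  is_derive (fun u => sqrt ((f u - a) * (f u - a) + (g u - b) * (g u - b))) t
    (((f t - a) * lf + (g t - b) * lg) / sqrt ((f t - a) * (f t - a) + (g t - b) * (g t - b))).
Proof.
intros Df Dg H; pose proof (sqrt_lt_R0 _ H).
pose proof (is_derive_unique _ _ _ Df) as Ef; pose proof (is_derive_unique _ _ _ Dg) as Eg.
auto_derive.
- repeat split; try (eexists; eassumption); exact H.
- replace (Derive (fun x => f x) t) with lf by (symmetry; exact Ef).
  replace (Derive (fun x => g x) t) with lg by (symmetry; exact Eg).
  unfold Rminus in *; field; lra.
Qed.

Lemma is_derive_edist (gam : R -> plane) (c : plane) (t : R) (l : plane) :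
  is_derive gam t l -> gam t <> c ->
  is_derive (fun u => edist (gam u) c) t
    (((fst (gam t) - fst c) * fst l + (snd (gam t) - snd c) * snd l) / edist (gam t) c).
Proof.
intros Hg Hc; apply (is_derive_sqrt_sum_sqr (fun u => fst (gam u)) (fun u => snd (gam u))).
- apply is_derive_fst, Hg.
- apply is_derive_snd, Hg.
- apply sqrt_lt_0_alt; rewrite sqrt_0; exact (edist_pos _ _ Hc).
Qed.

(** The radicand is twice (m1 + m2)(cosh xi - 1) + h (cosh^2 xi - 1), whose first term is
    positive. *)
Lemma a_fun_pos (m1 m2 h xi : R) : m1 >= m2 -> m2 > 0 -> h >= 0 -> 0 < xi -> 0 < a_fun m1 m2 h xi.
Proof.
intros H1 H2 H3 Hxi; apply sqrt_lt_R0; unfold W1.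
pose proof (cosh_sinh_sqr xi); pose proof (sinh_pos xi Hxi); pose proof (cosh_pos xi).
assert (1 < cosh xi) by (apply Rnot_le_lt; intro; nra).
assert (0 < (m1 + m2) * (cosh xi - 1)) by (apply Rmult_lt_0_compat; lra).
assert (0 <= h * (cosh xi * cosh xi - 1)) by (apply Rmult_le_pos; nra).
lra.
Qed.

(** The two fields have equal norms and opposite eta components, so their normalised sum points
    along decreasing xi. On the boundary [f_gam] is cosh xi, whose gradient points along increasing
    xi; hence the common sign. *)
Lemma Upsilon_f_gam (m1 m2 h : R) (gam : R -> plane) (t : R) :
  m1 >= m2 -> m2 > 0 -> h >= 0 -> C1_curve gam -> off_segment (gam t) ->
  exists kappa, 0 < kappa /\ Upsilon m1 m2 h gam t = kappa * Derive (f_gam gam) t.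
Proof.
intros H1 H2 H3 Hg Hoff.
destruct (Phi_inv_spec _ Hoff) as [Hxi HPhi].
set (q := Phi_inv (gam t)) in *; set (p := gam t) in *.
destruct (edist_Phi q) as [Hr1 Hr2]; rewrite HPhi in Hr1, Hr2.
pose proof (cosh_sinh_sqr (fst q)) as Hch; pose proof (cos_sin_sqr (snd q)) as Hcs.
pose proof (sinh_pos _ Hxi) as HY; pose proof (cosh_pos (fst q)) as HX.
pose proof (COS_bound (snd q)) as Hcb.
pose proof (a_fun_pos m1 m2 h _ H1 H2 H3 Hxi) as Ha.
assert (Hp1 : p <> c1).
{ intro E; apply Hoff; fold p; rewrite E; unfold on_segment, c1; simpl; lra. }
assert (Hp2 : p <> c2).
{ intro E; apply Hoff; fold p; rewrite E; unfold on_segment, c2; simpl; lra. }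
pose proof (edist_pos _ _ Hp1) as Hd1; pose proof (edist_pos _ _ Hp2) as Hd2.
assert (Hdens : 0 < density m1 m2 h p).
{ unfold density, U.
  assert (0 < m1 / edist p c1) by (apply Rdiv_lt_0_compat; lra).
  assert (0 < m2 / edist p c2) by (apply Rdiv_lt_0_compat; lra). lra. }
pose proof (is_derive_edist gam c1 t _ (proj1 (Hg t)) Hp1) as D1.
pose proof (is_derive_edist gam c2 t _ (proj1 (Hg t)) Hp2) as D2.
assert (Df : Derive (f_gam gam) t = / 2 *
  (((fst p + 1) * fst (velocity gam t) + snd p * snd (velocity gam t)) / edist p c1 +
   ((fst p - 1) * fst (velocity gam t) + snd p * snd (velocity gam t)) / edist p c2)).
{ apply is_derive_unique; unfold f_gam.
  apply (is_derive_scal (fun u => edist (gam u) c1 + edist (gam u) c2)).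
  replace (fst p + 1) with (fst (gam t) - fst c1) by (unfold p, c1; simpl; ring).
  replace (fst p - 1) with (fst (gam t) - fst c2) by reflexivity.
  replace (snd p) with (snd (gam t) - snd c1) at 1 by (unfold p, c1; simpl; ring).
  replace (snd p) with (snd (gam t) - snd c2) by (unfold p, c2; simpl; ring).
  apply (is_derive_plus (V := R_NormedModule) (fun u => edist (gam u) c1)
    (fun u => edist (gam u) c2)); assumption. }
set (g1 := fst (velocity gam t)) in *; set (g2 := snd (velocity gam t)) in *.
assert (Ep1 : fst p = cosh (fst q) * cos (snd q)) by (rewrite <- HPhi; reflexivity).
assert (Ep2 : snd p = sinh (fst q) * sin (snd q)) by (rewrite <- HPhi; reflexivity).
set (n := fun sgn => g_norm m1 m2 h p (dPhi q (X_field m1 m2 h sgn q))).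
set (X := cosh (fst q)) in *; set (Y := sinh (fst q)) in *.
set (a := cos (snd q)) in *; set (b := sin (snd q)) in *.
set (A := a_fun m1 m2 h (fst q)) in *; set (B := b_fun m1 m2 h (snd q)).
(* [Phi] is conformal with factor cosh^2 xi - cos^2 eta, and [sgn] enters the norm only through its
   square. *)
assert (Hen : forall sgn, sgn * sgn = 1 ->
  n sgn = sqrt (density m1 m2 h p * ((X * X - a * a) * (A * A + B * B)))).
{ intros sgn Hsgn; unfold n, g_norm, g_inner; fold (density m1 m2 h p); f_equal; f_equal.
  unfold dot, dPhi, X_field; simpl; fold X Y a b A B.
  transitivity ((Y * Y * (a * a) + X * X * (b * b)) * (A * A + sgn * sgn * (B * B))); [ring |].
  rewrite Hsgn; replace (Y * Y) with (X * X - 1) by lra.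
  replace (b * b) with (1 - a * a) by lra; ring. }
assert (Hen2 : n (-1) = n 1) by (rewrite !Hen; [reflexivity | ring | ring]).
assert (HXa : 0 < X * X - a * a).
{ replace (X * X - a * a) with ((X + a) * (X - a)) by ring; rewrite <- Hr1, <- Hr2.
  apply Rmult_lt_0_compat; assumption. }
assert (Hn : 0 < n 1).
{ rewrite Hen by ring; apply sqrt_lt_R0; pose proof (Rle_0_sqr B) as HB; unfold Rsqr in HB.
  assert (0 < A * A) by (apply Rmult_lt_0_compat; assumption).
  apply Rmult_lt_0_compat; [exact Hdens |]; apply Rmult_lt_0_compat; [exact HXa | lra]. }
assert (HU : Upsilon m1 m2 h gam t = density m1 m2 h p * (2 * A / n 1) * (Y * a * g1 + X * b * g2)).
{ assert (EX : forall sgn, hatX m1 m2 h sgn p =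
      ((Y * a * - A - X * b * (sgn * B)) / n sgn, (X * b * - A + Y * a * (sgn * B)) / n sgn))
    by reflexivity.
  unfold Upsilon, hatX_plus, hatX_minus, g_inner; fold p.
  fold (density m1 m2 h p); rewrite !EX, Hen2.
  unfold dot; fold g1 g2; cbn [fst snd]; field; lra. }
(* The last quotient turns the derivative of cosh xi along [gam] into the inner product of the
   velocity with the partial derivative of [Phi] in xi. *)
exists (density m1 m2 h p * (2 * A / n 1) * ((X * X - a * a) / Y)); split.
- apply Rmult_lt_0_compat; [apply Rmult_lt_0_compat |]; try assumption;
    apply Rdiv_lt_0_compat; lra.
- rewrite HU, !Rmult_assoc; do 2 f_equal.
  rewrite Df, Hr1, Hr2, Ep1, Ep2.
  rewrite Hr1 in Hd1; rewrite Hr2 in Hd2.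
  assert (Hk : / 2 * (((X * a + 1) * g1 + Y * b * g2) / (X + a) +
     ((X * a - 1) * g1 + Y * b * g2) / (X - a)) =
     ((X * X - 1) * a * g1 + X * Y * b * g2) / (X * X - a * a)).
  { field; repeat split; lra. }
  rewrite Hk; replace (X * X - 1) with (Y * Y) by lra; field; split; lra.
Qed.

(** * Impacts *)

Lemma dot_abs_le (u v : plane) : Rabs (dot u v) <= enorm u * enorm v.
Proof.
unfold enorm; rewrite <- sqrt_mult_alt, <- sqrt_Rsqr_abs by (unfold dot; nra).
apply sqrt_le_1_alt; unfold Rsqr, dot.
pose proof (Rle_0_sqr (fst u * snd v - snd u * fst v)) as H; unfold Rsqr in H; nra.
Qed.

Lemma lipschitz_of_derivative_bound (f : R -> R) (a b M : R) :
  (forall x, a <= x <= b -> exists d, is_derive f x d /\ Rabs d <= M) ->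
  forall x y, a <= x <= b -> a <= y <= b -> Rabs (f x - f y) <= M * Rabs (x - y).
Proof.
intros Hf x y Hx Hy.
assert (Hmm : forall z, Rmin y x <= z <= Rmax y x -> a <= z <= b).
{ intros z [Hz1 Hz2]; split.
  - apply Rle_trans with (2 := Hz1); apply Rmin_glb; lra.
  - apply Rle_trans with (1 := Hz2); apply Rmax_lub; lra. }
destruct (MVT_gen f y x (Derive f)) as [z [Hz E]].
- intros z Hz; destruct (Hf z) as [d [Hd _]]; [apply Hmm; lra |].
  apply Derive_correct; exists d; exact Hd.
- intros z Hz; destruct (Hf z (Hmm z Hz)) as [d [Hd _]].
  apply continuity_pt_filterlim, (ex_derive_continuous (V := R_NormedModule)); exists d; exact Hd.
- rewrite E, Rabs_mult; apply Rmult_le_compat_r; [apply Rabs_pos |].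
  destruct (Hf z (Hmm z Hz)) as [d [Hd Hb]]; rewrite (is_derive_unique _ _ _ Hd); exact Hb.
Qed.

Lemma derivative_at_right_minimum (f : R -> R) (t b d : R) :
  is_derive f t d -> t < b -> (forall u, t <= u <= b -> f t <= f u) -> 0 <= d.
Proof.
intros Hd Htb Hmin.
assert (H : -1 * (1 * d) <= 0); [| lra].
assert (He : is_derive (fun s => - f s) t (- d)) by exact (is_derive_opp f t d Hd).
replace (-1 * (1 * d)) with (1 * - d) by ring.
apply (derivative_le_of_locally_le (fun s => - f s) t (- d) 1 0 He).
intro eta; pose proof (cond_pos eta).
assert (Hb : 0 < b - t) by lra.
generalize (locally_pos_lt (b - t) 1 Hb); apply filter_imp; intros s Hs Hs0.
assert (f t <= f (t + 1 * s)) by (apply Hmin; lra).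
assert (0 < s * eta) by (apply Rmult_lt_0_compat; assumption); lra.
Qed.

Lemma derivative_at_left_minimum (f : R -> R) (a t d : R) :
  is_derive f t d -> a < t -> (forall u, a <= u <= t -> f t <= f u) -> d <= 0.
Proof.
intros Hd Hat Hmin.
assert (He : is_derive (fun s => f (- s)) (- t) (- d)).
{ replace (- d) with (-1 * d) by ring.
  apply (is_derive_comp (V := R_NormedModule) f (fun s => - s) (- t) d (-1)).
  - rewrite Ropp_involutive; exact Hd.
  - auto_derive; [trivial | ring]. }
assert (0 <= - d); [| lra].
apply (derivative_at_right_minimum _ (- t) (- a) _ He); [lra |].
intros u Hu; rewrite Ropp_involutive; apply Hmin; lra.
Qed.

(** By Pythagoras in the frame of [tau] and [rot90 tau], equal speeds and tangential components
    leave normal components equal up to sign; the sign hypothesis decides. *)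
Lemma reflection_of_equal_tangential (tau vin vout : plane) :
  dot vin vin = dot vout vout -> dot vin tau = dot vout tau ->
  dot vin (rot90 tau) * dot vout (rot90 tau) < 0 ->
  dot vout (rot90 tau) = - dot vin (rot90 tau).
Proof.
intros Hn Ht Hs.
assert (Hpyth : forall v, dot v tau * dot v tau + dot v (rot90 tau) * dot v (rot90 tau) =
  dot v v * dot tau tau) by (intro v; unfold dot, rot90; simpl; ring).
pose proof (Hpyth vin) as E1; pose proof (Hpyth vout) as E2; rewrite Hn, Ht in E1.
set (x := dot vin (rot90 tau)) in *; set (y := dot vout (rot90 tau)) in *.
assert (Hxy : (x - y) * (x + y) = 0) by lra.
apply Rmult_integral in Hxy; destruct Hxy as [H | H]; [exfalso; nra | lra].
Qed.

Lemma in_cut_circle_locally (th0 t : R) :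
  in_cut_circle th0 t -> locally t (in_cut_circle th0).
Proof. intros [H1 H2]; exact (filter_and _ _ (open_gt _ _ H1) (open_lt _ _ H2)). Qed.

Lemma in_I_cut_circle (th0 tm tp t : R) :
  base_point_outside th0 tm tp -> in_I tm tp t -> in_cut_circle th0 t.
Proof. unfold base_point_outside, in_cut_circle, in_I; lra. Qed.

Lemma boundary_off_domain (Om : plane -> Prop) (p : plane) : open Om -> boundary Om p -> ~ Om p.
Proof.
intros HO [_ Hb] Hp; destruct (HO p Hp) as [e He].
destruct (Hb e) as [q [Hq Nq]]; exact (Nq (He q Hq)).
Qed.

(** For a slid endpoint the action is the minimum over competitors with that endpoint, and the cut
    circle is open, so [S] lies below every nearby competitor as the first variation requires. *)
Lemma S_len_derivatives (m1 m2 h : R) (gam : R -> plane) (s : arc_family) (th0 th1 th2 d1 d2 : R)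
    (k : Z) :
  m1 >= m2 -> m2 > 0 -> h >= 0 -> C1_curve gam -> minimising_arcs m1 m2 h gam s ->
  k <> 0%Z -> in_cut_circle th0 th1 -> in_cut_circle th0 th2 ->
  is_derive (fun t => S_len m1 m2 h s k th0 t th2) th1 d1 ->
  is_derive (fun t => S_len m1 m2 h s k th0 th1 t) th2 d2 ->
  let c := s k th0 th1 th2 in
  d1 = - dot (velocity (pos c) 0) (velocity gam th1) /\
  d2 = dot (velocity (pos c) (dur c)) (velocity gam th2).
Proof.
intros H1 H2 H3 Hg Hs Hk Hth1 Hth2 D1 D2 c.
destruct (Hs k th0 th1 th2 Hk Hth1 Hth2) as [Hen [[Hcomp _] _]].
split.
- apply (first_variation_start m1 m2 h gam k th1 th2 d1 c
    (fun t => S_len m1 m2 h s k th0 t th2)); try assumption; [reflexivity |].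
  generalize (in_cut_circle_locally th0 th1 Hth1); apply filter_imp; intros t Ht c' Hc'.
  destruct (Hs k th0 t th2 Hk Ht Hth2) as [_ [[_ Hmin] _]]; apply Hmin, Hc'.
- apply (first_variation_end m1 m2 h gam k th1 th2 d2 c
    (fun t => S_len m1 m2 h s k th0 th1 t)); try assumption; [reflexivity |].
  generalize (in_cut_circle_locally th0 th2 Hth2); apply filter_imp; intros t Ht c' Hc'.
  destruct (Hs k th0 th1 t Hk Hth1 Ht) as [_ [[_ Hmin] _]]; apply Hmin, Hc'.
Qed.

Lemma energy_dot_bound (m1 m2 h : R) (c : curve) (t : R) (w : plane) :
  energy_trajectory m1 m2 h c -> 0 <= t <= dur c ->
  Rabs (dot (velocity (pos c) t) w) <= sqrt (density m1 m2 h (pos c t)) * enorm w.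
Proof.
intros Hc Ht; eapply Rle_trans; [apply dot_abs_le |].
rewrite <- (energy_dot m1 m2 h c t Hc Ht); apply Rle_refl.
Qed.

Theorem theorem3 :
  forall (m1 m2 h : R), m1 >= m2 -> m2 > 0 -> h >= 0 ->
  forall (Om : plane -> Prop) (gam : R -> plane),
    bounded_domain Om ->
    (forall p, on_segment p -> Om p) ->
    ccw_boundary_param Om gam ->
    ~ is_focal_ellipse (boundary Om) ->
  forall s : arc_family, minimising_arcs m1 m2 h gam s ->
  forall (delta0 : R) (k1 : nat), inside_thresholds Om gam s delta0 k1 ->
  forall (delta tm tp th0 : R),
    0 < delta < delta0 -> star gam delta tm tp -> base_point_outside th0 tm tp ->
  forall (eps : R),
    2 * eps = Rmin (Rabs (Upsilon m1 m2 h gam tm)) (Rabs (Upsilon m1 m2 h gam tp)) ->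
  forall k0 : nat, (k1 <= k0)%nat ->
    derivative_threshold m1 m2 h gam s tm tp th0 eps k0 ->
  forall sigma : Z -> nat, (forall i, (k0 <= sigma i)%nat) ->
  exists th : Z -> R,
    (forall i, in_I tm tp (th i)) /\
    complete_billiard_trajectory m1 m2 h Om gam th
      (fun i => s (Z.of_nat (sigma i)) th0 (th i) (th (i + 1)%Z)) /\
    (forall i, winds gam (Z.of_nat (sigma i)) (th i) (th (i + 1)%Z)
                 (s (Z.of_nat (sigma i)) th0 (th i) (th (i + 1)%Z))).
Proof.
intros m1 m2 h H1 H2 H3 Om gam Hbd Hseg Hccw _ s Hs delta0 k1 Hin delta tm tp th0 Hdelta Hstar
  Hbase eps Heps k0 Hk Hthr sigma Hsigma.
assert (Hg : C1_curve gam) by apply Hccw.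
(* The segment lies in the open set [Om], which is disjoint from its boundary. *)
assert (Hoff : forall t, off_segment (gam t)).
{ intros t Hon; destruct Hccw as [_ [_ [_ [_ [Hb _]]]]].
  apply (boundary_off_domain Om (gam t)); [apply Hbd | apply Hb; exists t; reflexivity |].
  apply Hseg, Hon. }
assert (Hc1 : forall t, gam t <> c1).
{ intros t E; apply (Hoff t); rewrite E; unfold on_segment, c1; simpl; lra. }
assert (Hc2 : forall t, gam t <> c2).
{ intros t E; apply (Hoff t); rewrite E; unfold on_segment, c2; simpl; lra. }
destruct Hstar as [Htmp [Hf Hstar]].
assert (Hcut : forall t, in_I tm tp t -> in_cut_circle th0 t)
  by (intros t; apply in_I_cut_circle, Hbase).
assert (Hk0 : forall i, Z.of_nat (sigma i) <> 0%Z).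
{ intro i; destruct Hin as [_ [Hk1 _]]; specialize (Hsigma i); lia. }
pose (c := fun i x y => s (Z.of_nat (sigma i)) th0 x y).
pose (L := fun i x y => S_len m1 m2 h s (Z.of_nat (sigma i)) th0 x y).
assert (Hen : forall i x y, in_I tm tp x -> in_I tm tp y -> energy_trajectory m1 m2 h (c i x y)).
{ intros i x y Hx Hy; apply (Hs (Z.of_nat (sigma i)) th0 x y); auto. }
assert (Hcomp : forall i x y, in_I tm tp x -> in_I tm tp y ->
  competitor gam (Z.of_nat (sigma i)) x y (c i x y)).
{ intros i x y Hx Hy; apply (Hs (Z.of_nat (sigma i)) th0 x y); auto. }
(* Existence of the partial derivatives comes from the threshold hypothesis, their value from the
   first variation; the error bound thereby becomes one on tangential velocities. *)
assert (HD : forall i x y, in_I tm tp x -> in_I tm tp y ->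
  let dx := - dot (velocity (pos (c i x y)) 0) (velocity gam x) in
  let dy := dot (velocity (pos (c i x y)) (dur (c i x y))) (velocity gam y) in
  is_derive (fun t => L i t y) x dx /\ is_derive (fun t => L i x t) y dy /\
  Rabs (dx + g_inner m1 m2 h (gam x) (hatX_plus m1 m2 h (gam x)) (velocity gam x)) <= eps / 2 /\
  Rabs (dy + g_inner m1 m2 h (gam y) (hatX_minus m1 m2 h (gam y)) (velocity gam y)) <= eps / 2).
{ intros i x y Hx Hy dx dy.
  destruct (Hthr (sigma i) x y (Hsigma i) Hx Hy) as [d1 [d2 [D1 [D2 HB]]]].
  destruct (S_len_derivatives m1 m2 h gam s th0 x y d1 d2 (Z.of_nat (sigma i))
    H1 H2 H3 Hg Hs (Hk0 i) (Hcut x Hx) (Hcut y Hy) D1 D2) as [E1 E2].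
  change (d1 = dx) in E1; change (d2 = dy) in E2; subst d1 d2.
  set (u := dx + _) in HB; set (w := dy + _) in HB.
  pose proof (Rabs_pos u); pose proof (Rabs_pos w).
  split; [exact D1 | split; [exact D2 | split; fold u; fold w; lra]]. }
(* Tangential velocities are bounded by speed times |velocity of [gam]|, and the speed at a boundary
   point depends on that point only: one [M] serves all arcs. *)
destruct (continuous_upper_bound
  (fun t => sqrt (density m1 m2 h (gam t)) * enorm (velocity gam t)) tm tp) as [M HM]; [lra | |].
{ intros t _; apply (continuous_mult (K := R_AbsRing)).
  - apply continuous_sqrt_comp; [| apply density_ge_0; assumption].
    apply (continuous_comp gam (density m1 m2 h)); [apply C1_curve_continuous, Hg |].
    apply density_continuous; auto.
  - apply continuous_enorm, Hg. }
assert (HDb : forall i x y, in_I tm tp x -> in_I tm tp y ->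
  Rabs (- dot (velocity (pos (c i x y)) 0) (velocity gam x)) <= M /\
  Rabs (dot (velocity (pos (c i x y)) (dur (c i x y))) (velocity gam y)) <= M).
{ intros i x y Hx Hy; pose proof (Hen i x y Hx Hy) as He; pose proof (proj1 He) as Hd.
  destruct (Hcomp i x y Hx Hy) as [_ [_ [_ [P0 [P1 _]]]]].
  rewrite Rabs_Ropp; split.
  - eapply Rle_trans; [apply (energy_dot_bound m1 m2 h); [exact He | lra] |].
    rewrite P0; apply HM, Hx.
  - eapply Rle_trans; [apply (energy_dot_bound m1 m2 h); [exact He | lra] |].
    rewrite P1; apply HM, Hy. }
destruct (minimising_orbit L tm tp) as [th [Hth Hmin]]; [lra | |].
(* Moving one endpoint at a time needs only the partial derivatives. *)
{ intro i; exists M; intros x y x' y' Hx Hy Hx' Hy'.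
  replace (L i x y - L i x' y') with ((L i x y - L i x' y) + (L i x' y - L i x' y')) by ring.
  eapply Rle_trans; [apply Rabs_triang |]; rewrite Rmult_plus_distr_l; apply Rplus_le_compat.
  - apply (lipschitz_of_derivative_bound (fun t => L i t y) tm tp); try assumption.
    intros t Ht; eexists; split; [apply (HD i t y Ht Hy) | apply (HDb i t y Ht Hy)].
  - apply (lipschitz_of_derivative_bound (fun t => L i x' t) tm tp); try assumption.
    intros t Ht; eexists; split; [apply (HD i x' t Hx' Ht) | apply (HDb i x' t Hx' Ht)]. }
pose (x := fun i => c i (th i) (th (i + 1)%Z)).
assert (Hcrit : forall i, dot (velocity (pos (x (i + 1)%Z)) 0) (velocity gam (th (i + 1)%Z)) =
  dot (velocity (pos (x i)) (dur (x i))) (velocity gam (th (i + 1)%Z))).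
{ intro i; set (j := (i + 1)%Z).
  destruct (HD i (th i) (th j) (Hth i) (Hth j)) as [_ [Din [_ Bin]]].
  destruct (HD j (th j) (th (j + 1)%Z) (Hth j) (Hth (j + 1)%Z)) as [Dout [_ [Bout _]]].
  change (c i (th i) (th j)) with (x i) in Din, Bin; fold (x j) in Dout, Bout.
  set (din := dot (velocity (pos (x i)) (dur (x i))) (velocity gam (th j))) in *.
  set (dout := dot (velocity (pos (x j)) 0) (velocity gam (th j))) in *.
  assert (Dloc : is_derive (local_action L th j) (th j) (din + - dout)).
  { unfold local_action; replace (j - 1)%Z with i by (unfold j; lia).
    apply (is_derive_plus (V := R_NormedModule)); assumption. }
  (* Each of the two adjacent arcs contributes an error of [eps / 2]. *)
  assert (HU : Rabs (din + - dout - Upsilon m1 m2 h gam (th j)) <= eps).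
  { unfold Upsilon; apply Rabs_le_between in Bin; apply Rabs_le_between in Bout.
    apply Rabs_le; lra. }
  apply Rabs_le_between in HU.
  assert (Hright : th j < tp -> 0 <= din + - dout).
  { intro Hlt; apply (derivative_at_right_minimum _ _ tp _ Dloc Hlt).
    intros u Hu; apply Hmin; specialize (Hth j); lra. }
  assert (Hleft : tm < th j -> din + - dout <= 0).
  { intro Hlt; apply (derivative_at_left_minimum _ tm _ _ Dloc Hlt).
    intros u Hu; apply Hmin; specialize (Hth j); lra. }
  destruct (Upsilon_f_gam m1 m2 h gam tm H1 H2 H3 Hg (Hoff tm)) as [km [Hkm Em]].
  destruct (Upsilon_f_gam m1 m2 h gam tp H1 H2 H3 Hg (Hoff tp)) as [kp [Hkp Ep]].
  assert (Um : Upsilon m1 m2 h gam tm < 0) by (rewrite Em; nra).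
  assert (Up : 0 < Upsilon m1 m2 h gam tp) by (rewrite Ep; nra).
  rewrite (Rabs_left _ Um), (Rabs_pos_eq _ (Rlt_le _ _ Up)) in Heps.
  pose proof (Rmin_l (- Upsilon m1 m2 h gam tm) (Upsilon m1 m2 h gam tp)).
  pose proof (Rmin_r (- Upsilon m1 m2 h gam tm) (Upsilon m1 m2 h gam tp)).
  destruct (Hth j) as [Hlo Hhi].
  (* Strictly inside, both one-sided inequalities hold and give criticality. At [tp] the derivative
     would be at least [eps], at [tm] at most [- eps], against the one-sided minimum condition
     there. *)
  destruct Hlo as [Hlo | Hlo], Hhi as [Hhi | Hhi].
  - specialize (Hright Hhi); specialize (Hleft Hlo); lra.
  - specialize (Hleft Hlo); rewrite Hhi in HU; lra.
  - specialize (Hright Hhi); rewrite <- Hlo in HU; lra.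
  - lra. }
assert (Hbil : forall i, billiard_arc Om gam (th i) (th (i + 1)%Z) (x i)).
{ intro i; destruct Hin as [_ [_ Hin]].
  apply (Hin delta tm tp th0 Hdelta); try apply Hth; [| exact Hbase |].
  - split; [exact Htmp | split; [exact Hf | exact Hstar]].
  - specialize (Hsigma i); lia. }
exists th; split; [exact Hth |]; split.
- intro i; fold (x i); fold (x (i + 1)%Z).
  pose proof (Hen i _ _ (Hth i) (Hth (i + 1)%Z)) as Ei; fold (x i) in Ei.
  pose proof (Hen (i + 1)%Z _ _ (Hth (i + 1)%Z) (Hth (i + 1 + 1)%Z)) as Ej.
  fold (x (i + 1)%Z) in Ej.
  pose proof (Hbil i) as Bi; pose proof (Hbil (i + 1)%Z) as Bj.
  pose proof (proj1 Ei) as Di; pose proof (proj1 Ej) as Dj.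
  split; [exact Ei | split; [exact Bi |]].
  split; [apply Hcrit |].
  apply (reflection_of_equal_tangential (velocity gam (th (i + 1)%Z))
    (velocity (pos (x i)) (dur (x i))) (velocity (pos (x (i + 1)%Z)) 0)).
  (* Both squared speeds equal the conformal factor at the common impact point. *)
  + rewrite (energy_dot m1 m2 h (x i) (dur (x i)) Ei (conj (Rlt_le _ _ Di) (Rle_refl _))).
    rewrite (energy_dot m1 m2 h (x (i + 1)%Z) 0 Ej (conj (Rle_refl _) (Rlt_le _ _ Dj))).
    rewrite (proj1 (proj2 Bi)), (proj1 Bj); reflexivity.
  + symmetry; apply Hcrit.
  + apply (incoming_outgoing_normal Om gam (th i) (th (i + 1)%Z) (th (i + 1 + 1)%Z)
      (x i) (x (i + 1)%Z)); try assumption; try apply Bi; try apply Bj.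
    * apply (energy_is_derive m1 m2 h (x i) (dur (x i)) Ei); lra.
    * apply (energy_is_derive m1 m2 h (x (i + 1)%Z) 0 Ej); lra.
- intro i; apply (Hcomp i (th i) (th (i + 1)%Z) (Hth i) (Hth (i + 1)%Z)).
Qed.
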